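(* Let $(X,\mu)$ be a standard non-atomic finite or $\sigma$-finite measure space. Then the group $\mathrm{Aut}(X,\mu)$ of all measure-preserving automorphisms of $(X,\mu)$, equipped with the weak topology, is a Lévy group, and therefore extremely amenable.
   Context: $\mathrm{Aut}(X,\mu)$ is the group of (equivalence classes modulo null sets of) invertible measurable measure-preserving transformations of $X$. The weak topology on it is the one induced by the strong operator topology on the isometry group of $L^p(X,\mu)$ via the representation $\sigma\mapsto (f\mapsto f\circ\sigma^{-1})$, where $1\le p<\infty$ is any (the topology does not depend on $p$). A net $(\mu_\alpha)$ of Borel probability measures on a uniform space $X$ concentrates if for every family of Borel subsets $A_\alpha\subseteq X$ with $\liminf_\alpha\mu_\alpha(A_\alpha)>0$ and every entourage $V$ one has $\mu_\alpha(V[A_\alpha])\to_\alpha 1$, where $V[A]=\{x: \exists a\in A,\ (x,a)\in V\}$. The right uniform structure of a topological group $G$ has as basis the entourages $\{(x,y): xy^{-1}\in V\}$, $V$ a neighbourhood of $e$. A topological group $G$ is a Lévy group if it contains a family $\mathcal K$ of compact subgroups, directed by inclusion, with everywhere dense union in $G$, such that the normalized Haar measures $\mu_K$, $K\in\mathcal K$, concentrate in $G$ with respect to the right uniform structure. A topological group is extremely amenable if every continuous action of it on a (non-empty, Hausdorff) compact space has a fixed point. *)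

(* Defs.v *)
From HB Require Import structures.
From mathcomp Require Import all_boot all_order all_algebra.
From mathcomp Require Import all_classical all_reals all_analysis.
From mathcomp Require Import measurable_realfun.

Set Implicit Arguments.
Unset Strict Implicit.
Unset Printing Implicit Defensive.

Import Order.TTheory GRing.Theory Num.Theory.
Import numFieldNormedType.Exports.

Local Open Scope classical_set_scope.
Local Open Scope ring_scope.

(* The point is not extra structure on a group; it is required by the
   library's generated sigma-algebras. *)
HB.mixin Record isTopologicalGroup G of Group G & PointedTopological G := {
  mulg_continuous : continuous (fun xy : G * G => (xy.1 * xy.2)%g) ;
  invg_continuous : continuous (fun x : G => (x^-1)%g)
}.

#[short(type="topGroupType")]
HB.structure Definition TopologicalGroup :=
  {G of Group G & PointedTopological G & isTopologicalGroup G}.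

Definition right_uniform (G : topGroupType) : Type := G.

Section RightUniform.
Variable G : topGroupType.
Local Open Scope relation_scope.

HB.instance Definition _ := PointedTopological.copy (right_uniform G) G.

Definition right_entourage : set_system (G * G) :=
  filter_from (nbhs (1%g : G)) (fun V => [set xy | V (xy.1 * xy.2^-1)%g]).

Let mulgl_cvg (x y : G) : (fun z : G => x * z)%g @ y --> (x * y)%g.
Proof.
apply: (@continuous_comp _ _ _ (fun z : G => (x, z)) (fun xy => xy.1 * xy.2)%g).
  by apply: cvg_pair; [exact: cvg_cst|exact: cvg_id].
exact: mulg_continuous.
Qed.

Let mulgr_cvg (x y : G) : (fun z : G => z * x)%g @ y --> (y * x)%g.
Proof.
apply: (@continuous_comp _ _ _ (fun z : G => (z, x)) (fun xy => xy.1 * xy.2)%g).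
  by apply: cvg_pair; [exact: cvg_id|exact: cvg_cst].
exact: mulg_continuous.
Qed.

Let right_entourage_filter : Filter right_entourage.
Proof.
apply: filter_from_filter; first by exists setT; exact: filterT.
by move=> V W nV nW; exists (V `&` W) => //; exact: filterI.
Qed.

Let right_entourage_diagonal A : right_entourage A -> diagonal `<=` A.
Proof.
move=> [V nV VA] [x y] /diagonalP <-; apply: VA => /=.
by rewrite mulgV; exact: nbhs_singleton.
Qed.

Let right_entourage_inv A : right_entourage A -> right_entourage A^-1.
Proof.
move=> [V nV VA]; exists [set x | V x^-1%g].
  have : (fun x : G => x^-1)%g @ (1 : G)%g --> (1 : G)%g.
    by rewrite -[X in _ --> X]invg1; exact: invg_continuous.
  exact.
by move=> [x y] /=; rewrite invgM invgK => Vyx; exact: VA.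
Qed.

Let right_entourage_split A : right_entourage A ->
  exists2 B, right_entourage B & B \; B `<=` A.
Proof.
move=> [V nV VA].
have mul1_cvg : (fun xy : G * G => xy.1 * xy.2)%g @ ((1 : G)%g, (1 : G)%g) -->
    (1 : G)%g.
  have := @mulg_continuous G (1%g, 1%g).
  by rewrite /continuous_at [X in _ --> X]mulg1.
move: (mul1_cvg _ nV) => [[W1 W2] /= [nW1 nW2] W12].
exists [set xy | (W1 `&` W2) (xy.1 * xy.2^-1)%g].
  by exists (W1 `&` W2) => //; exact: filterI.
move=> [x y] [z /= [Wx _] [_ Wy]]; apply: VA => /=.
have := W12 ((x * z^-1)%g, (z * y^-1)%g) (conj Wx Wy) => /=.
by rewrite mulgA mulgVK.
Qed.

Let right_entourage_nbhs :
  @nbhs (right_uniform G) (right_uniform G) = nbhs_ right_entourage.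
Proof.
rewrite predeq2E => x A; split.
  move=> nA; exists [set xy | [set u | A (u^-1 * x)%g] (xy.1 * xy.2^-1)%g].
    exists [set u | A (u^-1 * x)%g] => //.
    have : (fun u : G => u^-1 * x)%g @ (1 : G)%g --> (1^-1 * x)%g.
      apply: (@continuous_comp _ _ _ (fun u : G => u^-1)%g (fun u => u * x)%g).
        exact: invg_continuous.
      exact: mulgr_cvg.
    by rewrite invg1 mul1g; exact.
  by move=> y /xsectionP /=; rewrite invgM invgK mulgVK.
move=> [B [V nV VB] BA].
have : (fun y : G => x * y^-1)%g @ (x : G)%g --> (x * x^-1)%g.
  apply: (@continuous_comp _ _ _ (fun u : G => u^-1)%g (fun u => x * u)%g).
    exact: invg_continuous.
  exact: mulgl_cvg.
rewrite mulgV => /(_ _ nV) nx.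
apply: (@filterS _ (nbhs (x : G)) _ _ _ _ nx) => y Vy.
by apply: BA; apply/xsectionP; apply: VB.
Qed.

HB.instance Definition _ := @Nbhs_isUniform.Build (right_uniform G)
  right_entourage right_entourage_filter right_entourage_diagonal
  right_entourage_inv right_entourage_split right_entourage_nbhs.

End RightUniform.

Definition borel (T : ptopologicalType) := g_sigma_algebraType (@open T).

Section Nets.
Variables (I : Type).

(* A net over the set D preordered by le is represented by a function on I;
   only its values on D matter. *)
Definition net_tails (D : set I) (le : I -> I -> Prop) : set_system I :=
  filter_from D (fun i => [set j | D j /\ le i j]).

Definition directed_by (D : set I) (le : I -> I -> Prop) : Prop :=
  D !=set0 /\
  forall i j, D i -> D j -> exists k, [/\ D k, le i k & le j k].

Definition liminf_along (R : realType) (F : set_system I) (u : I -> \bar R) :=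
  ereal_sup [set ereal_inf [set u i | i in T] | T in F].

End Nets.

Definition entourage_nbhd (U : Type) (V : set (U * U)) (A : set U) : set U :=
  [set x | exists2 a, A a & V (x, a)].

(* The sets V[A_i] need not be Borel for an arbitrary entourage V, so the
   condition ranges over the V for which they are.  This loses nothing: every
   entourage contains an open one, and V[A] is open when V is open. *)
Definition concentrates (R : realType) (U : puniformType) (I : Type)
    (F : set_system I) (m : I -> probability (borel U) R) : Prop :=
  forall (A : I -> set (borel U)) (V : set (U * U)),
    (forall i, measurable (A i)) ->
    entourage V ->
    (forall i, measurable (entourage_nbhd V (A i) : set (borel U))) ->
    (0 < liminf_along F (fun i => m i (A i)))%E ->
    m i (entourage_nbhd V (A i)) @[i --> F] --> 1%E.

Section LevyGroups.
Variables (R : realType) (G : topGroupType).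

Definition subgroup (K : set G) : Prop :=
  [/\ K 1%g, forall x y, K x -> K y -> K (x * y)%g & forall x, K x -> K x^-1%g].

(* Normalized Haar measure of K, pushed forward to G: the regular Borel
   probability measure carried by K that is invariant under translations
   by K. *)
Definition haar_probability (K : set G)
    (m : probability (borel (right_uniform G)) R) : Prop :=
  [/\ measurable (K : set (borel (right_uniform G))),
      m K = 1%E,
      forall (k : G) (A : set (borel (right_uniform G))), K k -> measurable A ->
        m ((fun x : G => k * x)%g @^-1` A) = m A
    & forall A : set (borel (right_uniform G)), measurable A ->
        m A = ereal_sup [set m C | C in
          [set C : set G | [/\ compact C, closed C & C `<=` A]]] ].

Definition levy_group : Prop :=
  exists (KK : set (set G))
         (m : set G -> probability (borel (right_uniform G)) R),
  [/\ forall K, KK K -> subgroup K /\ compact K,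
      directed_by KK (fun K L => K `<=` L),
      dense (\bigcup_(K in KK) K),
      forall K, KK K -> haar_probability K (m K)
    & @concentrates R (right_uniform G) _
        (net_tails KK (fun K L => K `<=` L)) m ].

End LevyGroups.

Definition extremely_amenable (G : topGroupType) : Prop :=
  forall (Q : topologicalType) (act : G -> Q -> Q),
    [set: Q] !=set0 -> hausdorff_space Q -> compact [set: Q] ->
    (forall x, act 1%g x = x) ->
    (forall g h x, act (g * h)%g x = act g (act h x)) ->
    continuous (fun gx : G * Q => act gx.1 gx.2) ->
    exists x, forall g, act g x = x.

Definition standard_borel (R : realType) d (X : measurableType d) : Prop :=
  exists (P : completePseudoMetricType R) (phi : X -> P),
  [/\ hausdorff_space P,
      exists2 D : set P, countable D & dense D,
      bijective phi
    & forall A : set X, measurable A <-> measurable (phi @` A : set (borel P)) ].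

Definition is_atom (R : realType) d (X : measurableType d)
    (mu : {measure set X -> \bar R}) (A : set X) : Prop :=
  [/\ measurable A, (0 < mu A)%E &
    forall B, measurable B -> B `<=` A -> mu B = 0%E \/ mu (A `\` B) = 0%E].

Definition non_atomic (R : realType) d (X : measurableType d)
    (mu : {measure set X -> \bar R}) : Prop := forall A, ~ is_atom mu A.

Section MeasurePreserving.
Context (R : realType) d (X : measurableType d).
Variable mu : {measure set X -> \bar R}.

Record mp_transf := MPTransf {
  mp_fun : X -> X ;
  mp_inv : X -> X ;
  mp_funK : cancel mp_fun mp_inv ;
  mp_invK : cancel mp_inv mp_fun ;
  mp_measurable_fun : measurable_fun setT mp_fun ;
  mp_measurable_inv : measurable_fun setT mp_inv ;
  mp_preserving : forall A, measurable A -> mu (mp_fun @^-1` A) = mu A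
}.

HB.instance Definition _ := gen_eqMixin mp_transf.
HB.instance Definition _ := gen_choiceMixin mp_transf.

Lemma mp_preserving_inv (s : mp_transf) A :
  measurable A -> mu (mp_inv s @^-1` A) = mu A.
Proof.
move=> mA; rewrite -(mp_preserving s); last first.
  by rewrite -[_ @^-1` _]setTI; exact: mp_measurable_inv.
by congr (mu _); apply/seteqP; split => x /=; rewrite mp_funK.
Qed.

Definition mp_eq (s t : mp_transf) := `[< mp_fun s = mp_fun t %[ae mu] >].

Let mp_eq_refl : reflexive mp_eq.
Proof. by move=> s; apply/asboolP; exact: aeW. Qed.

Let mp_eq_sym : symmetric mp_eq.
Proof.
by move=> s t; apply/idP/idP => /asboolP st; apply/asboolP;
  apply: filterS st => x /[apply].
Qed.

Let mp_eq_trans : transitive mp_eq.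
Proof.
move=> t s u /asboolP st /asboolP tu; apply/asboolP.
by apply: filterS2 st tu => x st tu Tx; rewrite st// tu.
Qed.

Canonical mp_eq_canonical := EquivRel mp_eq mp_eq_refl mp_eq_sym mp_eq_trans.

Local Open Scope quotient_scope.

Definition mp_aut : Type := {eq_quot mp_eq}.
HB.instance Definition _ := Choice.on mp_aut.
HB.instance Definition _ := EqQuotient.on mp_aut.

Lemma mp_aut_eqP (s t : mp_transf) :
  \pi_mp_aut s = \pi_mp_aut t <-> mp_fun s = mp_fun t %[ae mu].
Proof.
split=> [/eqP|st]; first by rewrite eqmodE => /asboolP.
by apply/eqP; rewrite eqmodE; exact/asboolP.
Qed.

Lemma repr_pi_ae (s : mp_transf) :
  mp_fun (repr (\pi_mp_aut s)) = mp_fun s %[ae mu].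
Proof. by apply/mp_aut_eqP; rewrite reprK. Qed.

Definition mp_id : mp_transf.
Proof.
by apply: (@MPTransf idfun idfun) => //; exact: measurable_id.
Defined.

Definition mp_comp (s t : mp_transf) : mp_transf.
Proof.
apply: (@MPTransf (mp_fun s \o mp_fun t) (mp_inv t \o mp_inv s)).
- by move=> x /=; rewrite !mp_funK.
- by move=> x /=; rewrite !mp_invK.
- by apply: measurableT_comp; exact: mp_measurable_fun.
- by apply: measurableT_comp; exact: mp_measurable_inv.
- move=> A mA; rewrite comp_preimage !mp_preserving//.
  by rewrite -[_ @^-1` _]setTI; exact: mp_measurable_fun.
Defined.

Definition mp_opp (s : mp_transf) : mp_transf.
Proof.
apply: (@MPTransf (mp_inv s) (mp_fun s)).
- exact: mp_invK.
- exact: mp_funK.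
- exact: mp_measurable_inv.
- exact: mp_measurable_fun.
- exact: mp_preserving_inv.
Defined.

Lemma ae_comp (s : mp_transf) (P : X -> Prop) :
  (\forall x \ae mu, P x) -> \forall x \ae mu, P (mp_fun s x).
Proof.
move=> [N [mN N0 PN]]; exists (mp_fun s @^-1` N); split.
- by rewrite -[_ @^-1` _]setTI; exact: mp_measurable_fun.
- by rewrite mp_preserving.
- by move=> x /= nP; exact: PN.
Qed.

Lemma mp_comp_ae s s' t t' :
  mp_fun s = mp_fun s' %[ae mu] -> mp_fun t = mp_fun t' %[ae mu] ->
  mp_fun (mp_comp s t) = mp_fun (mp_comp s' t') %[ae mu].
Proof.
move=> ss' tt'; apply: filterS2 (ae_comp t ss') tt' => x /= e1 e2 _.
by rewrite e1// e2.
Qed.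

Lemma mp_inv_ae s s' : mp_fun s = mp_fun s' %[ae mu] ->
  mp_inv s = mp_inv s' %[ae mu].
Proof.
move=> ss'; apply: filterS (ae_comp (mp_opp s) ss') => x /= /(_ I).
by rewrite mp_invK => e _; rewrite [in RHS]e mp_funK.
Qed.

Definition mp_aut_one : mp_aut := \pi_mp_aut mp_id.
Definition mp_aut_mul (s t : mp_aut) : mp_aut :=
  \pi_mp_aut (mp_comp (repr s) (repr t)).
Definition mp_aut_inv (s : mp_aut) : mp_aut := \pi_mp_aut (mp_opp (repr s)).

Let mp_aut_mulE s t :
  \pi_mp_aut (mp_comp s t) = mp_aut_mul (\pi_mp_aut s) (\pi_mp_aut t).
Proof.
by apply/mp_aut_eqP; apply: mp_comp_ae; apply: ae_eq_sym; exact: repr_pi_ae.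
Qed.

Let mp_aut_mulA : associative mp_aut_mul.
Proof.
elim/quotW => s; elim/quotW => t; elim/quotW => u.
rewrite -(mp_aut_mulE t u) -(mp_aut_mulE s t) -!mp_aut_mulE.
by apply/mp_aut_eqP; exact: aeW.
Qed.

Let mp_aut_mul1 : left_id mp_aut_one mp_aut_mul.
Proof.
by elim/quotW => s; rewrite -mp_aut_mulE; apply/mp_aut_eqP; exact: aeW.
Qed.

Let mp_aut_1mul : right_id mp_aut_one mp_aut_mul.
Proof.
by elim/quotW => s; rewrite -mp_aut_mulE; apply/mp_aut_eqP; exact: aeW.
Qed.

Let mp_aut_invE s : mp_aut_inv (\pi_mp_aut s) = \pi_mp_aut (mp_opp s).
Proof. by apply/mp_aut_eqP; apply: mp_inv_ae; exact: repr_pi_ae. Qed.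

Let mp_aut_mulV : left_inverse mp_aut_one mp_aut_inv mp_aut_mul.
Proof.
elim/quotW => s; rewrite mp_aut_invE -mp_aut_mulE; apply/mp_aut_eqP.
by apply: aeW => x _ /=; rewrite mp_funK.
Qed.

Let mp_aut_Vmul : right_inverse mp_aut_one mp_aut_inv mp_aut_mul.
Proof.
elim/quotW => s; rewrite mp_aut_invE -mp_aut_mulE; apply/mp_aut_eqP.
by apply: aeW => x _ /=; rewrite mp_invK.
Qed.

HB.instance Definition _ := isGroup.Build mp_aut
  mp_aut_mulA mp_aut_mul1 mp_aut_1mul mp_aut_mulV mp_aut_Vmul.
HB.instance Definition _ := isPointed.Build mp_aut mp_aut_one.

End MeasurePreserving.

Arguments mp_fun {R d X mu}.
Arguments mp_inv {R d X mu}.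

Section LpSeminorm.
Context (R : realType) d (X : measurableType d).
Variables (mu : {measure set X -> \bar R}) (p : \bar R) (p1 : (1 <= p)%E).
Local Notation Lp := (LfunType mu p1).

(* LfunType consists of functions rather than classes modulo null sets: its
   topology is that of the seminorm, and L^p is its Hausdorff quotient.  Both
   induce the same topology on anything mapped to them. *)
Definition Lp_ball (f : Lp) (e : R) (g : Lp) : Prop :=
  ('N[mu]_p[EFin \o (f \- g)%R] < e%:E)%E.

Let Lp_ball_center f (e : R) : 0 < e -> Lp_ball f e f.
Proof.
move=> e0; rewrite /Lp_ball (_ : _ \o _ = cst 0%E).
  by rewrite Lnorm0 ?lte_fin// gt_eqF// (lt_le_trans _ p1).
by apply/funext => x /=; rewrite subrr.
Qed.

Let Lp_ball_sym f g (e : R) : Lp_ball f e g -> Lp_ball g e f.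
Proof.
rewrite /Lp_ball (_ : EFin \o (g \- f)%R = (\- (EFin \o (f \- g)%R))%E).
  by rewrite oppe_Lnorm.
by apply/funext => x /=; rewrite -(opprB (f x)).
Qed.

Let Lp_ball_triangle f g h (e1 e2 : R) :
  Lp_ball f e1 g -> Lp_ball g e2 h -> Lp_ball f (e1 + e2) h.
Proof.
rewrite /Lp_ball => fg gh.
rewrite (_ : _ \o _ = EFin \o ((f \- g) \+ (g \- h))%R); last first.
  by apply/funext => x /=; rewrite subrKA.
apply: (le_lt_trans (eminkowski mu _ _ p1)).
- by apply: measurable_funB; exact: measurable_funP.
- by apply: measurable_funB; exact: measurable_funP.
- by rewrite EFinD lteD.
Qed.

HB.instance Definition _ := hasNbhs.Build Lp (nbhs_ (entourage_ Lp_ball)).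
HB.instance Definition _ := @Nbhs_isPseudoMetric.Build R Lp
  (entourage_ Lp_ball) erefl Lp_ball Lp_ball_center Lp_ball_sym
  Lp_ball_triangle erefl.

End LpSeminorm.

Section WeakTopology.
Context (R : realType) d (X : measurableType d).
Variables (mu : {measure set X -> \bar R}) (p : R) (p1 : (1 <= p%:E)%E).
Local Notation Lp := (LfunType mu p1).

Let p_gt0 : 0 < p.
Proof. by rewrite (lt_le_trans ltr01)// -lee_fin. Qed.

Lemma Lnorm_comp_mp_inv (s : mp_transf mu) (f : X -> R) :
  measurable_fun setT f ->
  ('N[mu]_p%:E[EFin \o (f \o mp_inv s)] = 'N[mu]_p%:E[EFin \o f])%E.
Proof.
move=> mf; rewrite unlock /Lnorm; congr (_ `^ _)%E.
have mnf : measurable_fun setT (fun x => `|(f x)%:E| `^ p)%E.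
  apply: (@measurableT_comp _ _ _ _ _ _ (fun x => x `^ p)%E) => //=.
    exact: measurable_poweR.
  by apply/measurable_EFinP => /=; exact: measurableT_comp.
transitivity (\int[pushforward mu (mp_inv s)]_x (`|(f x)%:E| `^ p))%E.
  rewrite ge0_integral_pushforward//; first exact: mp_measurable_inv.
  by move=> x _; exact: poweR_ge0.
apply: (eq_measure_integral mu) => [|minv A mA _]; first exact: mp_measurable_inv.
exact: (mp_preserving_inv s mA).
Qed.

Lemma koopman_subproof (s : mp_transf mu) (f : Lp) :
  ((f : X -> R) \o mp_inv s) \in Lfun mu p%:E.
Proof.
apply/andP; split; rewrite inE /=.
  apply: measurableT_comp; first exact: measurable_funP.
  exact: mp_measurable_inv.
rewrite /finite_norm Lnorm_comp_mp_inv; last exact: measurable_funP.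
exact: Lfunction_finite.
Qed.

Definition koopman (s : mp_aut mu) (f : Lp) : Lp :=
  Lfun_Sub p1 (koopman_subproof (repr s) f).

(* {ptws Lp -> Lp} carries the strong operator topology *)
Definition weak_aut : Type :=
  initial_topology (koopman : mp_aut mu -> {ptws Lp -> Lp}).

HB.instance Definition _ := Group.copy weak_aut (mp_aut mu).
HB.instance Definition _ := PointedTopological.copy weak_aut
  (initial_topology (koopman : mp_aut mu -> {ptws Lp -> Lp})).

Lemma weak_aut_cvgP (F : set_system weak_aut) (s : weak_aut) : Filter F ->
  F --> s <-> forall f : Lp, koopman t f @[t --> F] --> koopman s f.
Proof.
move=> FF; pose K : weak_aut -> {ptws Lp -> Lp} := koopman.
split=> [Fs f|Fs].
  have KF : K @ F --> K s.
    apply: cvg_trans (cvg_app K Fs) _.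
    exact: (@initial_continuous _ _ (koopman : _ -> {ptws Lp -> Lp})).
  by move/pointwise_cvgP: KF; exact.
have {}Fs : K @ F --> K s by apply/pointwise_cvgP => f; exact: Fs.
move=> A [B [[C oC <-] Cs CA]].
by apply: filterS CA _; apply: Fs; exact: open_nbhs_nbhs.
Qed.

Let weak_aut_near T (F : set_system T) (h : T -> weak_aut) (s : weak_aut) :
  Filter F -> h @ F --> s -> forall (f : Lp) e, 0 < e ->
  \forall x \near F, ball (koopman s f) e (koopman (h x) f).
Proof.
move=> FF hs f e e0.
by have := (weak_aut_cvgP s (fmap_filter h FF)).1 hs f => /cvg_ballP; apply.
Qed.

Let ball_ae (f f' g g' : Lp) e :
  (f : X -> R) = f' %[ae mu] -> (g : X -> R) = g' %[ae mu] ->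
  ball f e g -> ball f' e g'.
Proof.
move=> ff' gg'; rewrite /ball /= /Lp_ball unlock /Lnorm.
have mfg (h k : Lp) :
    measurable_fun setT (fun x => `|(EFin \o (h \- k)%R) x| `^ p)%E.
  apply: (@measurableT_comp _ _ _ _ _ _ (fun x => x `^ p)%E) => //=.
    exact: measurable_poweR.
  apply/measurable_EFinP => /=; apply: measurableT_comp => //.
  by apply: measurable_funB; exact: measurable_funP.
rewrite [X in (X `^ _ < _)%E -> _](ge0_ae_eq_integral _ (mfg f g) (mfg f' g'))//.
- by move=> x _; exact: poweR_ge0.
- by move=> x _; exact: poweR_ge0.
- by apply: filterS2 ff' gg' => x /= e1 e2 _; rewrite e1// e2.
Qed.

Let koopman_ball (s : mp_aut mu) (f g : Lp) e :
  ball (koopman s f) e (koopman s g) <-> ball f e g.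
Proof.
rewrite /ball /= /Lp_ball.
rewrite (_ : EFin \o _ = EFin \o ((f \- g)%R \o mp_inv (repr s)))//.
by rewrite Lnorm_comp_mp_inv.
Qed.

Let koopmanM (s t : mp_aut mu) (f : Lp) :
  (koopman (s * t)%g f : X -> R) = koopman s (koopman t f) %[ae mu].
Proof.
have : mp_inv (repr (s * t)%g) = mp_inv (mp_comp (repr s) (repr t)) %[ae mu].
  by apply: mp_inv_ae; exact: repr_pi_ae.
by apply: filterS => x /[apply] /= ->.
Qed.

Let koopmanVK (s : mp_aut mu) (f : Lp) :
  (koopman s (koopman s^-1%g f) : X -> R) = f %[ae mu].
Proof.
apply: ae_eq_trans (ae_eq_sym (koopmanM s s^-1%g f)) _; rewrite mulgV.
have : mp_inv (repr (1 : mp_aut mu)%g) = mp_inv (mp_id mu) %[ae mu].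
  by apply: mp_inv_ae; exact: repr_pi_ae.
by apply: filterS => x /[apply] /= ->.
Qed.

Let weak_mulg_continuous :
  continuous (fun st : weak_aut * weak_aut => (st.1 * st.2)%g).
Proof.
move=> [s t]; apply/weak_aut_cvgP => f; apply/cvg_ballP => e e0.
rewrite !near_simpl /=.
have e20 : 0 < e / 2 by rewrite divr_gt0.
have hs := weak_aut_near _ (@cvg_fst _ _ (nbhs s) (nbhs t) _) (koopman t f) e20.
have ht := weak_aut_near _ (@cvg_snd _ _ (nbhs s) (nbhs t) _) f e20.
apply: (@filterS2 _ (filter_prod (nbhs s) (nbhs t)) _ _ _ _ _ (hs _ _) (ht _ _)).
move=> -[s' t'] /= {}hs {}ht.
apply: (ball_ae (ae_eq_sym (koopmanM s t f)) (ae_eq_sym (koopmanM s' t' f))).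
by apply: ball_split hs _; apply/koopman_ball.
Qed.

Let weak_invg_continuous : continuous (fun s : weak_aut => s^-1%g).
Proof.
move=> s; have Fs : ProperFilter (nbhs s) := nbhs_pfilter s.
apply/(weak_aut_cvgP _ (fmap_filter _ _)) => f; apply/cvg_ballP => e e0.
rewrite !near_simpl /=.
have hs := weak_aut_near _ (@cvg_id _ (nbhs s)) (koopman s^-1%g f) e0.
apply: (@filterS _ (nbhs s) _ _ _ _ (hs _)) => t /ball_sym {}hs.
apply/(koopman_ball t); apply: (ball_ae (ae_eq_refl _ _ _) _ hs).
exact: ae_eq_trans (koopmanVK s f) (ae_eq_sym (koopmanVK t f)).
Qed.

HB.instance Definition _ := isTopologicalGroup.Build weak_aut
  weak_mulg_continuous weak_invg_continuous.

End WeakTopology.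

(* Main.v *)
(* A Borel isomorphism with a Polish space embeds X in R by a binary code of a
   countable base, with a measurable left inverse; translating the pieces of finite
   measure to disjoint intervals and composing with the distribution function
   identifies (X, mu), up to null sets, with the interval [0, mu(X)[ under Lebesgue
   measure.  Cut [0, L_n c[ into N_n cells of width w_n = c / 4^n: the permutations
   of the cells by translations form an increasing sequence of finite subgroups,
   with N_n w_n^2 -> 0.

   Density: a basic weak neighbourhood of g constrains the images of finitely many
   cells of a level m up to a small measure.  At a fine level n, these images are
   almost unions of cells, with almost as many cells as their sources, so that some
   permutation of the cells follows g.

   Concentration: on S_N with the Hamming distance, the variance of a 1-Lipschitz
   function is at most 9N; applied to the distance to A, it shows that two sets at
   distance t satisfy |A| |B| t^2 <= 9 N (N!)^2.  Permutations at distance at most t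
   differ on a set of measure t w_n, which may be of constant size while
   N_n / t^2 -> 0.

   Fixed point: let a Levy group act on Q, and push its Haar measures to Q along the
   orbit of x0.  By compactness, some x has no neighbourhood W of measure tending to 0
   along an ultrafilter.  If V W is contained in U, concentration then gives U measure
   more than 1/2 eventually; so every k in the compact subgroups fixes x, since
   otherwise disjoint neighbourhoods of x and k x would both have measure more
   than 1/2. *)

Require Import Defs.
From HB Require Import structures.
From mathcomp Require Import all_fingroup.
From mathcomp Require Import all_boot all_order all_algebra.
From mathcomp Require Import ring lra zify.

Set Implicit Arguments.
Unset Strict Implicit.
Unset Printing Implicit Defensive.

Import Order.TTheory GRing.Theory Num.Theory.

Local Open Scope ring_scope.

(** * Concentration and matchings in symmetric groups *)

(** The group consists of classes of everywhere defined bijections, whereas the identification with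
    an interval is invertible only almost everywhere. The interval exchanges are therefore
    transported to an invariant set of full measure and extended by the identity: products, inverses
    and cells then behave exactly, not just up to null sets. A fixed measure [dl] of moved points
    amounts to about [dl / w] cells, so the variance bound is governed by [N w^2 / dl^2]. For finite
    mass [N w] is constant and this tends to 0 by itself; for infinite mass the cells must also
    spread over the whole half-line, and the widths have to shrink faster than the number of cells
    grows. The right uniformity measures [x y^-1], and the Hamming distance is invariant under
    translations on both sides; this is how one passes to the other. The net in the definition of a
    Levy group is indexed by the subgroups themselves. Different levels may yield the same subgroup,
    so the uniform measures of such levels have to be identified. *)

Section FiniteVariance.
Variable R : realDomainType.

(* [#|S| ^ 2] times the variance of [f] on [S]. *)
Definition fvar (I : finType) (S : {set I}) (f : I -> R) : R :=
  #|S|%:R * (\sum_(i in S) f i ^+ 2) - (\sum_(i in S) f i) ^+ 2.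

(** The second moment about any point [a] exceeds the variance by the square of the shifted mean,
    which is simply dropped. *)
Lemma fvar_le (I : finType) (S : {set I}) (f : I -> R) (a b : R) : 0 <= b ->
  (forall i, i \in S -> `|f i - a| <= b) -> fvar S f <= (#|S|%:R * b) ^+ 2.
Proof.
move=> b0 fab; rewrite /fvar.
have -> : #|S|%:R * (\sum_(i in S) f i ^+ 2) - (\sum_(i in S) f i) ^+ 2 =
    #|S|%:R * (\sum_(i in S) (f i - a) ^+ 2) -
    (\sum_(i in S) f i - #|S|%:R * a) ^+ 2.
  under [in RHS]eq_bigr do rewrite sqrrB.
  rewrite big_split/= sumrB sumrMnl -mulr_suml sumr_const -(mulr_natr (a ^+ 2)).
  by ring.
rewrite (le_trans (_ : _ <= #|S|%:R * \sum_(i in S) (f i - a) ^+ 2))//.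
  by rewrite gerBl sqr_ge0.
rewrite exprMn [in leRHS]expr2 -mulrA ler_wpM2l//.
rewrite (le_trans (_ : _ <= \sum_(i in S) b ^+ 2))//.
  apply: ler_sum => i iS; rewrite -real_normK ?num_real//.
  by rewrite ler_sqr ?nnegrE//; exact: fab.
by rewrite sumr_const mulr_natl.
Qed.

(** Writing the variance over pairs of points lets two sets that are far apart be seen directly as a
    lower bound for it. *)
Lemma fvar_sum_sqr (I : finType) (S : {set I}) (f : I -> R) :
  \sum_(i in S) \sum_(j in S) (f i - f j) ^+ 2 = 2 * fvar S f.
Proof.
under eq_bigr => i _.
  under eq_bigr do rewrite sqrrB.
  rewrite big_split/= sumrB sumrMnl sumr_const -mulr_natl.
  over.
rewrite big_split/= sumrB sumrMnl -mulr_sumr -big_distrlr/= sumr_const /fvar.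
by ring.
Qed.

End FiniteVariance.

Section HammingConcentration.
Variable N : nat.
Implicit Types (s t u : 'S_N).

Definition ham s t : nat := #|[set i | s i != t i]|.

Lemma hamss s : ham s s = 0%N.
Proof. by apply: eq_card0 => i; rewrite !inE eqxx. Qed.

Lemma ham_sym s t : ham s t = ham t s.
Proof. by apply: eq_card => i; rewrite !inE eq_sym. Qed.

Lemma ham_triangle s t u : (ham s u <= ham s t + ham t u)%N.
Proof.
apply: leq_trans (leq_card_setU _ _); apply/subset_leq_card/subsetP => i.
by rewrite !inE; apply: contraR; rewrite negb_or !negbK => /andP[/eqP-> /eqP->].
Qed.

Lemma ham_mulr s t u : ham (s * u)%g (t * u)%g = ham s t.
Proof. by apply: eq_card => i; rewrite !inE !permM (inj_eq perm_inj). Qed.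

Lemma ham_mull s t u : ham (u * s)%g (u * t)%g = ham s t.
Proof.
rewrite /ham -(card_imset _ (@perm_inj _ u)); apply: eq_card => i; rewrite inE.
apply/imsetP/idP => [[j] + ->|neq]; first by rewrite inE !permM.
exists (u^-1%g i); last by rewrite permKV.
by rewrite inE !permM permKV.
Qed.

Definition hlip (f : 'S_N -> int) :=
  forall s t, `|f s - f t| <= (ham s t)%:R.

(** The symmetric group on the first [k] points, inside ['S_N]: these subgroups form the chain from
    1 to ['S_N] along which the variance is estimated. *)
Definition fixing (k : nat) : {set 'S_N} :=
  [set s : 'S_N | [forall i : 'I_N, (k <= i)%N ==> (s i == i)]].

Lemma fixingP k s :
  reflect (forall i : 'I_N, (k <= i)%N -> s i = i) (s \in fixing k).
Proof.
rewrite inE; apply: (iffP forallP) => [h i ki|h i].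
  by move: (h i); rewrite ki => /eqP.
by apply/implyP => /h /eqP.
Qed.

Lemma fixing0 : fixing 0 = [set 1%g].
Proof.
apply/setP => s; rewrite !inE -[_ == _]/(s == 1%g).
apply/forallP/eqP => [h|-> i]; last by rewrite perm1 eqxx implybT.
by apply/perm.permP => i; rewrite perm1; apply/eqP/h.
Qed.

Lemma fixingN : fixing N = setT.
Proof. by apply/setP => s; rewrite in_setT; apply/fixingP => i; rewrite leqNgt ltn_ord. Qed.

(** Coset decomposition by the image [j] of the point [k]: as products apply the left factor first,
    [s * tperm j k] sends [k] to [j] when [s] fixes [k]. *)
Lemma big_fixingS (V : nmodType) (k : 'I_N) (h : 'S_N -> V) :
  \sum_(s in fixing k.+1) h s =
  \sum_(j in [set j : 'I_N | (j <= k)%N]) \sum_(s in fixing k) h (s * tperm j k)%g.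
Proof.
rewrite (partition_big (fun s => s k) (mem [set j : 'I_N | (j <= k)%N]))/=; last first.
  move=> s /fixingP fs; rewrite inE leqNgt; apply/negP => kj.
  by have /perm_inj e := fs (s k) kj; rewrite e ltnn in kj.
apply: eq_bigr => j; rewrite inE => jk.
rewrite (reindex_inj (mulIg (tperm j k))) /=; apply: eq_bigl => s.
apply/andP/idP => [[/fixingP fs /eqP sk]|/fixingP fs].
  have sk' : s k = k.
    by apply: (@perm_inj _ (tperm j k)); rewrite -permM sk tpermR.
  apply/fixingP => i; rewrite leq_eqVlt => /orP[/eqP/val_inj <- //|ki].
  apply: (@perm_inj _ (tperm j k)); rewrite -permM fs// tpermD// -val_eqE/=; lia.
split; last by rewrite permM fs// tpermR.
apply/fixingP => i ki; rewrite permM fs 1?ltnW// tpermD// -val_eqE/=; lia.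
Qed.

(** The two transpositions agree off [i], [j] and [k]. The square of this 3 is the 9 of the
    concentration inequality. *)
Lemma ham_tperm s (i j k : 'I_N) :
  (ham (s * tperm i k) (s * tperm j k) <= 3)%N.
Proof.
rewrite ham_mull (@leq_trans #|[set i; j; k]|)//; last first.
  by rewrite -setUA cardsU1 cards2; case: (_ \notin _); case: (_ != _).
apply/subset_leq_card/subsetP => l; rewrite !inE; apply: contraR.
by rewrite !negb_or => /andP[/andP[li lj] lk]; rewrite !tpermD// eq_sym.
Qed.

(* Decomposing by the image of the point [k], the variance grows at each step by
   that of the conditional means, which are pairwise at distance at most 3. *)
Lemma fvar_fixing_le (k : nat) (f : 'S_N -> int) : (k <= N)%N -> hlip f ->
  fvar (fixing k) f <= (9 * k)%:R * #|fixing k|%:R ^+ 2.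
Proof.
elim: k f => [|k IH] f kN flip.
  by rewrite fixing0 /fvar cards1 !big_set1; lia.
pose k' := Ordinal kN.
pose J := [set j : 'I_N | (j <= k')%N].
pose fj (j : 'I_N) s := f (s * tperm j k')%g.
pose A j := \sum_(s in fixing k) fj j s.
have cardS : #|fixing k.+1| = (#|J| * #|fixing k|)%N.
  rewrite -sum1_card (@big_fixingS _ k')/= -sum_nat_const; apply: eq_bigr => j _.
  by rewrite sum1_card.
have -> : fvar (fixing k.+1) f =
    #|J|%:R * (\sum_(j in J) fvar (fixing k) (fj j)) + fvar J A.
  rewrite /fvar cardS !(@big_fixingS _ k')/= sumrB -mulr_sumr natrM.
  by rewrite /A /fj /J /=; ring.
have jlip j : hlip (fj j) by move=> s t; rewrite /fj -(ham_mulr s t (tperm j k')).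
have fvarA : fvar J A <= (#|J|%:R * (3 * #|fixing k|%:R)) ^+ 2.
  apply: (@fvar_le _ _ _ _ (A k')); first by rewrite mulr_ge0.
  move=> j _; rewrite /A -sumrB (le_trans (ler_norm_sum _ _ _))//.
  rewrite mulr_natr -sumr_const.
  by apply: ler_sum => s _; rewrite (le_trans (flip _ _))// ler_nat ham_tperm.
have fvarB : \sum_(j in J) fvar (fixing k) (fj j) <=
    #|J|%:R * ((9 * k)%:R * #|fixing k|%:R ^+ 2).
  rewrite mulr_natl -sumr_const; apply: ler_sum => j _.
  by apply: IH => //; exact: ltnW.
rewrite (le_trans (lerD (ler_wpM2l _ fvarB) fvarA))// cardS mulnS.
rewrite !natrD !natrM; lia.
Qed.

Lemma ham_concentration (A B : {set 'S_N}) (t : nat) :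
  (forall a b, a \in A -> b \in B -> (t <= ham a b)%N) ->
  (#|A| * #|B| * t ^ 2 <= 9 * N * (N`!) ^ 2)%N.
Proof.
move=> AB; have [->|[a0 a0A]] := set_0Vmem A; first by rewrite cards0.
pose d s := ham s [arg min_(a < a0 in A) ham s a].
have dA a : a \in A -> d a = 0%N.
  move=> aA; rewrite /d; case: arg_minnP => // i iA /(_ a aA).
  by rewrite hamss leqn0 => /eqP.
have dB b : b \in B -> (t <= d b)%N.
  by move=> bB; rewrite /d; case: arg_minnP => // i iA _; rewrite ham_sym AB.
have dlip s u : (d s <= d u + ham s u)%N.
  rewrite {2}/d /d; case: arg_minnP => // i iA mi; case: arg_minnP => // j jA mj.
  by rewrite (leq_trans (mi j jA))// addnC ham_triangle.
pose f s : int := (d s)%:R.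
have flip : hlip f.
  move=> s u; rewrite /f; have := dlip s u; have := dlip u s.
  by rewrite (ham_sym u s); lia.
have := fvar_fixing_le (leqnn N) flip; rewrite fixingN cardsT card_Sn => fvarT.
(* Each pair of a point of [A] and a point of [B] occurs in both orders, which balances the factor 2
   of [fvar_sum_sqr]. For [0 < t] the sets are disjoint, so no ordered pair is used twice. *)
have : \sum_(s in A) \sum_(u in B) (t%:R : int) ^+ 2 +
       \sum_(s in B) \sum_(u in A) (t%:R : int) ^+ 2 <=
       \sum_(s in [set: 'S_N]) \sum_(u in [set: 'S_N]) (f s - f u) ^+ 2.
  have [->|t0] := posnP t.
    have z (X Y : {set 'S_N}) :
        \sum_(s in X) \sum_(u in Y) (0%:R : int) ^+ 2 = 0.
      by rewrite big1// => *; rewrite big1.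
    rewrite !z addr0.
    by apply: sumr_ge0 => *; apply: sumr_ge0 => *; exact: sqr_ge0.
  have AdB s : s \in A -> s \in B -> False by move=> /dA e /dB; lia.
  rewrite [leRHS](bigID (mem A))/= lerD//.
    rewrite [leRHS](eq_bigl (mem A)); last by move=> s; rewrite inE.
    apply: ler_sum => s sA; rewrite [leRHS](bigID (mem B))/= ler_wpDr//.
      by apply: sumr_ge0 => *; exact: sqr_ge0.
    rewrite [leRHS](eq_bigl (mem B)); last by move=> u; rewrite inE.
    apply: ler_sum => u uB.
    by rewrite /f (dA s)// mulr0n sub0r sqrrN ler_sqr ?nnegrE// ler_nat dB.
  rewrite [leRHS](bigID (mem B))/= ler_wpDr//.
    by apply: sumr_ge0 => *; apply: sumr_ge0 => *; exact: sqr_ge0.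
  rewrite [leRHS](eq_bigl (mem B)); last first.
    by move=> s; rewrite !inE; case: (boolP (s \in A)) => //= sA;
       case: (boolP (s \in B)) => // sB; have := AdB _ sA sB.
  apply: ler_sum => s sB; rewrite [leRHS](bigID (mem A))/= ler_wpDr//.
    by apply: sumr_ge0 => *; exact: sqr_ge0.
  rewrite [leRHS](eq_bigl (mem A)); last by move=> u; rewrite inE.
  apply: ler_sum => u uA.
  by rewrite /f (dA u)// mulr0n subr0 ler_sqr ?nnegrE// ler_nat dB.
rewrite fvar_sum_sqr !sumr_const -!mulrnA => vge.
have {vge} := le_trans vge (ler_wpM2l (ler0n _ 2) fvarT).
rewrite -mulrnDr -[leLHS]mulr_natr -!natrX -!natrM ler_nat; lia.
Qed.

End HammingConcentration.

Section MatchingPermutation.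
Variables (I J : finType) (beta phi : I -> option J).

Definition matched (s : {perm I}) := [set x | (beta x != None) && (phi (s x) == beta x)].

(* A permutation with the most matches: otherwise a transposition would add one. *)
Lemma matching_perm : exists s : {perm I}, forall j : J,
  (minn #|[set x | beta x == Some j]| #|[set x | phi x == Some j]| <=
   #|[set x | (beta x == Some j) && (phi (s x) == Some j)]|)%N.
Proof.
pose s := [arg max_(s > (1%g : {perm I})) #|matched s|].
have smax u : (#|matched u| <= #|matched s|)%N.
  by rewrite /s; case: arg_maxnP => // i _ /(_ u isT).
exists s => j; rewrite leqNgt; apply/negP; rewrite leq_min => /andP[lb lp].
have [x bx px] : exists2 x, beta x = Some j & phi (s x) <> Some j.
  have /subsetPn[x] : ~~ ([set x | beta x == Some j] \subset
      [set x | (beta x == Some j) && (phi (s x) == Some j)]).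
    by apply/negP => /subset_leq_card; lia.
  by rewrite !inE => /eqP bx; rewrite bx eqxx /= => /eqP; exists x.
have [y py bz] : exists2 y, phi y = Some j & beta (s^-1%g y) <> Some j.
  have /subsetPn[y] : ~~ ([set x | phi x == Some j] \subset
      [set s x | x in [set x | (beta x == Some j) && (phi (s x) == Some j)]]).
    by apply/negP => /subset_leq_card; rewrite card_imset; [lia|exact: perm_inj].
  rewrite !inE => /eqP py ny; exists y => // bz; case/negP: ny.
  by apply/imsetP; exists (s^-1%g y); rewrite ?inE permKV// bz py eqxx.
(* The transposition changes the images of [x] and of [s^-1 y] only. Neither was matched, so no
   match is lost, and [x], now sent to [y], becomes matched. *)
have := smax (s * tperm (s x) y)%g; rewrite leqNgt => /negP; apply.
apply: proper_card; apply/properP; split.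
  apply/subsetP => z; rewrite !inE => /andP[bz0 /eqP pz]; rewrite bz0 permM/=.
  case: tpermP => [/perm_inj zx|szy|_ _]; last exact/eqP.
  - by move: px; rewrite -zx pz zx bx.
  - by move: bz; rewrite -szy permK -pz szy py.
exists x; rewrite !inE bx /=; first by rewrite permM tpermL py.
exact/eqP.
Qed.

End MatchingPermutation.

From mathcomp Require Import all_classical all_reals all_analysis.
From mathcomp Require Import measurable_realfun.

Import numFieldNormedType.Exports.

Local Open Scope classical_set_scope.
Local Open Scope ring_scope.

(** * Fixed points of Levy groups *)

Lemma open_borel (T : ptopologicalType) (A : set T) :
  open A -> measurable (A : set (borel T)).
Proof. by move=> oA; exact: sub_sigma_algebra. Qed.

Section LevyFixedPoint.
Variables (R : realType) (G : topGroupType).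
Variables (KK : set (set G)) (m : set G -> probability (borel (right_uniform G)) R).
Hypothesis KK_directed : directed_by KK (fun K L => K `<=` L).
Hypothesis KK_dense : dense (\bigcup_(K in KK) K).
Hypothesis KK_haar : forall K, KK K -> haar_probability K (m K).
Hypothesis KK_conc :
  @concentrates R (right_uniform G) _ (net_tails KK (fun K L => K `<=` L)) m.

Variables (Q : topologicalType) (act : G -> Q -> Q) (x0 : Q).
Hypothesis Q_hausdorff : hausdorff_space Q.
Hypothesis Q_compact : compact [set: Q].
Hypothesis act1 : forall x, act 1%g x = x.
Hypothesis actM : forall g h x, act (g * h)%g x = act g (act h x).
Hypothesis act_cont : continuous (fun gx : G * Q => act gx.1 gx.2).

Let tails := net_tails KK (fun K L => K `<=` L).

Let tails_filter : ProperFilter tails.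
Proof.
have [[K0 KK0] dir] := KK_directed.
eapply @filter_from_proper; last by move=> K KKK; exists K; split.
apply: filter_from_filter; first by exists K0.
move=> K L KKK KKL; have [M [KKM KM LM]] := dir _ _ KKK KKL.
exists M => // N [KKN MN]; split; split => //; exact: subset_trans MN.
Qed.

#[local] Instance tails_isfilter : Filter tails := @filter_filter _ _ tails_filter.

Let nu (K : set G) (W : set Q) : \bar R := m K [set g | W (act g x0)].

Let act_continuousl x : continuous (fun g => act g x).
Proof.
move=> g; apply: (@continuous_comp _ _ _ (fun g => (g, x)) (fun gx => act gx.1 gx.2)).
  by apply: cvg_pair; [exact: cvg_id|exact: cvg_cst].
exact: act_cont.
Qed.

Let act_continuousr g : continuous (act g).
Proof.
move=> x; apply: (@continuous_comp _ _ _ (fun x => (g, x)) (fun gx => act gx.1 gx.2)).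
  by apply: cvg_pair; [exact: cvg_cst|exact: cvg_id].
exact: act_cont.
Qed.

Let orbit_open W : open W -> open [set g | W (act g x0)].
Proof. by move=> oW; apply: open_comp => // g _; exact: act_continuousl. Qed.

Let orbit_measurable W : open W ->
  measurable ([set g | W (act g x0)] : set (borel (right_uniform G))).
Proof. by move=> oW; apply: open_borel; exact: orbit_open. Qed.

(** Which alternative holds may depend on [K]; an ultrafilter will decide between them. *)
Let small_or_expanding (V : set G) (W U : set Q) (a : R) :
  0 < a -> open V -> V 1%g -> open W -> open U ->
  (forall g x, V g -> W x -> U (act g x)) ->
  tails [set K | (nu K W < a%:E)%E \/ (2^-1%:E < nu K U)%E].
Proof.
move=> a0 oV V1 oW oU VWU.
(* Concentration requires a positive lower limit of the measures. Where [W] has measure less than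
   [a], the set is replaced by [setT], of measure 1; the conclusion is then used only for the other
   [K]. *)
pose A (K : set G) : set (borel (right_uniform G)) :=
  if (a%:E <= nu K W)%E then [set g | W (act g x0)] else setT.
pose E : set (right_uniform G * right_uniform G) := [set xy | V (xy.1 * xy.2^-1)%g].
have oE (B : set G) : open (entourage_nbhd E B : set G).
  have -> : entourage_nbhd E B = \bigcup_(b in B) [set g | V (g * b^-1)%g].
    by apply/seteqP; split=> x [b Bb Vb]; exists b.
  apply: bigcup_open => b _; apply: (@open_comp _ _ (fun g => g * b^-1)%g) => // g _.
  apply: (@continuous_comp _ _ _ (fun z : G => (z, b^-1)%g) (fun xy => xy.1 * xy.2)%g).
    by apply: cvg_pair; [exact: cvg_id|exact: cvg_cst].
  exact: mulg_continuous.
have mA K : measurable (A K).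
  by rewrite /A; case: ifP => _ //; exact: orbit_measurable.
have AE : m K (entourage_nbhd E (A K)) @[K --> tails] --> 1%E.
  apply: KK_conc => //.
  - by exists V => //; apply: open_nbhs_nbhs.
  - by move=> K; apply: open_borel; exact: oE.
  - apply: (@lt_le_trans _ _ (Order.min a%:E 1)%E); first by rewrite lt_min lte_fin a0 /=.
    have [[K0 KK0] _] := KK_directed.
    apply: (@le_trans _ _ (ereal_inf [set m K (A K) | K in [set: set G]])).
      apply: le_ereal_inf_tmp => _ [K _ <-]; rewrite /A; case: ifPn => h.
        by rewrite ge_min h.
      by rewrite probability_setT ge_min lexx orbT.
    by apply: ereal_sup_ubound; exists setT; [exists K0|].
have : tails [set K | (2^-1%:E < m K (entourage_nbhd E (A K)))%E].
  apply: (AE [set y | (2^-1%:E < y)%E]); apply: open_ereal_gt'.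
  by rewrite lte_fin invf_lt1// ltr1n.
apply: filterS => K /= hK; case: (leP a%:E (nu K W)) => h; [right|by left].
apply: lt_le_trans hK _; apply: le_measure; rewrite ?inE.
- by apply: open_borel; exact: oE.
- exact: orbit_measurable.
- rewrite /A h => g [b Wb /= Vgb] /=.
  by have := VWU _ _ Vgb Wb; rewrite -actM mulgVK.
Qed.

Lemma levy_fixed_point : exists x, forall g, act g x = x.
Proof.
have [UU [UUu tailsUU]] := ultraFilterLemma tails_filter.
(* The small open sets are stable under finite unions and exclude [setT], since [nu K setT] is
   always 1. Their complements thus generate a proper filter, none of whose cluster points lies in a
   small set. *)
pose small (W : set Q) :=
  open W /\ forall a : R, 0 < a -> UU [set K | (nu K W < a%:E)%E].
pose F : set_system Q := [set B | exists2 W, small W & ~` W `<=` B].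
have small0 : small set0.
  split=> [|a a0]; first exact: open0.
  by apply: filterE => K /=; rewrite /nu -[X in m K X]/(@set0 G) measure0 lte_fin.
have FF : ProperFilter F.
  split.
    move=> [W [oW sW]] W0; have WT : W = setT.
      by apply/seteqP; split=> // x _; apply: contrapT => /W0.
    have [K /=] := filter_ex (sW 1 ltr01).
    by rewrite WT /nu (_ : [set _ | _] = setT)// probability_setT ltxx.
  split.
  - by exists set0.
  - move=> B C [W [oW sW] WB] [W' [oW' sW'] WC]; exists (W `|` W').
      split=> [|a a0]; first exact: openU.
      have a20 : 0 < a / 2 by rewrite divr_gt0.
      apply: filterS2 (sW _ a20) (sW' _ a20) => K /= h h'.
      apply: (@le_lt_trans _ _ (nu K W + nu K W')%E).
        by apply: measureU2; exact: orbit_measurable.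
      by rewrite [a]splitr EFinD lteD.
    by rewrite setCU => x [Wx Wx']; split; [exact: WB|exact: WC].
  - by move=> B C BC [W sW WB]; exists W => //; exact: subset_trans BC.
have [x [_ xF]] := Q_compact FF filterT.
have half U : open U -> U x -> UU [set K | (2^-1%:E < nu K U)%E].
  move=> oU Ux.
  (* For an ultrafilter, the failure of [half] means that the opposite inequality itself holds along
     [UU]. The first alternative of [small_or_expanding] then holds along [UU] for every [a], which
     makes the neighbourhood [W] of [x] small. *)
  have [|nU] := in_ultra_setVsetC [set K | (2^-1%:E < nu K U)%E] UUu; first by [].
  exfalso.
  have : nbhs (act 1%g x) U by rewrite act1; exact: open_nbhs_nbhs.
  move=> /(@act_cont (1%g, x))[[V' W'] /= [nV nW] VWU].
  move: nV; rewrite nbhsE => -[V [oV V1] VV'].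
  move: nW; rewrite nbhsE => -[W [oW Wx] WW'].
  have {}VWU g y : V g -> W y -> U (act g y).
    by move=> /VV' gV /WW' yW; exact: (VWU (g, y) (conj gV yW)).
  have sW : small W.
    split=> // a a0; apply: filterS2 nU
      (tailsUU _ (small_or_expanding a0 oV V1 oW oU VWU)).
    by move=> K /= h [].
  have FW : F (~` W) by exists W.
  have [z [nWz]] := xF _ _ FW (open_nbhs_nbhs (conj oW Wx)); exact.
have fixK k K : KK K -> K k -> act k x = x.
  move=> KKK Kk; apply/eqP/negP => /negP neq.
  move: Q_hausdorff; rewrite open_hausdorff => /(_ _ _ neq)[[A B]] /=.
  move=> -[/set_mem Akx /set_mem Bx] [oA oB /eqP AB0].
  have : nbhs (act k x) A by exact: open_nbhs_nbhs.
  move=> /(@act_continuousr k x); rewrite /= nbhsE => -[C [oC Cx] CA].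
  have : tails [set L | KK L /\ K `<=` L] by exists K.
  move=> /tailsUU UUK.
  have [L [[KKL KL] [hC hB]]] :=
    filter_ex (filterI UUK (filterI (half C oC Cx) (half B oB Bx))).
  have [mL L1 Linv _] := KK_haar KKL.
  (* As [k] lies in [L], invariance of the Haar measure equates the measure of [A] with that of its
     preimage under [k], which contains [C]. *)
  have hA : (2^-1%:E < nu L A)%E.
    rewrite /nu -(Linv k _ (KL _ Kk) (orbit_measurable oA)).
    apply: lt_le_trans hC _; apply: le_measure; rewrite ?inE.
    - exact: orbit_measurable.
    - apply: open_borel; apply: (@open_comp _ _ (fun g : G => k * g)%g).
        move=> g _; apply: (@continuous_comp _ _ _ (fun z : G => (k, z)) (fun xy => xy.1 * xy.2)%g).
          by apply: cvg_pair; [exact: cvg_cst|exact: cvg_id].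
        exact: mulg_continuous.
      exact: orbit_open.
    - by move=> g /= /CA /=; rewrite actM.
  have : (nu L A + nu L B <= 1)%E.
    rewrite /nu -measureU//.
    - by apply: probability_le1; apply: measurableU; exact: orbit_measurable.
    - exact: orbit_measurable.
    - exact: orbit_measurable.
    - by rewrite -[RHS]/([set g | set0 (act g x0)]) -AB0.
  apply/negP; rewrite -ltNge (_ : 1%E = (2^-1 + 2^-1)%:E); last first.
    by rewrite [in LHS](splitr 1) mul1r.
  by rewrite EFinD lteD.
exists x => g; apply/eqP/negP => /negP neq.
move: Q_hausdorff; rewrite open_hausdorff => /(_ _ _ neq)[[A B]] /=.
move=> -[/set_mem Agx /set_mem Bx] [oA oB /eqP AB0].
have oA' : open [set h | A (act h x)].
  by apply: open_comp => // h _; exact: act_continuousl.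
have [|k [Ak [K KKK Kk]]] := KK_dense _ oA'; first by exists g.
have : (A `&` B) x by split=> //; move: Ak; rewrite /= (fixK k K).
by rewrite AB0.
Qed.

End LevyFixedPoint.

Lemma levy_extremely_amenable (R : realType) (G : topGroupType) :
  levy_group R G -> extremely_amenable G.
Proof.
move=> [KK [m [_ KKdir KKdense KKhaar KKconc]]] Q act [x0 _] QH Qc act1 actM actc.
exact: (@levy_fixed_point R G KK m).
Qed.

(** * The Lebesgue model *)

Section BinaryCode.
Variable R : realType.
Implicit Type b : nat -> bool.

(* Base 4 with digits 0 and 1: the expansion of every code is unique. *)
Definition bin_psum b (n : nat) : R := \sum_(k < n) (b k)%:R * 4^-1 ^+ k.+1.

Definition bin_code b : R := limn (bin_psum b).

Definition bin_digit (m : nat) (y : R) : bool := odd (Num.truncn (4 ^+ m.+1 * y)).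

Let bin_psumS b n : bin_psum b n.+1 = bin_psum b n + (b n)%:R * 4^-1 ^+ n.+1.
Proof. by rewrite /bin_psum big_ord_recr. Qed.

Let bin_psum_nd b : nondecreasing_seq (bin_psum b).
Proof.
by apply/nondecreasing_seqP => n; rewrite bin_psumS lerDl mulr_ge0// exprn_ge0//.
Qed.

Let bin_psum_le b m n : bin_psum b (m + n) <= bin_psum b m + (4^-1 ^+ m) / 3.
Proof.
(* Adding the largest possible tail makes the partial sums nonincreasing in [n]: a digit 1 followed
   by the new tail gives exactly the old one, as (1 + 1/3) / 4 = 1/3. *)
suff : bin_psum b (m + n) + 4^-1 ^+ (m + n) / 3 <= bin_psum b m + 4^-1 ^+ m / 3.
  by apply: le_trans; rewrite lerDl divr_ge0// exprn_ge0.
elim: n => [|n IH]; first by rewrite addn0.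
apply: le_trans IH; rewrite addnS bin_psumS exprS.
have : 0 <= 4^-1 ^+ (m + n) :> R by rewrite exprn_ge0// invr_ge0.
case: (b _) => /=; set x := _ ^+ (m + n) => x0; lra.
Qed.

Let bin_psum_cvg b : bin_psum b @ \oo --> bin_code b.
Proof.
apply: nondecreasing_is_cvgn; first exact: bin_psum_nd.
exists (bin_psum b 0 + 1 / 3) => _ [n _ <-].
by have := bin_psum_le b 0 n; rewrite add0n expr0.
Qed.

Let bin_code_ge b m : bin_psum b m <= bin_code b.
Proof. by apply: nondecreasing_cvgn_le; [exact: bin_psum_nd|exact: bin_psum_cvg]. Qed.

Let bin_code_le b m : bin_code b <= bin_psum b m + (4^-1 ^+ m) / 3.
Proof.
apply: limr_le; first exact: bin_psum_cvg.
near=> n; rewrite -(@subnKC m n); first exact: bin_psum_le.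
by near: n; exact: nbhs_infty_ge.
Unshelve. all: by end_near. Qed.

Lemma bin_code_ge0 b : 0 <= bin_code b.
Proof. by have := bin_code_ge b 0; rewrite /bin_psum big_ord0. Qed.

Lemma bin_code_lt1 b : bin_code b < 1.
Proof.
have := bin_code_le b 0; rewrite /bin_psum big_ord0 expr0 add0r => h.
by apply: le_lt_trans h _; lra.
Qed.

Lemma bin_codeK b m : bin_digit m (bin_code b) = b m.
Proof.
(* [P n] is the integer with base 4 digits [b 0], ..., [b (n - 1)]. The remaining digits contribute
   at most 1/3 after scaling, so truncation returns [P m.+1], whose parity is its last digit
   [b m]. *)
pose P n := (\sum_(k < n) b k * 4 ^ (n - k.+1))%N.
have PS n : P n.+1 = (4 * P n + b n)%N.
  rewrite /P big_ord_recr/= subnn muln1 big_distrr/=; congr (_ + _)%N.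
  by apply: eq_bigr => i _; rewrite subSn// expnS mulnCA.
have PE n : 4 ^+ n * bin_psum b n = (P n)%:R.
  elim: n => [|n IH]; first by rewrite /P /bin_psum !big_ord0 mulr0.
  rewrite PS natrD natrM -IH bin_psumS mulrDr exprS mulrA; congr (_ + _).
  by rewrite mulrCA -exprS -exprMn divff ?expr1n ?mulr1.
rewrite /bin_digit (@truncn_def _ _ (P m.+1)).
  by rewrite PS oddD oddM/= oddb.
rewrite -[(P m.+1).+1%:R]natr1 -PE; apply/andP; split.
  by rewrite ler_pM2l ?exprn_gt0//; exact: bin_code_ge.
rewrite (le_lt_trans (ler_wpM2l _ (bin_code_le b m.+1))) ?exprn_ge0//.
rewrite mulrDr ltrD2l mulrA -exprMn divff// expr1n; lra.
Qed.

Lemma measurable_bin_code d (X : measurableType d) (U : nat -> set X) :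
  (forall n, measurable (U n)) ->
  measurable_fun setT (fun x => bin_code (fun n => x \in U n)).
Proof.
move=> mU; apply: (@measurable_fun_cvg _ _ _ _
    (fun n x => bin_psum (fun n => x \in U n) n)); last first.
  by move=> x _; exact: bin_psum_cvg.
move=> n; rewrite /bin_psum.
rewrite (_ : (fun _ => _) = (fun x => \sum_(k < n) \1_(U k) x * 4^-1 ^+ k.+1))//.
by apply: measurable_sum => k; apply: measurable_funM.
Qed.

End BinaryCode.

Lemma measurable_fun_nat d (T : measurableType d) (f : T -> nat) :
  (forall n, measurable [set x | (f x <= n)%N]) -> measurable_fun setT f.
Proof.
move=> mf _ B _; rewrite setTI.
have -> : f @^-1` B = \bigcup_(n in B) [set x | f x = n].
  by apply/seteqP; split=> [x|x [n Bn /= ->]] //; exists (f x).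
apply: bigcup_measurable => n _.
have -> : [set x | f x = n] = [set x | (f x <= n)%N] `\`
    (if n is n'.+1 then [set x | (f x <= n')%N] else set0).
  case: n => [|n]; apply/seteqP; split=> x /=; lia.
apply: measurableD => //; case: n => //.
Qed.

Lemma measurable_truncn (R : realType) : measurable_fun setT (@Num.truncn R).
Proof.
apply: measurable_fun_nat => n.
rewrite (_ : [set _ | _] = `]-oo, n.+1%:R[%classic); first exact: measurable_itv.
by apply/seteqP; split=> x /=; rewrite in_itv/= truncn_le_nat.
Qed.

Lemma measurable_bin_digit (R : realType) m :
  measurable_fun setT (@bin_digit R m).
Proof.
apply: (@measurableT_comp _ _ _ _ _ _ odd) => //.
apply: (@measurableT_comp _ _ _ _ _ _ (@Num.truncn R)).
  exact: measurable_truncn.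
by apply: measurable_funM.
Qed.

(** * Measurable decoding in a Polish space *)

Section StandardBorelRetract.
Variables (R : realType) (d : measure_display) (X : measurableType d).
Variables (P : completePseudoMetricType R) (phi : X -> P) (psi : P -> X).
Hypothesis P_hausdorff : hausdorff_space P.
Hypothesis phiK : cancel phi psi.
Hypothesis psiK : cancel psi phi.
Hypothesis phi_measurable :
  forall A : set X, measurable A <-> measurable (phi @` A : set (borel P)).
Variable c : nat -> P.
Hypothesis c_dense : dense (range c).

Let r (n : nat) : R := n.+1%:R^-1.

Let r_gt0 n : 0 < r n. Proof. by rewrite invr_gt0. Qed.

Let r_small e : 0 < e -> exists n, r n < e.
Proof.
move=> e0; have [n _ nP] := near_infty_natSinv_lt (PosNum e0).
by exists n; exact: nP (leqnn n).
Qed.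

(** Interiors are taken because a [ball] need not be open, and openness is what makes these sets
    Borel. *)
Let U (n i : nat) : set P := interior (ball (c i) (r n)).

Let Ubit (m : nat) : set X :=
  if unpickle m is Some (n, i) then phi @^-1` U n i else set0.

Let enc (x : X) : R := bin_code R (fun m => x \in Ubit m).

Let bit (n i : nat) (y : R) : bool := bin_digit (pickle (n, i)) y.

Let bit_enc n i x : bit n i (enc x) = (phi x \in U n i).
Proof. by rewrite /bit /enc bin_codeK /Ubit pickleK. Qed.

Let measurable_phi (B : set P) : measurable (B : set (borel P)) ->
  measurable (phi @^-1` B).
Proof.
move=> mB; apply/phi_measurable; rewrite (_ : phi @` _ = B)//.
by apply/seteqP; split=> [_ [x Bx <-]//|p Bp]; exists (psi p); rewrite /= psiK.
Qed.

Let measurable_bit n i : measurable [set y | bit n i y].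
Proof.
by have := @measurable_bin_digit R (pickle (n, i)) measurableT [set true] I;
  rewrite setTI.
Qed.

(** Consistency of the digits of [y]: a countable condition, hence Borel, satisfied by every code of
    a point, and strong enough for the selected centres to form a Cauchy sequence. Decoding takes
    place on [C] and is constant elsewhere. *)
Let C : set R := [set y | (forall n, exists i, bit n i y) /\
  forall n m i j, bit n i y -> bit m j y -> ball (c i) (r n + r m) (c j)].

Let measurable_C : measurable C.
Proof.
have -> : C = \bigcap_n (\bigcup_i [set y | bit n i y]) `&`
    \bigcap_n \bigcap_m \bigcap_i \bigcap_j (
      (if `[< ball (c i) (r n + r m) (c j) >] then setT else set0) `|`
      (~` [set y | bit n i y] `|` ~` [set y | bit m j y])).
  apply/seteqP; split=> y.
    move=> [h1 h2]; split=> [n _|n _ m _ i _ j _].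
      by have [i] := h1 n; exists i.
    case: asboolP => [|nb]; first by left.
    right; apply/not_andP => -[yi yj]; apply: nb; exact: h2.
  move=> [h1 h2]; split=> [n|n m i j yi yj].
    by have [i _] := h1 n I; exists i.
  have := h2 n I m I i I j I; case: asboolP => // _.
  by move=> [//|[]].
apply: measurableI; apply: bigcap_measurableType => n _.
  by apply: bigcup_measurable => i _.
apply: bigcap_measurableType => m _; apply: bigcap_measurableType => i _.
apply: bigcap_measurableType => j _; apply: measurableU; first by case: ifP.
by apply: measurableU; exact: measurableC.
Qed.

(** The radius is doubled because the decoded point is a limit of centres [c j] of level [m], each
    within [r n + r m] of [c i]: a margin remains for [r m] and for the convergence. *)
Let near_code y : set P := [set p | forall n i, bit n i y -> ball (c i) (r n + r n) p].

Let near_codeP y : C y -> near_code y !=set0.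
Proof.
move=> [/choice[k kP] Cy].
have : cauchy (c \o k @ \oo).
  apply: cauchy_exP => e e0; have [n rn] := @r_small (e / 2) (divr_gt0 e0 (ltr0n _ 2)).
  exists (c (k n)); exists n => // m /= nm.
  apply: (@le_ball _ _ _ (r n + r m)); last exact: Cy.
  rewrite [e]splitr lerD// ?(ltW rn)// (le_trans _ (ltW rn))// lef_pV2 ?posrE//.
  by rewrite ler_nat ltnS.
move=> /cauchy_cvg/cvg_ex[p /cvg_ballP kp]; exists p => n i yi.
have rn2 : 0 < r n / 2 by rewrite divr_gt0.
have [N _ /(_ _ (leqnn N)) rN] := near_infty_natSinv_lt (PosNum rn2).
have [M _ MP] := kp _ rn2.
have := MP (maxn N M) (leq_maxr _ _) => /= /ball_sym.
have := Cy _ (maxn N M) _ _ yi (kP _) => /= h1 h2.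
have := ball_triangle h1 h2; apply: le_ball.
rewrite [X in _ <= _ + X]splitr addrA lerD// lerD// (le_trans _ (ltW rN))//.
by rewrite lef_pV2 ?posrE// ler_nat ltnS leq_maxl.
Qed.

Let near_code_uniq y p q : (forall n, exists i, bit n i y) ->
  near_code y p -> near_code y q -> p = q.
Proof.
move=> yn yp yq; apply: contrapT => /eqP.
move: P_hausdorff; rewrite ball_hausdorff => /[apply] -[[a b]] /= /eqP ab0.
suff : (ball p a%:num `&` ball q b%:num) q by rewrite ab0.
split; last exact: ballxx.
have a4 : 0 < a%:num / 4 :> R by rewrite divr_gt0.
have [n rn] := r_small a4; have [i yi] := yn n.
apply: le_ball (ball_triangle (ball_sym (yp _ _ yi)) (yq _ _ yi)).
by move: rn; lra.
Qed.

Let dec (y : R) : P := if `[< C y >] then xget point (near_code y) else point.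

Let decP y : C y -> near_code y (dec y).
Proof. by move=> Cy; rewrite /dec asboolT//; apply: xgetPex; exact: near_codeP. Qed.

Let encC x : C (enc x).
Proof.
split=> [n|n m i j].
  have [z [/= zx [i _ cz]]] : ((ball (phi x) (r n / 2))° `&` range c) !=set0.
    apply: c_dense; last exact: open_interior.
    by exists (phi x); apply: nbhsx_ballx; rewrite divr_gt0.
  exists i; rewrite bit_enc; apply/mem_set.
  rewrite /U /interior /=; apply: (@filterS _ _ _ (ball (phi x) (r n / 2))).
    move=> w /= xw; rewrite [r n]splitr; apply: ball_triangle xw.
    by apply: ball_sym; rewrite cz; exact: interior_subset zx.
  by apply: nbhsx_ballx; rewrite divr_gt0.
rewrite !bit_enc => /set_mem/interior_subset xi /set_mem/interior_subset xj.
by apply: ball_triangle xi _; exact: ball_sym.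
Qed.

Let encK x : dec (enc x) = phi x.
Proof.
apply: (@near_code_uniq (enc x)); [by have [] := encC x|exact/decP/encC|].
move=> n i; rewrite bit_enc => /set_mem/interior_subset xi.
by apply: le_ball xi; rewrite lerDl ltW.
Qed.

Let measurable_dec : measurable_fun setT (dec : R -> borel P).
Proof.
apply: (@measurability _ _ _ (borel P) _ _ (@open P)) => //.
move=> _ [/= O oO <-]; rewrite setTI.
(* If bit [(n, i)] of [y] is set, then [dec y] is in the ball of radius [r n + r n] about [c i]. As
   these radii tend to 0, [dec y] lies in the open set [O] exactly when one such ball is contained
   in [O]. *)
have -> : dec @^-1` O =
  (C `&` \bigcup_n \bigcup_i ((if `[< ball (c i) (r n + r n) `<=` O >] then setT else set0)
     `&` [set y | bit n i y])) `|`
  (~` C `&` (if `[< O point >] then setT else set0)).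
  apply/seteqP; split=> y.
    have [Cy|nCy] := pselect (C y); last first.
      by rewrite /= /dec asboolF// => Op; right; split=> //; rewrite asboolT.
    move=> Oy; left; split=> //.
    have : nbhs (dec y) O by apply: open_nbhs_nbhs; split.
    move=> /nbhs_ballP[e /= e0 eO].
    have [n rn] := @r_small (e / 4) (divr_gt0 e0 (ltr0n _ 4)).
    have [i yi] := Cy.1 n; exists n => //; exists i => //; split=> //.
    rewrite asboolT// => z iz; apply: eO.
    apply: le_ball (ball_triangle (ball_sym (decP Cy yi)) iz).
    by move: rn; lra.
  move=> [[Cy [n _ [i _]]]|[nCy]].
    by case: asboolP => iO [] // _ yi; exact: (iO _ (decP Cy yi)).
  by case: asboolP => Op // _; rewrite /= /dec asboolF.
apply: measurableU; apply: measurableI => //.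
- apply: bigcup_measurable => n _; apply: bigcup_measurable => i _.
  by apply: measurableI => //; case: ifP.
- exact: measurableC.
- by case: ifP.
Qed.

Lemma standard_borel_retract_subproof : exists (f : X -> R) (g : R -> X),
  [/\ measurable_fun setT f, measurable_fun setT g, cancel f g &
      forall x, 0 <= f x < 1].
Proof.
exists enc, (psi \o dec); split.
- apply: measurable_bin_code => m; rewrite /Ubit; case: unpickle => // -[n i].
  by apply: measurable_phi; apply: sub_sigma_algebra; exact: open_interior.
- move=> _ A mA; rewrite setTI.
  have -> : (psi \o dec) @^-1` A = dec @^-1` (phi @` A).
    apply/seteqP; split=> y /=; first by move=> Ay; exists (psi (dec y)).
    by move=> [x Ax <-]; rewrite phiK.
  rewrite -[X in measurable X]setTI; apply: measurable_dec => //.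
  exact/phi_measurable.
- by move=> x /=; rewrite encK phiK.
- by move=> x; rewrite bin_code_ge0 bin_code_lt1.
Qed.

End StandardBorelRetract.

Lemma standard_borel_retract (R : realType) d (X : measurableType d) :
  standard_borel R X -> exists (f : X -> R) (g : R -> X),
  [/\ measurable_fun setT f, measurable_fun setT g, cancel f g &
      forall x, 0 <= f x < 1].
Proof.
move=> [P [phi [PH [D /countable_injP[e einj] Dd] [psi phiK psiK] phim]]].
(* [e] numbers the points of [D]; integers that are no number receive the default [point], so the
   range of [c] contains [D]. *)
pose c i := xget point [set p | D p /\ e p = i].
apply: (@standard_borel_retract_subproof R d X P phi psi PH phiK psiK phim c).
move=> O O0 oO; have [p [Op Dp]] := Dd O O0 oO; exists p; split=> //.
exists (e p) => //; rewrite /c; case: xgetP => [q _ [Dq eq]|/(_ p)[]//].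
by apply: einj eq; rewrite inE.
Qed.

(** * Transport to Lebesgue measure by a distribution function *)

Section DistributionFunction.
Variables (R : realType) (d : measure_display) (X : measurableType d).
Variables (mu : {measure set X -> \bar R}) (h : X -> R).
Hypothesis mh : measurable_fun setT h.
Hypothesis h_ge0 : forall x, 0 <= h x.
Hypothesis h_fin : forall t, (mu [set x | (h x <= t)%R] < +oo)%E.
Hypothesis h_diffuse : forall t, mu [set x | h x = t] = 0%E.

Let M := mu setT.

Definition range_itv : set R := [set u | 0 <= u /\ (u%:E < M)%E].
Let J := range_itv.

Lemma measurable_range_itv : measurable range_itv.
Proof.
have : (0 <= M)%E by exact: measure_ge0.
rewrite /range_itv -/M.
case: M => [m _|_|]; last by rewrite leeNy_eq.
  rewrite (_ : [set _ | _] = `[0, m[%classic); first exact: measurable_itv.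
  by apply/seteqP; split=> x /=; rewrite in_itv/= lte_fin => /andP.
rewrite (_ : [set _ | _] = `[0, +oo[%classic); first exact: measurable_itv.
by apply/seteqP; split=> x /=; rewrite in_itv/= andbT ltry => // -[].
Qed.

Let measurable_le (f : X -> R) t : measurable_fun setT f ->
  measurable [set x | f x <= t].
Proof.
move=> mf; rewrite (_ : [set _ | _] = f @^-1` `]-oo, t]%classic).
  by rewrite -[X in measurable X]setTI; apply: mf => //; exact: measurable_itv.
by apply/seteqP; split=> x /=; rewrite in_itv.
Qed.

Let measurable_eq (f : X -> R) t : measurable_fun setT f ->
  measurable [set x | f x = t].
Proof. by move=> mf; rewrite -[X in measurable X]setTI; exact: (mf _ [set t]). Qed.

Let mle t : measurable [set x | h x <= t]. Proof. exact: measurable_le. Qed.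

Definition dist_fun (t : R) : R := fine (mu [set x | h x <= t]).
Let F := dist_fun.

Let FE t : (F t)%:E = mu [set x | h x <= t].
Proof. by rewrite /F /dist_fun fineK// ge0_fin_numE. Qed.

Let F_nd : {homo F : s t / s <= t}.
Proof.
move=> s t st; rewrite -lee_fin !FE le_measure ?inE// => x /= /le_trans; exact.
Qed.

Let F_ge0 t : 0 <= F t. Proof. by rewrite -lee_fin FE. Qed.

Let F_leM t : ((F t)%:E <= M)%E.
Proof. by rewrite FE le_measure ?inE. Qed.

Definition quantile_fun (u : R) : R := sup [set t | F t <= u].
Let G := quantile_fun.

Let has_sup_G u : J u -> has_sup [set t | F t <= u].
Proof.
move=> [u0 uM]; split.
  exists (-1); rewrite /= (_ : F (-1) = 0)//; apply: EFin_inj; rewrite FE.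
  rewrite (_ : [set _ | _] = set0) ?measure0//.
  by apply/seteqP; split=> x //= hx; have := h_ge0 x; lra.
have : mu [set x | h x <= n%:R] @[n --> \oo] --> M.
  rewrite /M (_ : setT = \bigcup_n [set x | h x <= n%:R]).
    apply: nondecreasing_cvg_mu => //; first exact: bigcup_measurable.
    move=> m n mn; apply/subsetPset => x /= /le_trans; apply; by rewrite ler_nat.
  apply/seteqP; split=> x // _; exists (Num.truncn (h x)).+1 => //=.
  by rewrite ltW// truncnS_gt.
move=> /(_ [set y | (u%:E < y)%E])[|N _ /(_ _ (leqnn N))/=].
  exact: open_ereal_gt'.
rewrite -FE lte_fin => uFN; exists N%:R => t /= Ftu; rewrite leNgt; apply/negP.
by move=> /ltW/F_nd; lra.
Qed.

(** [F] is continuous: from the left because the fibres of [h] are null, from the right because [mu]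
    is continuous from above on sets of finite measure. *)
Let FG u : J u -> F (G u) = u.
Proof.
move=> Ju; have hs := has_sup_G Ju; set s := G u.
apply/eqP; rewrite eq_le -!lee_fin FE; apply/andP; split.
  have -> : [set x | h x <= s] = [set x | h x < s] `|` [set x | h x = s].
    apply/seteqP; split=> x /=; first by rewrite le_eqVlt => /orP[/eqP|]; tauto.
    by move=> [/ltW|->].
  have ltE : [set x | h x < s] = \bigcup_n [set x | h x <= s - n.+1%:R^-1].
    apply/seteqP; split=> x /=.
      by move=> /ltr_add_invr[k hk]; exists k => //=; rewrite lerBrDr ltW.
    move=> [k _ /=] hk; rewrite (le_lt_trans hk)// ltrBlDr ltrDl.
    by rewrite invr_gt0.
  have mlt : measurable [set x | h x < s] by rewrite ltE; exact: bigcup_measurable.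
  apply: le_trans (measureU2 _ _ _) _ => //; first exact: measurable_eq.
  rewrite [X in (_ + X)%E]h_diffuse adde0 ltE.
  have : mu [set x | h x <= s - n.+1%:R^-1] @[n --> \oo] -->
      mu (\bigcup_n [set x | h x <= s - n.+1%:R^-1]).
    apply: nondecreasing_cvg_mu => //; first exact: bigcup_measurable.
    move=> m n mn; apply/subsetPset => x /= /le_trans; apply.
    by rewrite lerD2l lerN2 lef_pV2 ?posrE// ler_nat ltnS.
  move=> /cvge_to_le; apply; apply: nearW => n; rewrite -FE lee_fin.
  have [|t /= Ft st] := sup_adherent _ hs (eps := n.+1%:R^-1); first by rewrite invr_gt0.
  by apply: le_trans Ft; apply: F_nd; exact: ltW.
have -> : [set x | h x <= s] = \bigcap_n [set x | h x <= s + n.+1%:R^-1].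
  apply/seteqP; split=> x /=.
    by move=> hs' n _ /=; rewrite (le_trans hs')// lerDl invr_ge0.
  move=> hx; rewrite leNgt; apply/negP => /ltr_add_invr[k].
  by have := hx k I; rewrite /= leNgt => /negP.
have : mu [set x | h x <= s + n.+1%:R^-1] @[n --> \oo] -->
    mu (\bigcap_n [set x | h x <= s + n.+1%:R^-1]).
  apply: nonincreasing_cvg_mu => //; first exact: bigcap_measurableType.
  move=> m n mn; apply/subsetPset => x /= /le_trans; apply.
  by rewrite lerD2l lef_pV2 ?posrE// ler_nat ltnS.
move=> /cvge_to_ge; apply; apply: nearW => n; rewrite -FE lee_fin leNgt; apply/negP => /ltW Fu.
have := sup_upper_bound hs; rewrite -/(G u) -/s => /(_ _ Fu).
by apply/negP; rewrite -ltNge ltrDl invr_gt0.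
Qed.

(** A Galois connection: it turns sublevel sets of [cdf_of] and superlevel sets of [quantile_on]
    into half-lines. *)
Let F_le_iff u t : J u -> (F t <= u) = (t <= G u).
Proof.
move=> Ju; apply/idP/idP => [Ft|/F_nd]; last by rewrite FG.
exact: (sup_upper_bound (has_sup_G Ju)).
Qed.

Definition cdf_of (x : X) : R := F (h x).
Let a := cdf_of.

Lemma measurable_cdf_of : measurable_fun setT cdf_of.
Proof.
by apply: (measurableT_comp _ mh); apply: nondecreasing_measurable.
Qed.

Let cdf_leM x : ((a x)%:E <= M)%E. Proof. exact: F_leM. Qed.

Let mu_cdf_le u : mu [set x | a x <= u] = lebesgue_measure (J `&` `]-oo, u]%classic).
Proof.
have [u0|u0] := ltP u 0.
  rewrite (_ : [set _ | _] = set0); last first.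
    by apply/seteqP; split=> x //=; have := F_ge0 (h x); rewrite /a /cdf_of -/F; lra.
  rewrite (_ : _ `&` _ = set0) ?measure0//.
  by apply/seteqP; split=> x //= [[]]; rewrite in_itv/=; lra.
have [uM|Mu] := ltP u%:E M.
  have Ju : J u by split.
  rewrite (_ : [set _ | _] = [set x | h x <= G u]); last first.
    by apply/seteqP; split=> x; rewrite /= /a /cdf_of -/F F_le_iff.
  rewrite -FE FG// (_ : _ `&` _ = `[0, u]%classic); last first.
    apply/seteqP; split=> x /=; rewrite !in_itv/=; first by move=> [[-> _] ->].
    by move=> /andP[x0 xu]; do !split=> //; apply: le_lt_trans uM; rewrite lee_fin.
  rewrite lebesgue_measure_itv/= lte_fin; case: ltgtP u0 => // [u0|<-] _ //.
  by rewrite oppr0 adde0.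
rewrite (_ : [set x | a x <= u] = setT); last first.
  by apply/seteqP; split=> x //= _; rewrite -lee_fin (le_trans (cdf_leM x)).
have ME : M = (fine M)%:E.
  by rewrite fineK// fin_real// (lt_le_trans _ (measure_ge0 mu setT))// (le_lt_trans Mu) ?ltry.
rewrite -/M (_ : _ `&` _ = `[0, fine M[%classic); last first.
  apply/seteqP; split=> x /=; rewrite !in_itv/=.
    by move=> [[-> +] _]; rewrite ME lte_fin.
  move=> /andP[x0]; rewrite -lte_fin -ME => xM; split=> //.
  by rewrite -lee_fin (le_trans (ltW xM)).
rewrite lebesgue_measure_itv/= lte_fin.
have : 0 <= fine M by exact/fine_ge0/measure_ge0.
rewrite le_eqVlt => /orP[/eqP M0|M0]; first by rewrite -M0 ltxx ME -M0.
by rewrite M0 oppr0 adde0 -ME.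
Qed.

Let mJ : measurable J. Proof. exact: measurable_range_itv. Qed.

(** The uniqueness of Lebesgue measure concerns measures on the whole line, so the image of [mu]
    under [a] is completed by Lebesgue measure off [J] before comparing values on the intervals []u,
    v]]. *)
Let lebesgue_split A : measurable A ->
  lebesgue_measure A = (mu (a @^-1` A) + lebesgue_measure (A `&` ~` J))%E.
Proof.
have mJc : measurable (~` J) by exact: measurableC.
have ma : measurable_fun setT (cdf_of : X -> measurableTypeR R).
  exact: measurable_cdf_of.
pose pm : {measure set (measurableTypeR R) -> \bar R} :=
  measure_function_pushforward__canonical__measure_function_Measure mu ma.
pose m := measure_add pm (mrestr lebesgue_measure mJc).
move=> mA; transitivity (m A); last exact: measure_addE.
apply: lebesgue_measure_unique mA => _ [[u v] _ <-].
apply/esym; apply: etrans (measure_addE _ _ _) _; apply/esym.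
change (lebesgue_measure (`]u, v]%classic : set R) = mu (a @^-1` `]u, v]%classic) +
  lebesgue_measure ((`]u, v]%classic : set R) `&` ~` J))%E.
have [uv|vu] := ltP u v; last first.
  by rewrite set_itv_ge ?bnd_simp -?leNgt// preimage_set0 set0I !measure0 adde0.
have muE : mu (a @^-1` `]u, v]%classic) = lebesgue_measure (J `&` `]u, v]%classic).
  have -> : a @^-1` `]u, v]%classic = [set x | a x <= v] `\` [set x | a x <= u].
    apply/seteqP; split=> x /=; rewrite in_itv/=.
      by move=> /andP[ux ->]; split=> //; apply/negP; rewrite -ltNge.
    by move=> [-> /negP]; rewrite -ltNge => ->.
  have -> : J `&` `]u, v]%classic = (J `&` `]-oo, v]%classic) `\` (J `&` `]-oo, u]%classic).
    apply/seteqP; split=> x /=; rewrite !in_itv/=.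
      by move=> [Jx /andP[ux xv]]; split=> // -[_]; lra.
    by move=> [[Jx xv] nx]; split=> //; rewrite xv andbT ltNge; apply/negP => ?; exact: nx.
  have fin w : (lebesgue_measure (J `&` `]-oo, w]%classic) < +oo)%E.
    apply: (@le_lt_trans _ _ (lebesgue_measure (`[0, w]%classic : set R))).
      apply: le_measure; rewrite ?inE; [|exact: measurable_itv|].
        by apply: measurableI => //; exact: measurable_itv.
      by move=> x [[x0 _]] /=; rewrite !in_itv/= x0.
    by rewrite lebesgue_measure_itv/=; case: ifP => _; rewrite ltry.
  have mJi w : measurable (J `&` `]-oo, w]%classic).
    by apply: measurableI => //; exact: measurable_itv.
  have mav w : measurable [set x | a x <= w] by exact: measurable_le.
  have av : (mu [set x | (a x <= v)%R] < +oo)%E by rewrite mu_cdf_le.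
  rewrite (measureD (mav v) (mav u) av).
  rewrite [RHS]measureD; [|exact: mJi|exact: mJi|exact: fin].
  rewrite (_ : [set x | _] `&` _ = [set x | a x <= u]); last first.
    by apply/seteqP; split=> x /=; [case|move=> h'; split=> //; lra].
  rewrite (_ : J `&` _ `&` _ = J `&` `]-oo, u]%classic); last first.
    apply/seteqP; split=> x /=; rewrite !in_itv/=; first by case.
    by move=> [? ?]; split=> //; split=> //; lra.
  by congr (_ - _)%E; exact: mu_cdf_le.
rewrite muE -measureU//.
- by rewrite setIC -setIUr setUv setIT.
- by apply: measurableI => //; exact: measurable_itv.
- by apply: measurableI => //; exact: measurable_itv.
- by apply/seteqP; split=> x //= [[? _] [_]].
Qed.

Lemma mu_cdf_preimage (A : set R) : measurable A ->
  mu (cdf_of @^-1` A) = lebesgue_measure (A `&` range_itv).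
Proof.
move=> mA; have ma := measurable_cdf_of.
have mpre B : measurable B -> measurable (a @^-1` B).
  by move=> mB; rewrite -[X in measurable X]setTI; exact: ma.
have mJc : measurable (~` J) by exact: measurableC.
(* The values of [a] lie between 0 and [M], so outside [J] only the value [M] itself is possible,
   and it has a null preimage because singletons are Lebesgue null. *)
have muJc : mu (a @^-1` (~` J)) = 0%E.
  apply/eqP; rewrite eq_le measure_ge0 andbT.
  have : (mu (a @^-1` [set fine M]) = 0)%E.
    have := lebesgue_split (measurable_set1 (fine M)).
    rewrite lebesgue_measure_set1 => /esym/eqP.
    by rewrite padde_eq0// => /andP[/eqP].
  move=> <-; rewrite le_measure ?inE//; [exact: mpre|exact: mpre|].
  move=> x /= nJ; have := cdf_leM x; rewrite le_eqVlt => /orP[/eqP <-//|aM].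
  by exfalso; apply: nJ; split=> //; exact: F_ge0.
rewrite (lebesgue_split (measurableI _ _ mA mJ)) -setIA setICr setI0 measure0 adde0.
apply/eqP; rewrite eq_le [X in _ && X]le_measure ?inE//; last 3 first.
- by apply: mpre; exact: measurableI.
- exact: mpre.
- by move=> x [].
rewrite andbT; apply: (@le_trans _ _ (mu (a @^-1` (A `&` J) `|` a @^-1` (~` J)))).
  apply: le_measure; rewrite ?inE; [exact: mpre| |].
    by apply: measurableU; apply: mpre => //; exact: measurableI.
  by move=> x /= Ax; have [?|?] := pselect (J (a x)); [left|right].
apply: le_trans (measureU2 _ _ _) _; [|exact: mpre|by rewrite [X in (_ + X)%E]muJc adde0].
by apply: mpre; exact: measurableI.
Qed.

Definition quantile_on (u : R) : R := if u \in J then G u else 0.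

Lemma measurable_quantile : measurable_fun setT quantile_on.
Proof.
apply: (measurability (@RGenCInfty.G R)); first exact: RGenCInfty.measurableE.
move=> _ [_ [t ->] <-]; rewrite setTI.
have -> : quantile_on @^-1` `[t, +oo[%classic =
    (J `&` `[F t, +oo[%classic) `|` (~` J `&` (if t <= 0 then setT else set0)).
  apply/seteqP; split=> u; rewrite /quantile_on /= !in_itv/= !andbT.
    case: ifPn => [/set_mem Ju|/negP nJ] tu.
      by left; split=> //; rewrite F_le_iff.
    by right; rewrite tu; split=> // /mem_set.
  move=> [[Ju]|[nJ]]; first by rewrite mem_set// F_le_iff.
  by rewrite memNset//; case: ifP.
apply: measurableU; apply: measurableI.
- exact: mJ.
- exact: measurable_itv.
- exact: measurableC.
- by case: ifP.
Qed.

(** If [quantile_on (cdf_of x)] exceeds [h x], then [F] is constant from [h x] up to some rational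
    [q], and [x] lies in the preimage of the singleton [F q] under [cdf_of]. These countably many
    preimages are null. *)
Lemma quantile_cdf_ae : {ae mu, forall x, quantile_on (cdf_of x) = h x}.
Proof.
have ma := measurable_cdf_of.
have mpre B : measurable B -> measurable (a @^-1` B).
  by move=> mB; rewrite -[X in measurable X]setTI; exact: ma.
pose N (k : nat) : set X :=
  if unpickle k is Some q then a @^-1` [set F (ratr (q : rat))] else set0.
suff : mu.-negligible (a @^-1` (~` J) `|` \bigcup_k N k).
  apply: negligibleS => x /=; apply: contra_notP => /not_orP[/contrapT Jx nN].
  rewrite /quantile_on mem_set//; apply/eqP; rewrite eq_le -F_le_iff// lexx andbT.
  rewrite leNgt; apply/negP => /rat_in_itvoo[q]; rewrite in_itv/= => /andP[hq qG].
  have [k kq] : exists k, unpickle k = Some q.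
    by exists (pickle q); exact: pickleK.
  apply: nN; exists k; rewrite // /N kq /=.
  apply/eqP; rewrite eq_le F_nd ?(ltW hq)//=.
  by rewrite /a /cdf_of -/F F_le_iff// ltW.
apply: negligibleU.
  apply/negligibleP; first by apply: mpre; exact: measurableC.
  have mJc : measurable (~` J) by exact: measurableC.
  by apply: etrans (mu_cdf_preimage mJc) _; rewrite setICl measure0.
apply: negligible_bigcup => k; rewrite /N; case: unpickle => [q|]; last first.
  exact: negligible_set0.
apply/negligibleP; first exact: mpre.
apply: etrans (mu_cdf_preimage (measurable_set1 _)) _.
apply/eqP; rewrite eq_le measure_ge0 andbT.
rewrite -(lebesgue_measure_set1 (F (ratr q))) le_measure ?inE//.
exact: measurableI.
Qed.

End DistributionFunction.

Section LebesgueModel.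
Variables (R : realType) (d : measure_display) (X : measurableType d).
Variable mu : {measure set X -> \bar R}.
Hypothesis X_standard : standard_borel R X.
Hypothesis mu_non_atomic : non_atomic mu.
Hypothesis mu_sigma_finite : sigma_finite [set: X] mu.

(** [a] is injective only almost everywhere, whereas [e] separates all points of [X]; it serves to
    test equality in [X] measurably. *)
Lemma lebesgue_model : exists (a : X -> R) (b : R -> X) (e : X -> R),
  [/\ measurable_fun setT a, measurable_fun setT b,
      measurable_fun setT e /\ injective e,
      forall A, measurable A ->
        mu (a @^-1` A) = lebesgue_measure (A `&` range_itv mu)
    & {ae mu, forall x, b (a x) = x}].
Proof.
have [f [g [mf mg fK f01]]] := standard_borel_retract X_standard.
have [S SX mS] := mu_sigma_finite.
have exS x : exists n, x \in S n.
  by have : setT x by []; rewrite SX => -[n _ Sx]; exists n; exact: mem_set.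
pose k x := ex_minn (exS x).
have kle n : [set x | (k x <= n)%N] = \big[setU/set0]_(i < n.+1) S i.
  rewrite -bigcup_mkord; apply/seteqP; split=> x /=; rewrite /k; case: ex_minnP => j Sj jmin.
    by move=> jn; exists j => //; exact: set_mem.
  by move=> [i /= ilt Si]; rewrite (leq_trans (jmin i (mem_set Si))).
have mk : measurable_fun setT k.
  apply: measurable_fun_nat => n; rewrite kle; apply: bigsetU_measurable => i _.
  by have [] := mS i.
(* The integer part records the first piece [S n] containing [x] and the fractional part its code.
   Hence [h] is injective, with left inverse [g'] below, and each set [h x <= t] is covered by
   finitely many pieces. *)
pose h x : R := (k x)%:R + f x.
have h0 x : 0 <= h x by rewrite addr_ge0//; have /andP[] := f01 x.
have hk x : Num.truncn (h x) = k x.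
  by apply: truncn_def; rewrite /h -natr1 lerDl ltrD2l; exact: f01.
have mnat : measurable_fun setT (fun n : nat => n%:R : R) by [].
have mh : measurable_fun setT h.
  by apply: measurable_funD => //; exact: (measurableT_comp mnat mk).
have hfin t : (mu [set x | (h x <= t)%R] < +oo)%E.
  apply: (@le_lt_trans _ _ (mu [set x | (k x <= Num.truncn t)%N])).
    apply: le_measure; rewrite ?inE.
    - rewrite (_ : [set _ | _] = h @^-1` `]-oo, t]%classic).
        by rewrite -[X in measurable X]setTI; apply: mh => //; exact: measurable_itv.
      by apply/seteqP; split=> x /=; rewrite in_itv.
    - by rewrite kle; apply: bigsetU_measurable => i _; have [] := mS i.
    - by move=> x /= ht; rewrite -hk; exact: le_truncn.
  rewrite kle (le_lt_trans (Boole_inequality _ _))//.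
    by move=> i _; have [] := mS i.
  by apply/lte_sum_pinfty => i _; have [] := mS i.
pose g' y := g (y - (Num.truncn y)%:R).
have hK x : g' (h x) = x by rewrite /g' hk /h addrAC subrr add0r fK.
have mg' : measurable_fun setT g'.
  apply: (measurableT_comp mg); apply: measurable_funB => //.
  exact: (measurableT_comp mnat (@measurable_truncn R)).
have hdiff t : mu [set x | h x = t] = 0%E.
  have mt : measurable [set x | h x = t].
    by rewrite -[X in measurable X]setTI; exact: (mh _ [set t]).
  apply/eqP; apply: contrapT => /negP mu0.
  (* By injectivity of [h] the fibre has at most one point, so its only subsets are trivial: with
     positive measure it would be an atom. *)
  apply: (mu_non_atomic (A := [set x | h x = t])); split=> //.
    by rewrite lt0e mu0 measure_ge0.
  move=> B mB Bt; have [->|/set0P[z Bz]] := eqVneq B set0; first by left.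
  right; rewrite (_ : _ `\` _ = set0) ?measure0//.
  apply/seteqP; split=> // x /= [xt]; apply.
  by rewrite -(hK x) xt -(Bt _ Bz) hK.
exists (cdf_of mu h), (g' \o quantile_on mu h), f; split.
- exact: measurable_cdf_of.
- by apply: (measurableT_comp mg'); exact: measurable_quantile.
- by split=> //; exact: can_inj fK.
- by move=> A; exact: mu_cdf_preimage.
- have := quantile_cdf_ae mh h0 hfin hdiff.
  by apply: filterS => x /= ->; rewrite hK.
Qed.

End LebesgueModel.

(** * The weak topology *)

Lemma measurableY d (X : measurableType d) (A B : set X) :
  measurable A -> measurable B -> measurable (A `+` B).
Proof. by move=> mA mB; apply: measurableU; exact: measurableD. Qed.

Section SetControl.
Variables (R : realType) (d : measure_display) (X : measurableType d).
Variables (mu : {measure set X -> \bar R}) (p : R).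
Hypothesis p1 : (1 <= p%:E)%E.

Let p_ge1 : 1 <= p. Proof. by rewrite -lee_fin. Qed.
Let p_gt0 : 0 < p. Proof. exact: lt_le_trans p_ge1. Qed.
Let p_neq0 : p != 0. Proof. by rewrite gt_eqF. Qed.

Local Notation Np f := ('N[mu]_p%:E[EFin \o f%R])%E.

Lemma Lnorm_lt (f : X -> R) (e : R) : 0 < e ->
  (\int[mu]_x (`|f x| `^ p)%:E < (e `^ p)%:E)%E -> (Np f < e%:E)%E.
Proof.
move=> e0; apply: contraTT; rewrite -!leNgt => h.
have := powR_Lnorm mu (EFin \o f) p_neq0; under eq_integral do rewrite /=.
move=> <-; rewrite -poweR_EFin; apply: gt0_ler_poweR => //; first exact: ltW.
- by rewrite in_itv/= lee_fin ltW//= leey.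
- by rewrite in_itv/= Lnorm_ge0 leey.
Qed.

Lemma Lnorm_ltE (f : X -> R) (e : R) : 0 < e ->
  (Np f < e%:E)%E -> (\int[mu]_x (`|f x| `^ p)%:E <= (e `^ p)%:E)%E.
Proof.
move=> e0 h.
have := powR_Lnorm mu (EFin \o f) p_neq0; under eq_integral do rewrite /=.
move=> <-; rewrite -poweR_EFin; apply: gt0_ler_poweR => //.
- exact: ltW.
- by rewrite in_itv/= Lnorm_ge0 leey.
- by rewrite in_itv/= lee_fin ltW//= leey.
- exact: ltW.
Qed.

Lemma integral_powR_indicB (A B : set X) : measurable A -> measurable B ->
  (\int[mu]_x (`|\1_A x - \1_B x| `^ p)%:E = mu (A `+` B))%E.
Proof.
move=> mA mB; rewrite -[A `+` B]setIT -integral_indic//; last exact: measurableY.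
apply: eq_integral => x _; congr EFin; rewrite !indicE /setY in_setU !in_setD.
by case: (x \in A); case: (x \in B); rewrite /= ?subrr ?subr0 ?sub0r ?normrN ?normr0 ?normr1 ?powR1 ?powR0.
Qed.

(** Uniform continuity of [s |-> f \o s] expressed through finitely many sets of finite measure. The
    property passes from indicators to linear combinations and to [L^p] limits, hence to all of
    [L^p]; this removes [p] from the description of weak neighbourhoods. *)
Definition set_controlled (f : X -> R) : Prop := forall e : R, 0 < e ->
  exists (Es : seq (set X)) (dl : R), [/\ 0 < dl,
    forall E, E \in Es -> measurable E /\ (mu E < +oo)%E &
    forall s t : mp_transf mu,
      (forall E, E \in Es -> (mu (mp_fun s @^-1` E `+` mp_fun t @^-1` E) < dl%:E)%E) ->
      (Np (fun x => f (mp_fun s x) - f (mp_fun t x)) < e%:E)%E].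

Lemma measurable_mp_fun_preimage (s : mp_transf mu) (E : set X) :
  measurable E -> measurable (mp_fun s @^-1` E).
Proof.
move=> mE; rewrite -[X in measurable X]setTI.
exact: (@mp_measurable_fun _ _ _ _ s measurableT _ mE).
Qed.

Lemma set_controlled_indic (E : set X) : measurable E -> (mu E < +oo)%E ->
  set_controlled \1_E.
Proof.
move=> mE Efin e e0; exists [:: E], (e `^ p); split.
- exact: powR_gt0.
- by move=> F; rewrite inE => /eqP ->.
- move=> s t st; apply: Lnorm_lt => //.
  have := st E; rewrite mem_head => /(_ isT); apply: le_lt_trans.
  rewrite -integral_powR_indicB; [|exact: measurable_mp_fun_preimage..].
  by rewrite le_eqVlt; apply/orP; left; apply/eqP/eq_integral => x _; rewrite !indicE.
Qed.

Lemma set_controlledZ (f : X -> R) (c : R) : measurable_fun setT f ->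
  set_controlled f -> set_controlled (fun x => c * f x).
Proof.
move=> mf cf e e0; have c1 : 0 < `|c| + 1 by rewrite ltr_wpDl.
have [Es [dl [dl0 mEs h]]] := cf (e / (`|c| + 1)) (divr_gt0 e0 c1).
exists Es, dl; split=> // s t st; apply: Lnorm_lt => //.
have := Lnorm_ltE (divr_gt0 e0 c1) (h s t st) => h2.
have mst : measurable_fun setT (fun x => (`|f (mp_fun s x) - f (mp_fun t x)| `^ p)%:E).
  apply/measurable_EFinP; apply: (@measurableT_comp _ _ _ _ _ _ (@powR R ^~ p)) => //.
  apply: measurableT_comp => //; apply: measurable_funB.
    exact: (measurableT_comp mf (mp_measurable_fun s)).
  exact: (measurableT_comp mf (mp_measurable_fun t)).
under eq_integral do rewrite -mulrBr normrM powRM// EFinM.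
rewrite ge0_integralZl//.
apply: (@le_lt_trans _ _ ((`|c| `^ p)%:E * ((e / (`|c| + 1)) `^ p)%:E)%E).
  by apply: lee_wpmul2l => //; rewrite lee_fin powR_ge0.
rewrite -EFinM lte_fin -powRM//; last by rewrite divr_ge0// ltW.
apply: gt0_ltr_powR => //.
- by rewrite nnegrE mulr_ge0// divr_ge0// ltW.
- by rewrite nnegrE ltW.
- by rewrite mulrCA gtr_pMr// ltr_pdivrMr// mul1r ltrDl.
Qed.

Lemma set_controlledD (f g : X -> R) : measurable_fun setT f -> measurable_fun setT g ->
  set_controlled f -> set_controlled g -> set_controlled (fun x => f x + g x).
Proof.
move=> mf mg cf cg e e0; have e2 : 0 < e / 2 by rewrite divr_gt0.
have [Es [dl [dl0 mEs h]]] := cf _ e2.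
have [Es' [dl' [dl0' mEs' h']]] := cg _ e2.
exists (Es ++ Es'), (Num.min dl dl'); split.
- by rewrite lt_min dl0.
- by move=> E; rewrite mem_cat => /orP[/mEs|/mEs'].
- move=> s t st.
  have mB (u : X -> R) : measurable_fun setT u ->
      measurable_fun setT (fun x => u (mp_fun s x) - u (mp_fun t x)).
    move=> mu'; apply: measurable_funB.
      exact: (measurableT_comp mu' (mp_measurable_fun s)).
    exact: (measurableT_comp mu' (mp_measurable_fun t)).
  rewrite (_ : (fun x => _) = (fun x => f (mp_fun s x) - f (mp_fun t x)) \+
      (fun x => g (mp_fun s x) - g (mp_fun t x))); last first.
    by apply/funext => x /=; rewrite opprD addrACA.
  rewrite [e]splitr EFinD (le_lt_trans (eminkowski mu (mB f mf) (mB g mg) p1))//.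
  apply: lteD.
    apply: h => E EE; apply: lt_le_trans (st E _) _; first by rewrite mem_cat EE.
    by rewrite lee_fin ge_min lexx.
  apply: h' => E EE; apply: lt_le_trans (st E _) _; first by rewrite mem_cat EE orbT.
  by rewrite lee_fin ge_min lexx orbT.
Qed.

Lemma Lnorm_comp_mp_fun (s : mp_transf mu) (f : X -> R) : measurable_fun setT f ->
  (Np (fun x => f (mp_fun s x)) = Np f)%E.
Proof. by move=> mf; rewrite -[RHS](Lnorm_comp_mp_inv p (mp_opp s) mf). Qed.

(** Composition with a measure-preserving map is an isometry, so replacing [f] by [g] costs the same
    norm on the side of [s] and on that of [t]: hence the thirds. *)
Lemma set_controlled_approx (f : X -> R) : measurable_fun setT f ->
  (forall e : R, 0 < e -> exists g, [/\ measurable_fun setT g, set_controlled g &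
     (Np (fun x => f x - g x) < e%:E)%E]) -> set_controlled f.
Proof.
move=> mf appr e e0; have e3 : 0 < e / 3 by rewrite divr_gt0.
have [g [mg cg fg]] := appr _ e3.
have [Es [dl [dl0 mEs h]]] := cg _ e3.
exists Es, dl; split=> // s t st.
have mfg : measurable_fun setT (fun x => f x - g x) by exact: measurable_funB.
have mgf : measurable_fun setT (fun x => g x - f x) by exact: measurable_funB.
have gf : (Np (fun x => g x - f x) < (e / 3)%:E)%E.
  rewrite (_ : _ \o _ = (\- (EFin \o (fun x => (f x - g x)%R)))%E) ?oppe_Lnorm//.
  by apply/funext => x /=; rewrite opprB.
have mc (u : X -> R) (s' : mp_transf mu) : measurable_fun setT u ->
    measurable_fun setT (fun x => u (mp_fun s' x)).
  by move=> mu'; exact: (measurableT_comp mu' (mp_measurable_fun s')).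
rewrite (_ : (fun x => _) = (fun x => f (mp_fun s x) - g (mp_fun s x)) \+
    ((fun x => g (mp_fun s x) - g (mp_fun t x)) \+
     (fun x => g (mp_fun t x) - f (mp_fun t x)))); last first.
  by apply/funext => x /=; rewrite subrKA subrKA.
rewrite (_ : e = e / 3 + (e / 3 + e / 3)); last by lra.
rewrite !EFinD; apply: le_lt_trans (eminkowski mu _ _ p1) _.
- exact: (mc _ s mfg).
- apply: measurable_funD; last exact: (mc _ t mgf).
  by apply: measurable_funB; exact: mc.
apply: lteD; first by rewrite (Lnorm_comp_mp_fun s mfg).
apply: le_lt_trans (eminkowski mu _ _ p1) _.
- by apply: measurable_funB; exact: mc.
- exact: (mc _ t mgf).
by apply: lteD; [exact: h|rewrite (Lnorm_comp_mp_fun t mgf)].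
Qed.

Import HBNNSimple.

Lemma set_controlled_sum (n : nat) (F : 'I_n -> X -> R) :
  (forall i, measurable_fun setT (F i)) -> (forall i, set_controlled (F i)) ->
  set_controlled (fun x => \sum_(i < n) F i x).
Proof.
elim: n F => [|n IH] F mF cF.
  rewrite (_ : (fun x => _) = (fun x => \1_(set0 : set X) x)).
    by apply: set_controlled_indic => //; rewrite measure0.
  by apply/funext => x; rewrite big_ord0 indicE in_set0.
rewrite (_ : (fun x => _) =
    (fun x => (\sum_(i < n) F (widen_ord (leqnSn n) i) x) + F ord_max x)).
  apply: set_controlledD => //; last exact: IH.
  by apply: measurable_sum => i; exact: mF.
by apply/funext => x; rewrite big_ord_recr.
Qed.

Lemma set_controlled_nnsfun (g : {nnsfun X >-> R}) :
  (forall y : R, y != 0 -> (mu ((g : X -> R) @^-1` [set y]) < +oo)%E) ->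
  set_controlled g.
Proof.
move=> gfin; pose s : seq R := finmap.enum_fset (fset_set (range g)).
rewrite (_ : (g : X -> R) = fun x => \sum_(i < size s)
    (s`_i * \1_((g : X -> R) @^-1` [set s`_i]) x)); last first.
  by apply/funext => x; exact: fimfunEord.
apply: set_controlled_sum => i; first by apply: measurable_funM.
have [->|y0] := eqVneq (s`_i) 0; last first.
  by apply: set_controlledZ => //; apply: set_controlled_indic => //; exact: gfin.
(* The level set of the value 0 may have infinite measure; its coefficient being 0, it is replaced
   by the empty set. *)
rewrite (_ : (fun x => _) = (fun x => 0 * \1_(set0 : set X) x)).
  by apply: set_controlledZ => //; apply: set_controlled_indic => //; rewrite measure0.
by apply/funext => x; rewrite !mul0r.
Qed.

Lemma set_controlled_ge0 (f : X -> R) : measurable_fun setT f ->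
  (forall x, 0 <= f x) -> (\int[mu]_x ((f x) `^ p)%:E < +oo)%E -> set_controlled f.
Proof.
move=> mf f0 fp.
have mEf : measurable_fun setT (EFin \o f) by exact/measurable_EFinP.
pose g := nnsfun_approx measurableT mEf.
have gle n x : g n x <= f x.
  by rewrite -lee_fin /g nnsfun_approxE; apply: le_approx => // y _; rewrite lee_fin.
have g_cvg x : g n x @[n --> \oo] --> f x.
  have := @cvg_nnsfun_approx _ _ _ _ measurableT _ mEf (fun y _ => _) x I.
  by move=> /(_ (fun y => f0 y)) /fine_cvg.
have mpow (u : X -> R) : measurable_fun setT u ->
    measurable_fun setT (fun x => (u x `^ p)%:E).
  move=> mu'; apply/measurable_EFinP.
  exact: (@measurableT_comp _ _ _ _ _ _ (@powR R ^~ p)).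
have diff0 : (\int[mu]_x (`|f x - g n x| `^ p)%:E)%E @[n --> \oo] --> 0%E.
  have := @dominated_convergence _ X R mu setT measurableT
    (fun n x => (`|f x - g n x| `^ p)%:E) (cst 0%E) (fun x => (f x `^ p)%:E).
  case.
  - move=> n; apply: mpow; apply: measurableT_comp => //.
    exact: measurable_funB.
  - exact: measurable_cst.
  - apply: aeW => x _; apply: cvg_EFin; first by apply: nearW.
    apply/cvgrPdist_le => e e0.
    (* Below 1 the [p]-th power is at most the number itself, since [1 <= p]. *)
    have /cvgrPdist_lt/(_ (Num.min e 1)) := g_cvg x.
    rewrite lt_min e0 ltr01 => /(_ isT); apply: filterS => n.
    rewrite lt_min /= sub0r normrN [`|_ `^ _|]ger0_norm ?powR_ge0// => /andP[h1 h2].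
    have [->|neq0] := eqVneq `|f x - g n x| 0; first by rewrite powR0// ltW.
    apply: le_trans (ltW h1); apply: ge1r_powR => //.
    by rewrite lt_neqAle eq_sym neq0 normr_ge0 ltW.
  - apply/integrableP; split; first exact: mpow.
    by under eq_integral do rewrite /= ger0_norm ?powR_ge0//.
  - apply: aeW => x n _; rewrite /= lee_fin ger0_norm ?powR_ge0//.
    apply: ge0_ler_powR; rewrite ?nnegrE// ?(ltW p_gt0)//.
    rewrite [leLHS]ger0_norm; last by rewrite subr_ge0.
    by rewrite lerBlDr lerDl; exact: fun_ge0.
  move=> _ + _; apply: cvg_trans; apply: near_eq_cvg; apply: nearW => n /=.
  by apply: eq_integral => x _; rewrite subr0 ger0_norm ?powR_ge0.
apply: set_controlled_approx => // e e0.
have : \forall n \near \oo, (\int[mu]_x (`|f x - g n x| `^ p)%:E < (e `^ p)%:E)%E.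
  by apply: (diff0 [set y | (y < (e `^ p)%:E)%E]); apply: open_ereal_lt';
    rewrite lte_fin powR_gt0.
move=> [n _ /(_ n (leqnn n)) hn]; exists (g n); split=> //; last exact: Lnorm_lt.
apply: set_controlled_nnsfun => y y0.
have [ylt|yge] := ltP y 0.
  rewrite (_ : _ @^-1` _ = set0) ?measure0//.
  apply/seteqP; split=> // x /= gy.
  by have : 0 <= g n x := fun_ge0 x; rewrite gy; lra.
have {}y0 : 0 < y by rewrite lt_neqAle eq_sym y0.
have yp : 0 < y `^ p by exact: powR_gt0.
have mE : measurable (g n @^-1` [set y]) by [].
(* Markov's inequality: on this level set [f] is at least [y], and [f ^ p] is integrable. *)
have : ((y `^ p)%:E * mu (g n @^-1` [set y]) < +oo)%E.
  apply: le_lt_trans fp.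
  have <- : (\int[mu]_x ((y `^ p)%:E * (\1_(g n @^-1` [set y]) x)%:E))%E =
      ((y `^ p)%:E * mu (g n @^-1` [set y]))%E.
    rewrite ge0_integralZl//; first by rewrite integral_indic// setIT.
      by apply/measurable_EFinP.
    by rewrite lee_fin ltW.
  apply: ge0_le_integral => //.
  - by move=> x _; rewrite -EFinM lee_fin mulr_ge0// ltW.
  - by apply/measurable_EFinP; apply: measurable_funM.
  - exact: mpow.
  - move=> x _; rewrite -EFinM lee_fin indicE; case: (boolP (x \in _)) => [/set_mem/= gy|_].
      rewrite mulr1; apply: ge0_ler_powR; rewrite ?nnegrE// ?(ltW p_gt0)//.
      by rewrite -gy.
    by rewrite mulr0 powR_ge0.
by case: (mu _) (measure_ge0 mu (g n @^-1` [set y])) => [r|//|//] _; rewrite ?ltry// mulry gtr0_sg// mul1e.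
Qed.

Lemma set_controlled_Lfun (f : X -> R) : measurable_fun setT f ->
  (Np f < +oo)%E -> set_controlled f.
Proof.
move=> mf Nf.
have fp : (\int[mu]_x (`|f x| `^ p)%:E < +oo)%E.
  have := powR_Lnorm mu (EFin \o f) p_neq0; under eq_integral do rewrite /=.
  by move=> <-; exact: poweR_lty.
have part (u : X -> R) : measurable_fun setT u -> (forall x, 0 <= u x <= `|f x|) ->
    set_controlled u.
  move=> mu' u0; apply: set_controlled_ge0 => //; first by move=> x; have /andP[] := u0 x.
  apply: le_lt_trans fp; apply: ge0_le_integral => //.
  - by move=> x _; rewrite lee_fin powR_ge0.
  - by apply/measurable_EFinP; exact: (@measurableT_comp _ _ _ _ _ _ (@powR R ^~ p)).
  - apply/measurable_EFinP; apply: (@measurableT_comp _ _ _ _ _ _ (@powR R ^~ p)) => //.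
    exact: measurableT_comp.
  - move=> x _; rewrite lee_fin; have /andP[? ?] := u0 x.
    by apply: ge0_ler_powR; rewrite ?nnegrE// ?(ltW p_gt0).
rewrite (_ : f = (fun x => Num.max (f x) 0 + (-1) * Num.max (- f x) 0)); last first.
  apply/funext => x; rewrite mulN1r; have [h|/negP h] := boolP (0 <= f x).
    by rewrite max_l// max_r ?oppr_le0// subr0.
  have {}h : f x <= 0 by rewrite leNgt; apply/negP => /ltW.
  by rewrite max_r// max_l ?oppr_ge0// opprK add0r.
have mp : measurable_fun setT (fun x => Num.max (f x) 0).
  by apply: measurable_maxr.
have mn : measurable_fun setT (fun x => Num.max (- f x) 0).
  by apply: measurable_maxr => //; exact: measurableT_comp.
apply: set_controlledD => //; first exact: measurable_funM.
  apply: part => // x; rewrite le_max lexx orbT ge_max normr_ge0 andbT.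
  exact: ler_norm.
apply: set_controlledZ => //; apply: part => // x.
rewrite le_max lexx orbT ge_max normr_ge0 andbT -normrN.
exact: ler_norm.
Qed.

End SetControl.

Section WeakAutTopology.
Variables (R : realType) (d : measure_display) (X : measurableType d).
Variables (mu : {measure set X -> \bar R}) (p : R).
Hypothesis p1 : (1 <= p%:E)%E.
Local Notation Aut := (weak_aut mu p1).
Local Notation Lp := (LfunType mu p1).
Implicit Types s t : Aut.

(** Inverses appear because the Koopman operator composes with them: this is the [p]-th power of the
    [L^p] distance between the images of the indicator of [E]. *)
Definition aut_inv_dist s t (E : set X) : \bar R :=
  mu (mp_inv (repr (s : mp_aut mu)) @^-1` E `+` mp_inv (repr (t : mp_aut mu)) @^-1` E).

Definition set_nbhd s (U : set Aut) : Prop :=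
  exists (Es : seq (set X)) (dl : R), [/\ 0 < dl,
    forall E, E \in Es -> measurable E /\ (mu E < +oo)%E &
    forall t, (forall E, E \in Es -> (aut_inv_dist s t E < dl%:E)%E) -> U t].

Let set_nbhd_filter s : Filter (set_nbhd s).
Proof.
split.
- by exists [::], 1; split.
- move=> U V [Es [dl [dl0 mEs EU]]] [Es' [dl' [dl0' mEs' EV]]].
  exists (Es ++ Es'), (Num.min dl dl'); split.
  + by rewrite lt_min dl0.
  + by move=> E; rewrite mem_cat => /orP[/mEs|/mEs'].
  + move=> t st; split.
      apply: EU => E EE; apply: lt_le_trans (st E _) _; first by rewrite mem_cat EE.
      by rewrite lee_fin ge_min lexx.
    apply: EV => E EE; apply: lt_le_trans (st E _) _; first by rewrite mem_cat EE orbT.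
    by rewrite lee_fin ge_min lexx orbT.
- move=> U V UV [Es [dl [dl0 mEs EU]]]; exists Es, dl; split=> // t st.
  exact/UV/EU.
Qed.

Lemma weak_nbhs_set_nbhd s (U : set Aut) : nbhs s U -> set_nbhd s U.
Proof.
move: U; apply/(weak_aut_cvgP s (set_nbhd_filter s)) => f.
apply/(@cvg_ballP R Lp Aut (set_nbhd s) (set_nbhd_filter s)) => e e0.
have mf : measurable_fun setT (f : X -> R) by exact: measurable_funP.
have Nf : ('N[mu]_p%:E[EFin \o (f : X -> R)] < +oo)%E by exact: Lfunction_finite.
have [Es [dl [dl0 mEs h]]] := set_controlled_Lfun p1 mf Nf e0.
exists Es, dl; split=> // t st.
exact: (h (mp_opp (repr (s : mp_aut mu))) (mp_opp (repr (t : mp_aut mu)))).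
Qed.

Lemma weak_nbhs_aut_inv_dist s (E : set X) (e : R) : measurable E -> (mu E < +oo)%E -> 0 < e ->
  nbhs s [set t | (aut_inv_dist s t E <= e%:E)%E].
Proof.
move=> mE Efin e0.
have p0 : 0 < p by rewrite (lt_le_trans ltr01)// -lee_fin.
have E_Lp : (\1_E : X -> R) \in Lfun mu p%:E.
  apply/andP; split; rewrite inE /=; first exact: measurable_indic.
  rewrite /finite_norm unlock /Lnorm; apply: poweR_lty.
  rewrite (_ : (\int[mu]_x _)%E = mu E)//.
  rewrite -[in RHS](setIT E) -integral_indic//; apply: eq_integral => x _ /=.
  rewrite indicE; case: (x \in E); rewrite /= ?normr1 ?normr0 ?powR1 ?powR0//.
  by rewrite gt_eqF.
pose f : Lp := Lfun_Sub p1 E_Lp.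
have eta0 : 0 < e `^ p^-1 by exact: powR_gt0.
have cont := (weak_aut_cvgP s (nbhs_filter s)).1 (@cvg_id _ (nbhs s)) f.
have := (@cvg_ballP R Lp Aut (nbhs s) (nbhs_filter s) (fun t => koopman t f) _).1 cont _ eta0.
have etaE : (e `^ p^-1) `^ p = e by rewrite -powRrM mulVf ?gt_eqF// powRr1// ltW.
apply: filterS => t /(Lnorm_ltE p1 eta0); rewrite etaE.
rewrite /= /aut_inv_dist -(integral_powR_indicB mu p1); last 2 first.
- rewrite -[X in measurable X]setTI.
  exact: (@mp_measurable_inv _ _ _ _ (repr (s : mp_aut mu)) measurableT _ mE).
- rewrite -[X in measurable X]setTI.
  exact: (@mp_measurable_inv _ _ _ _ (repr (t : mp_aut mu)) measurableT _ mE).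
apply: le_trans; rewrite le_eqVlt; apply/orP; left; apply/eqP/eq_integral => x _.
by rewrite /= !indicE.
Qed.

(** Closedness of points makes the finite subgroups closed, hence Borel, as a Haar probability
    requires. *)
Lemma weak_aut_accessible (e : X -> R) : measurable_fun setT e -> injective e ->
  sigma_finite [set: X] mu -> accessible_space Aut.
Proof.
move=> me einj [S SX mS] s t st.
have [[E [mE Efin Est]]|noE] := pselect (exists E, [/\ measurable E, (mu E < +oo)%E &
    (0 < aut_inv_dist s t E)%E]).
  have [r r0 rE] : exists2 r : R, 0 < r & (r%:E < aut_inv_dist s t E)%E.
    move: Est; case: (aut_inv_dist s t E) => [x| |]//.
      by rewrite lte_fin => x0; exists (x / 2); rewrite ?divr_gt0// lte_fin; lra.
    by exists 1 => //; rewrite ltry.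
  have := weak_nbhs_aut_inv_dist s mE Efin r0; rewrite nbhsE => -[A [oA As] AE].
  exists A; split=> //; [exact: mem_set|apply/mem_set => /AE /=].
  by rewrite leNgt rE.
exfalso; move/eqP: st; apply; rewrite -[s]reprK -[t]reprK; apply/mp_aut_eqP.
set s' := repr _; set t' := repr _.
suff st : mp_inv s' = mp_inv t' %[ae mu].
  exact: (@mp_inv_ae _ _ _ mu (mp_opp s') (mp_opp t') st).
have E0 E : measurable E -> (mu E < +oo)%E ->
    {ae mu, forall x, E (mp_inv s' x) <-> E (mp_inv t' x)}.
  move=> mE Efin; have : aut_inv_dist s t E = 0%E.
    apply/eqP; rewrite eq_le measure_ge0 andbT leNgt; apply/negP => Est.
    by apply: noE; exists E.
  have mYE : measurable (mp_inv s' @^-1` E `+` mp_inv t' @^-1` E).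
    by apply: measurableY; rewrite -[X in measurable X]setTI;
      [exact: (@mp_measurable_inv _ _ _ _ s' measurableT _ mE)
      |exact: (@mp_measurable_inv _ _ _ _ t' measurableT _ mE)].
  move=> /(negligibleP _ mYE); apply: negligibleS => x /= /not_andP[] /not_implyP[? ?];
    by [left|right].
(* A countable family of sets of finite measure that separates points: the [S n] cover [X], and
   rational cuts of the injective function [e] distinguish any two points. *)
pose En (n : nat) (q : rat) := S n `&` [set x | e x <= ratr q].
have mEn n q : measurable (En n q).
  apply: measurableI; first by have [] := mS n.
  rewrite (_ : [set _ | _] = e @^-1` `]-oo, ratr q]%classic).
    by rewrite -[X in measurable X]setTI; apply: me => //; exact: measurable_itv.
  by apply/seteqP; split=> x /=; rewrite in_itv.
have En_fin n q : (mu (En n q) < +oo)%E.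
  by have [mSn Sn] := mS n; apply: le_lt_trans Sn; apply: le_measure; rewrite ?inE// => x [].
have : {ae mu, forall x, forall (k : nat), if unpickle k is Some (n, q) then
    En n q (mp_inv s' x) <-> En n q (mp_inv t' x) else True}.
  apply/ae_foralln => k; case: unpickle => [[n q]|]; first exact: E0.
  exact: aeW.
apply: filterS => x h _; apply: einj.
have {}h n q : En n q (mp_inv s' x) <-> En n q (mp_inv t' x).
  have [k kq] : exists k, unpickle k = Some (n, q).
    by exists (pickle (n, q)); exact: pickleK.
  by have := h k; rewrite kq.
have le_of (u v : X) : (forall n q, En n q u -> En n q v) -> e v <= e u.
  move=> uv; rewrite leNgt; apply/negP => /rat_in_itvoo[q].
  rewrite in_itv/= => /andP[uq qv].
  have [n _ Su] : (\bigcup_n S n) u by rewrite -SX.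
  have [_ /=] := uv n q (conj Su (ltW uq)).
  by rewrite leNgt qv.
by apply/eqP; rewrite eq_le !le_of// => n q /h.
Qed.

End WeakAutTopology.

(** * Levels of permuted cells *)

Section UniformProbability.
Variables (R : realType) (d : measure_display) (T : measurableType d).
Variables (I : finType) (x : I -> T) (i0 : I).

Let Icard_gt0 : 0 < #|I|%:R :> R.
Proof. by rewrite ltr0n; apply/card_gt0P; exists i0. Qed.

Let Icard_inv_ge0 : 0 <= #|I|%:R^-1 :> R.
Proof. by rewrite invr_ge0. Qed.

(** The law of [x i] for a uniform index [i]. Values count with multiplicity, as [x] is not assumed
    injective; [i0] witnesses that [I] is non-empty. *)
Definition uniform_on : set T -> \bar R := mscale (NngNum Icard_inv_ge0)
  (msum (fun k => dirac (x (nth i0 (enum I) k))) #|I|).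

HB.instance Definition _ := Measure.on uniform_on.

Lemma uniform_onE A : uniform_on A = (#|[set i | x i \in A]%SET|%:R / #|I|%:R)%:E.
Proof.
rewrite /uniform_on /mscale /= /msum.
rewrite (eq_bigr (fun k : 'I_#|I| => (\1_A (x (enum_val k)))%:E)); last first.
  by move=> k _; rewrite /= /dirac (enum_val_nth i0).
rewrite sumEFin -EFinM mulrC; congr (_ / _)%:E.
rewrite -(big_enum_val (A := predT) (fun i => \1_A (x i)))/=.
under eq_bigr do rewrite indicE.
rewrite -natr_sum -sum1_card big_mkcond/= [in RHS]big_mkcond/=; congr _%:R.
by apply: eq_bigr => i _; rewrite inE; case: (_ \in _).
Qed.

Lemma uniform_on_setT : uniform_on setT = 1%E.
Proof.
rewrite uniform_onE (_ : [set i | x i \in setT]%SET = [set: I]%SET) ?cardsT ?divff ?gt_eqF//.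
by apply/setP => i; rewrite !inE in_setT.
Qed.

HB.instance Definition _ := Measure_isProbability.Build _ _ _ uniform_on uniform_on_setT.

End UniformProbability.

Section MpClass.
Variables (R : realType) (d : measure_display) (X : measurableType d).
Variables (mu : {measure set X -> \bar R}).
Local Open Scope quotient_scope.

Definition mp_class (s : mp_transf mu) : mp_aut mu := \pi_(mp_aut mu) s.

Lemma mp_classM (s t : mp_transf mu) :
  mp_class (mp_comp s t) = (mp_class s * mp_class t)%g.
Proof.
apply/mp_aut_eqP; apply: mp_comp_ae; apply: ae_eq_sym; exact: repr_pi_ae.
Qed.

Lemma mp_class_id : mp_class (mp_id mu) = 1%g.
Proof. by []. Qed.

Lemma mp_class_repr (s : mp_transf mu) : mp_fun (repr (mp_class s)) = mp_fun s %[ae mu].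
Proof. exact: repr_pi_ae. Qed.

Lemma eq_mp_class (s t : mp_transf mu) : mp_fun s =1 mp_fun t -> mp_class s = mp_class t.
Proof. by move=> st; apply/mp_aut_eqP; apply: aeW => x _; exact: st. Qed.

Lemma mp_inv_eq (s t : mp_transf mu) : mp_fun s =1 mp_fun t -> mp_inv s =1 mp_inv t.
Proof. by move=> st x; apply: (can_inj (mp_funK s)); rewrite mp_invK st mp_invK. Qed.

End MpClass.

Lemma ae_eq_measure (R : realType) d (X : measurableType d)
    (mu : {measure set X -> \bar R}) (A B : set X) :
  measurable A -> measurable B -> {ae mu, forall x, A x <-> B x} -> mu A = mu B.
Proof.
suff le_of U V : measurable U -> measurable V -> {ae mu, forall x, U x <-> V x} ->
    (mu U <= mu V)%E.
  move=> mA mB AB; apply/eqP; rewrite eq_le !le_of//.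
  by apply: filterS AB => x [].
move=> mU mV [M [mM M0 UVM]]; apply: (@le_trans _ _ (mu (V `|` M))).
  apply: le_measure; rewrite ?inE//; first exact: measurableU.
  move=> x Ux; have [?|nV] := pselect (V x); [by left|right].
  by apply: UVM => /= -[/(_ Ux)].
by apply: le_trans (measureU2 _ mV mM) _; rewrite [X in (_ + X)%E]M0 adde0.
Qed.

Lemma bigsetU_ordP (T : Type) (n : nat) (P : pred 'I_n) (F : 'I_n -> set T) :
  \big[setU/set0]_(i < n | P i) F i = [set x | exists2 i, P i & F i x].
Proof.
apply/seteqP; split=> x /=.
  by elim/big_ind: _ => //= [A B IA IB [/IA|/IB]//|i Pi Fx]; exists i.
by move=> [i Pi Fx]; rewrite (bigD1 i)//=; left.
Qed.

Lemma measure_bigsetU_ord_le (R : realType) d (X : measurableType d)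
    (mu : {measure set X -> \bar R}) (n : nat) (P : pred 'I_n) (F : 'I_n -> set X) (e : R) :
  (forall i, P i -> measurable (F i)) -> (forall i, P i -> (mu (F i) <= e%:E)%E) -> 0 <= e ->
  (mu (\big[setU/set0]_(i < n | P i) F i) <= (n%:R * e)%:E)%E.
Proof.
move=> mF Fe e0.
have /proj2 : measurable (\big[setU/set0]_(i < n | P i) F i) /\
    (mu (\big[setU/set0]_(i < n | P i) F i) <= \sum_(i < n | P i) e%:E)%E.
  apply: (big_ind2 (fun A y => measurable A /\ (mu A <= y)%E)).
  - by rewrite measure0.
  - move=> A x B y [mA Ax] [mB By]; split; first exact: measurableU.
    by apply: le_trans (measureU2 _ _ _) _ => //; exact: leeD.
  - by move=> i Pi; split; [exact: mF|exact: Fe].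
move=> /le_trans; apply; rewrite sumEFin lee_fin sumr_const -[leLHS]mulr_natl.
rewrite ler_wpM2r// ler_nat; exact: leq_trans (max_card _) (eq_leq (card_ord n)).
Qed.

Section Levels.
Variables (R : realType) (d : measure_display) (X : measurableType d).
Variables (mu : {measure set X -> \bar R}).
Variables (N : nat -> nat) (w : nat -> R) (D : forall n, 'I_(N n) -> set X).
Variable S : forall n, 'S_(N n) -> mp_transf mu.
Arguments D : clear implicits.
Arguments S : clear implicits.
Hypothesis w_gt0 : forall n, 0 < w n.
Hypothesis measurable_D : forall n i, measurable (D n i).
Hypothesis D_disjoint : forall n i j x, D n i x -> D n j x -> i = j.
Hypothesis mu_D : forall n i, mu (D n i) = (w n)%:E.
Hypothesis S_D : forall n (s : 'S_(N n)) i x, D n i x -> D n (s i) (mp_fun (S n s) x).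
Hypothesis S_fix : forall n (s : 'S_(N n)) x, (forall i, D n i x -> s i = i) ->
  mp_fun (S n s) x = x.
Hypothesis D_refine : forall m n i, (m <= n)%N ->
  exists B : {set 'I_(N n)}, D m i = [set x | exists2 j, j \in B & D n j x].
Hypothesis D_approx : forall E (e : R), measurable E -> (mu E < +oo)%E -> 0 < e ->
  exists n0, forall n, (n0 <= n)%N -> exists J : {set 'I_(N n)},
    (mu (E `+` [set x | exists2 j, j \in J & D n j x]) < e%:E)%E.

Definition cells n (J : {set 'I_(N n)}) : set X := [set x | exists2 j, j \in J & D n j x].

Lemma measurable_cells n J : measurable (@cells n J).
Proof.
by rewrite /cells -(bigsetU_ordP (mem J)); apply: bigsetU_measurable => i _.
Qed.

Lemma mu_cells n J : mu (@cells n J) = (#|J|%:R * w n)%:E.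
Proof.
rewrite /cells -(bigsetU_ordP (mem J)) measure_bigsetU_ord_cond//; last first.
  by move=> i j _ _ [x [Dix Djx]]; exact: D_disjoint Dix Djx.
rewrite (eq_bigr (fun=> (w n)%:E)); last by move=> i _; exact: mu_D.
by rewrite sumEFin sumr_const mulr_natl.
Qed.

Let preim_cells n (s : 'S_(N n)) (J : {set 'I_(N n)}) :
  [set x | exists2 j, s j \in J & D n j x] `<=` mp_fun (S n s) @^-1` cells J.
Proof. by move=> x [j sJ Dj]; exists (s j) => //; exact: S_D. Qed.

Let mu_pre (g : mp_transf mu) E : measurable E -> mu (mp_fun g @^-1` E) = mu E.
Proof. exact: mp_preserving. Qed.

Let measurable_pre (g : mp_transf mu) E :
  measurable E -> measurable (mp_fun g @^-1` E).
Proof. exact: measurable_mp_fun_preimage. Qed.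

(* The colour of a cell is the unique set of [J] containing it; matching colours
   with blocks makes the permutation follow [g] up to the approximation error. *)
Lemma level_density_cells (g : mp_transf mu) m (e : R) : 0 < e ->
  exists n (s : 'S_(N n)), forall i : 'I_(N m),
    (mu (mp_fun g @^-1` D m i `+` mp_fun (S n s) @^-1` D m i) < e%:E)%E.
Proof.
move=> e0; pose E i := mp_fun g @^-1` D m i.
have mE i : measurable (E i) by exact: measurable_pre.
have muE i : mu (E i) = (w m)%:E by rewrite /E mu_pre// mu_D.
have E_disj i j x : E i x -> E j x -> i = j by exact: D_disjoint.
(* Each of the two differences will be at most [2 * N m * dl]; the successor makes the total
   strictly less than [e]. *)
pose dl := e / (4 * (N m).+1%:R).
have dl0 : 0 < dl by rewrite divr_gt0// mulr_gt0.
have /choice[n0 n0P] : forall i, exists n0, forall n, (n0 <= n)%N ->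
    exists J : {set 'I_(N n)}, (mu (E i `+` cells J) < dl%:E)%E.
  by move=> i; apply: D_approx => //; rewrite muE ltry.
pose n := maxn m (\max_i n0 i).
have mn : (m <= n)%N by rewrite leq_maxl.
have /choice[J JP] : forall i, exists J : {set 'I_(N n)}, (mu (E i `+` cells J) < dl%:E)%E.
  by move=> i; apply: n0P; rewrite leq_max (leq_bigmax i) orbT.
have /choice[B BP] : forall i, exists B : {set 'I_(N n)}, D m i = cells B.
  by move=> i; exact: D_refine.
have cell_ex (y : 'I_(N n)) : exists x, D n y x.
  apply/set0P/eqP => Dy0; have := mu_D y; rewrite Dy0 measure0 => -[w0].
  by have := w_gt0 n; rewrite -w0 ltxx.
have B_disj i j y : y \in B i -> y \in B j -> i = j.
  move=> yi yj; have [x Dx] := cell_ex y.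
  by apply: (@D_disjoint m i j x); rewrite BP; exists y.
pose color (y : 'I_(N n)) : option 'I_(N m) :=
  [pick i | (y \in J i) && [forall j, (y \in J j) ==> (j == i)]].
pose block (y : 'I_(N n)) : option 'I_(N m) := [pick i | y \in B i].
have colorP i y : color y = Some i <-> y \in J i /\ forall j, y \in J j -> j = i.
  rewrite /color; case: pickP => [k /andP[yk /forallP h]|h]; split.
  - by move=> [<-]; split=> // j yj; apply/eqP; have := h j; rewrite yj.
  - by move=> [yi hi]; congr Some; exact: hi.
  - by [].
  - move=> [yi hi]; have := h i; rewrite yi /= => /forallP; case=> j.
    by apply/implyP => /hi ->.
have blockP i y : block y = Some i <-> y \in B i.
  rewrite /block; case: pickP => [k yk|h]; split=> //.
  - by move=> [<-].
  - by move=> yi; congr Some; exact: B_disj yk yi.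
  - by rewrite h.
have [s sP] := matching_perm color block.
exists n, s => i.
pose Q := mp_fun (S n s) @^-1` D m i.
have mQ : measurable Q by exact: measurable_pre.
have muQ : mu Q = (w m)%:E by rewrite /Q mu_pre// mu_D.
pose Z := \big[setU/set0]_(j < N m) (E j `+` cells (J j)).
have mZ : measurable Z.
  by apply: bigsetU_measurable => j _; apply: measurableY => //; exact: measurable_cells.
have muZ : (mu Z <= ((N m)%:R * dl)%:E)%E.
  apply: measure_bigsetU_ord_le => [j _|j _|]; [|exact/ltW/JP|exact: ltW].
  by apply: measurableY => //; exact: measurable_cells.
have ZP x : (exists j, (E j `+` cells (J j)) x) -> Z x.
  by move=> [j h]; rewrite /Z bigsetU_ordP; exists j.
pose C : {set 'I_(N n)} := [set y | color y == Some i]%SET.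
pose Y : {set 'I_(N n)} :=
  [set y | (color y == Some i) && (block (s y) == Some i)]%SET.
have YQ : cells Y `<=` Q.
  move=> x [y]; rewrite inE => /andP[_ /eqP/blockP sy] Dx.
  by rewrite /Q /= BP; apply: preim_cells; exists y.
have CE : E i `\` cells C `<=` Z.
  move=> x [Ex nC]; apply: ZP; have [Jx|nJ] := pselect (cells (J i) x); last first.
    by exists i; left.
  have [y yJ Dx] := Jx; have [j yj ji] : exists2 j, y \in J j & j <> i.
    apply: contrapT => nj; apply: nC; exists y => //; rewrite inE; apply/eqP/colorP.
    by split=> // j yj; apply: contrapT => ji; apply: nj; exists j.
  by exists j; right; split; [exists y|move=> /(E_disj _ _ _ Ex) ij; apply: ji].
have YE : cells Y `\` E i `<=` Z.
  move=> x [[y]]; rewrite inE => /andP[/eqP/colorP[yJ _] _] Dx nE.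
  by apply: ZP; exists i; right; split=> //; exists y.
have mC := measurable_cells C; have mY := measurable_cells Y.
have cardB : (#|[set y | block y == Some i]%SET|%:R * w n)%:E = (w m)%:E.
  rewrite -mu_cells -(mu_D i) BP; congr (mu (cells _)).
  by apply/setP => y; rewrite inE; apply/eqP/idP => /blockP.
have cardC : w m - (N m)%:R * dl <= #|C|%:R * w n.
  rewrite -lee_fin EFinB -mu_cells leeBlDr// -(muE i).
  apply: (@le_trans _ _ (mu (cells C `|` Z))).
    apply: le_measure; rewrite ?inE//; first exact: measurableU.
    by move=> x Ex; have [?|?] := pselect (cells C x); [left|right; exact: CE].
  by apply: le_trans (measureU2 _ _ _) _ => //; rewrite leeD2l.
have cardY : w m - (N m)%:R * dl <= #|Y|%:R * w n.
  apply: (@le_trans _ _ ((minn #|C| #|[set y | block y == Some i]%SET|)%:R * w n)).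
    rewrite /minn; case: ifP => _ //; case: cardB => ->.
    by rewrite gerBl mulr_ge0// ltW.
  by rewrite ler_pM2r// ler_nat; exact: sP.
have Qfin : (mu Q < +oo)%E by rewrite muQ ltry.
have Efin : (mu (E i) < +oo)%E by rewrite muE ltry.
have QE : (mu (Q `\` E i) <= (2 * (N m)%:R * dl)%:E)%E.
  apply: (@le_trans _ _ (mu ((Q `\` cells Y) `|` Z))).
    apply: le_measure; rewrite ?inE; [exact: measurableD| |].
      by apply: measurableU => //; exact: measurableD.
    move=> x [Qx nEx]; have [Yx|nY] := pselect (cells Y x); last by left.
    by right; apply: YE.
  apply: le_trans (measureU2 _ _ _) _ => //; first exact: measurableD.
  rewrite -mulrA mulr2n mulrDl mul1r EFinD; apply: leeD; last exact: muZ.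
  rewrite (_ : (_ <= _)%E = (mu (Q `\` cells Y) <= ((N m)%:R * dl)%:E)%E)//.
  rewrite (_ : mu _ = (w m - #|Y|%:R * w n)%:E); first by rewrite lee_fin; lra.
  rewrite EFinB -muQ -mu_cells -[in RHS](setIidr YQ).
  exact: (measureD mQ mY Qfin).
(* [E i] and [Q] have the same finite measure, so their two differences do too, and estimating one
   is enough. *)
have EQ : mu (E i `\` Q) = mu (Q `\` E i).
  have -> : mu (E i `\` Q) = (mu (E i) - mu (E i `&` Q))%E.
    exact: (measureD (mE i) mQ Efin).
  have -> : mu (Q `\` E i) = (mu Q - mu (Q `&` E i))%E.
    exact: (measureD mQ (mE i) Qfin).
  by rewrite setIC muE muQ.
apply: le_lt_trans (measureU2 _ (measurableD (mE i) mQ) (measurableD mQ (mE i))) _.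
have EQ' := QE; rewrite -EQ in EQ'; apply: le_lt_trans (leeD EQ' QE) _.
rewrite -EFinD lte_fin /dl.
rewrite (_ : _ + _ = e * ((N m)%:R / (N m).+1%:R)); last first.
  have : (N m).+1%:R != 0 :> R by rewrite pnatr_eq0.
  by move: (N m).+1%:R => z z0; field.
by rewrite gtr_pMr// ltr_pdivrMr// mul1r ltr_nat.
Qed.

(** Each [E] is first replaced by a union [U] of cells of a common level [m]. Where neither image of
    a point falls in the difference of [E] and [U], the disagreement over [E] is one over [U], hence
    over some cell of level [m]. *)
Lemma level_density (g : mp_transf mu) (Es : seq (set X)) (e : R) : 0 < e ->
  (forall E, E \in Es -> measurable E /\ (mu E < +oo)%E) ->
  exists n (s : 'S_(N n)), forall E, E \in Es ->
    (mu (mp_fun g @^-1` E `+` mp_fun (S n s) @^-1` E) < e%:E)%E.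
Proof.
move=> e0 mEs; have e4 : 0 < e / 4 by rewrite divr_gt0.
have [m mP] : exists m, forall E, E \in Es -> exists J : {set 'I_(N m)},
    (mu (E `+` cells J) < (e / 4)%:E)%E.
  (* The approximation is required at all later levels, so that the levels found for the individual
     sets can be merged. *)
  suff [m mP] : exists m, forall n, (m <= n)%N -> forall E, E \in Es ->
      exists J : {set 'I_(N n)}, (mu (E `+` cells J) < (e / 4)%:E)%E.
    by exists m; exact: mP.
  elim: Es mEs => [|E Es IH] mEs; first by exists 0%N.
  have [|m mP] := IH; first by move=> F FE; apply: mEs; rewrite inE FE orbT.
  have [mE Efin] := mEs E (mem_head _ _).
  have [n0 n0P] := D_approx mE Efin e4.
  exists (maxn m n0) => n; rewrite geq_max => /andP[mn n0n] F.
  by rewrite in_cons => /orP[/eqP->|]; [exact: n0P|exact: mP].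
pose dl := e / (4 * (N m).+1%:R).
have dl0 : 0 < dl by rewrite divr_gt0// mulr_gt0.
have [n [s sP]] := level_density_cells g m dl0.
exists n, s => E EEs; have [mE Efin] := mEs E EEs; have [J JP] := mP E EEs.
pose T := mp_fun g; pose T' := mp_fun (S n s); pose U := cells J.
have mU : measurable U := measurable_cells J.
have mEU : measurable (E `+` U) by exact: measurableY.
pose Z := \big[setU/set0]_(i < N m | i \in J) (T @^-1` D m i `+` T' @^-1` D m i).
have mDY i : measurable (T @^-1` D m i `+` T' @^-1` D m i).
  by apply: measurableY; exact: measurable_pre.
have mZ : measurable Z by apply: bigsetU_measurable => i _.
have muZ : (mu Z <= ((N m)%:R * dl)%:E)%E.
  by apply: measure_bigsetU_ord_le => [//|i _|]; [exact/ltW/sP|exact: ltW].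
have sub : T @^-1` E `+` T' @^-1` E `<=`
    (T @^-1` (E `+` U) `|` T' @^-1` (E `+` U)) `|` Z.
  move=> x Ex; have [?|nTU] := pselect ((E `+` U) (T x)); first by left; left.
  have [?|nTU'] := pselect ((E `+` U) (T' x)); first by left; right.
  have eqU y : ~ (E `+` U) y -> E y <-> U y.
    move=> nY; split=> h; apply: contrapT => nh; apply: nY; [left|right]; split=> //.
  have UY : (T @^-1` U `+` T' @^-1` U) x.
    have /= := eqU _ nTU; have /= := eqU _ nTU'.
    by move: Ex => /= [[? ?]|[? ?]] ? ?; [left|right]; tauto.
  right; rewrite /Z bigsetU_ordP; case: UY => -[[i iJ Di] nU].
    by exists i => //; left; split=> // Di'; apply: nU; exists i.
  by exists i => //; right; split=> // Di'; apply: nU; exists i.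
have m1 : measurable (T @^-1` (E `+` U)) by exact: measurable_pre.
have m2 : measurable (T' @^-1` (E `+` U)) by exact: measurable_pre.
have mE' : measurable (T @^-1` E `+` T' @^-1` E).
  by apply: measurableY; exact: measurable_pre.
apply: (@le_lt_trans _ _ (mu ((T @^-1` (E `+` U) `|` T' @^-1` (E `+` U)) `|` Z))).
  by apply: le_measure; rewrite ?inE//; apply: measurableU => //; exact: measurableU.
apply: le_lt_trans (measureU2 _ (measurableU _ _ m1 m2) mZ) _.
have mu1 : mu (T @^-1` (E `+` U)) = mu (E `+` U) by exact: mu_pre.
have mu2 : mu (T' @^-1` (E `+` U)) = mu (E `+` U) by exact: mu_pre.
have U2 : (mu (T @^-1` (E `+` U) `|` T' @^-1` (E `+` U)) <= (e / 4 + e / 4)%:E)%E.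
  apply: le_trans (measureU2 _ m1 m2) _; rewrite EFinD.
  by apply: leeD; [have := ltW JP; rewrite -mu1|have := ltW JP; rewrite -mu2].
apply: le_lt_trans (leeD U2 muZ) _; rewrite -EFinD lte_fin /dl.
have : (N m)%:R * (e / (4 * (N m).+1%:R)) < e / 4.
  rewrite (_ : _ * _ = e / 4 * ((N m)%:R / (N m).+1%:R)); last first.
    have : (N m).+1%:R != 0 :> R by rewrite pnatr_eq0.
    by move: (N m).+1%:R => z z0; field.
  by rewrite gtr_pMr// ltr_pdivrMr// mul1r ltr_nat.
by set q := (N m)%:R * _; move: q => q; lra.
Qed.

(** * The level subgroups and their concentration *)

Variables (p : R) (p1 : (1 <= p%:E)%E).
Local Notation Aut := (weak_aut mu p1).
Hypothesis S_mul : forall n (s t : 'S_(N n)) x,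
  mp_fun (S n (s * t)%g) x = mp_fun (S n t) (mp_fun (S n s) x).
Hypothesis S_refine : forall n (s : 'S_(N n)),
  exists t : 'S_(N n.+1), mp_fun (S n.+1 t) =1 mp_fun (S n s).
Hypothesis Nw_small : forall e : R, 0 < e ->
  exists n0, forall n, (n0 <= n)%N -> (N n)%:R * w n ^+ 2 < e.
Hypothesis Aut_accessible : accessible_space Aut.

(* ['S_n] composes from left to right, whence the inverse. *)
Definition lev n (s : 'S_(N n)) : Aut := mp_class (mp_opp (S n s)).

Let levM n (s t : 'S_(N n)) : lev (s * t)%g = (lev s * lev t)%g.
Proof.
rewrite /lev -[RHS](mp_classM (mp_opp (S n s)) (mp_opp (S n t))).
apply: eq_mp_class => x /=; apply: (can_inj (mp_funK (S n (s * t)%g))).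
by rewrite mp_invK S_mul !mp_invK.
Qed.

Let lev1 n : lev (1 : 'S_(N n))%g = 1%g.
Proof.
rewrite -mp_class_id; apply: eq_mp_class => x /=.
apply: (can_inj (mp_funK (S n 1%g))); rewrite mp_invK S_fix// => i _.
by rewrite perm1.
Qed.

Let levV n (s : 'S_(N n)) : lev s^-1%g = (lev s)^-1%g.
Proof. by apply/esym/(@mulIg _ (lev s)); rewrite mulVg -levM mulVg lev1. Qed.

Definition lev_group n : set Aut := range (@lev n).
Let K := lev_group.

Let K_subgroup n : subgroup (K n).
Proof.
split.
- by exists 1%g.
- by move=> _ _ [s _ <-] [t _ <-]; exists (s * t)%g.
- by move=> _ [s _ <-]; exists s^-1%g.
Qed.

Let K_finite n : finite_set (K n).
Proof. by apply: finite_image; exact: finite_finset. Qed.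

Let K_S n : K n `<=` K n.+1.
Proof.
move=> _ [s _ <-]; have [t tS] := S_refine s; exists t => //.
by apply: eq_mp_class => x /=; exact: mp_inv_eq.
Qed.

Let K_mono m n : (m <= n)%N -> K m `<=` K n.
Proof.
move=> /subnK <-; elim: (n - m)%N => // k IH; rewrite addSn.
exact: subset_trans (@K_S _).
Qed.

Let finite_closed (C : set Aut) : finite_set C -> closed C.
Proof. exact: (accessible_finite_set_closed.1 Aut_accessible). Qed.

Let closed_borel (C : set Aut) : closed C -> measurable (C : set (borel (right_uniform Aut))).
Proof.
move=> cC; rewrite -(setCK C); apply: measurableC; apply: open_borel.
exact: closed_openC.
Qed.

Definition lev_haar n : probability (borel (right_uniform Aut)) R :=
  uniform_on R (@lev n : 'S_(N n) -> borel (right_uniform Aut)) 1%g.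

Let cnt n (A : set Aut) := #|[set s : 'S_(N n) | lev s \in A]%SET|.

Let lev_haarE n A : lev_haar n A = ((cnt n A)%:R / (N n)`!%:R)%:E.
Proof. by rewrite /lev_haar -card_Sn; exact: uniform_onE. Qed.

Let cntT n : cnt n setT = (N n)`!.
Proof. by rewrite -card_Sn -cardsT; apply: eq_card => s; rewrite !inE in_setT. Qed.

(* Both groups act by translations on each other's uniform measure, so counting
   the pairs whose product lies in [A] in two ways identifies the measures. *)
Let cnt_eq m n (A : set Aut) : K m = K n ->
  (cnt m A * (N n)`! = cnt n A * (N m)`!)%N.
Proof.
move=> Kmn.
have cnt_sum k : cnt k A = (\sum_(s : 'S_(N k)) (lev s \in A))%N.
  rewrite /cnt -sum1_card big_mkcond/=; apply: eq_bigr => s _.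
  by rewrite inE; case: (_ \in _).
transitivity (\sum_(t : 'S_(N n)) \sum_(s : 'S_(N m)) ((lev s * lev t)%g \in A))%N.
  rewrite mulnC -card_Sn -sum_nat_const; apply: eq_bigr => t _.
  have [t' _ <-] : K m (lev t) by rewrite Kmn; exists t.
  by rewrite cnt_sum (reindex_inj (mulIg t')); apply: eq_bigr => s _; rewrite levM.
rewrite exchange_big/= mulnC -card_Sn -sum_nat_const; apply: eq_bigr => s _.
have [s' _ <-] : K n (lev s) by rewrite -Kmn; exists s.
by rewrite cnt_sum [RHS](reindex_inj (mulgI s')); apply: eq_bigr => t _; rewrite levM.
Qed.

Let fact_gt0R n : 0 < (N n)`!%:R :> R. Proof. by rewrite ltr0n fact_gt0. Qed.

Let lev_haar_eq m n (A : set Aut) : K m = K n -> lev_haar m A = lev_haar n A.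
Proof.
move=> Kmn; rewrite !lev_haarE; congr EFin; apply/eqP.
have neq0 k : (N k)`!%:R != 0 :> R by rewrite gt_eqF.
by rewrite eqr_div// -!natrM eqr_nat; apply/eqP; exact: cnt_eq.
Qed.

Let lev_haarP n : haar_probability (K n) (lev_haar n).
Proof.
have levK (s : 'S_(N n)) : lev s \in K n by apply/mem_set; exists s.
split.
- by apply: closed_borel; apply: finite_closed.
- rewrite lev_haarE (_ : cnt n (K n) = (N n)`!) ?divff ?gt_eqF//.
  by rewrite -[RHS]cntT; apply: eq_card => s; rewrite !inE levK in_setT.
- move=> _ A [s _ <-] mA; rewrite !lev_haarE; congr (_%:R / _)%:E.
  rewrite /cnt -[RHS](card_imset _ (mulgI s^-1%g)); apply: eq_card => t.
  rewrite inE; apply/idP/imsetP => [/set_mem/= h|[u]].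
    by exists (s * t)%g; rewrite ?mulKg// inE; apply/mem_set; rewrite levM.
  by rewrite inE => /set_mem Au ->; apply/mem_set; rewrite /= -levM mulKVg.
- move=> A mA; apply/eqP; rewrite eq_le; apply/andP; split.
    (* Regularity is attained: this finite part of [A] already carries the full measure of [A]. *)
    apply: ereal_sup_ubound; exists (A `&` K n).
      have finA : finite_set (A `&` K n) by apply: sub_finite_set (K_finite n) => x [].
      split; [exact: finite_compact|exact: finite_closed|by move=> x []].
    rewrite !lev_haarE; congr (_%:R / _)%:E; apply: eq_card => s.
    by rewrite !inE in_setI levK andbT.
  apply: ge_ereal_sup => _ [C [_ _ CA] <-]; rewrite !lev_haarE lee_fin.
  rewrite ler_pM2r ?invr_gt0// ler_nat; apply/subset_leq_card/fintype.subsetP => s.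
  by rewrite !finset.in_set => /set_mem Cs; apply/mem_set/CA.
Qed.

Let class_aut_inv_dist (g h : mp_transf mu) E : measurable E ->
  aut_inv_dist (mp_class g : Aut) (mp_class h : Aut) E =
  mu (mp_inv g @^-1` E `+` mp_inv h @^-1` E).
Proof.
move=> mE; have mi (u : mp_transf mu) : measurable (mp_inv u @^-1` E).
  exact: (measurable_mp_fun_preimage (mp_opp u)).
rewrite /aut_inv_dist; apply: ae_eq_measure; [exact: measurableY..|].
apply: filterS2 (mp_inv_ae (mp_class_repr g)) (mp_inv_ae (mp_class_repr h)).
by move=> x /(_ I) + /(_ I) /= => -> ->.
Qed.

Let K_dense : dense (\bigcup_(L in range K) L).
Proof.
move=> U [s Us] oU.
have [Es [dl [dl0 mEs EU]]] := weak_nbhs_set_nbhd (open_nbhs_nbhs (conj oU Us)).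
have [n [t tP]] := level_density (mp_opp (repr (s : mp_aut mu))) dl0 mEs.
exists (lev t); split; last by exists (K n); [exists n|exists t].
apply: EU => E EE; have [mE _] := mEs E EE.
rewrite -[s](reprK (s : mp_aut mu)) (class_aut_inv_dist _ (mp_opp (S n t)))//.
exact: tP.
Qed.

(** [s * t^-1] moves exactly [ham s t] cells, by right invariance, and the transformation is the
    identity off them. *)
Let lev_near1 n (s t : 'S_(N n)) E (dl : R) : measurable E ->
  (ham s t)%:R * w n < dl -> (aut_inv_dist 1%g (lev s * (lev t)^-1)%g E < dl%:E)%E.
Proof.
move=> mE st; rewrite -levV -levM -mp_class_id class_aut_inv_dist//.
pose J : {set 'I_(N n)} := [set i | (s * t^-1)%g i != i]%SET.
have Jst : #|J| = ham s t.
  rewrite -(ham_mulr s t t^-1) mulgV; apply: eq_card => i.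
  by rewrite !finset.in_set perm1.
apply: (@le_lt_trans _ _ (mu (cells J))); last by rewrite mu_cells Jst lte_fin.
have mS : measurable (mp_fun (S n (s * t^-1)%g) @^-1` E).
  exact: measurable_mp_fun_preimage.
apply: le_measure; rewrite ?inE.
- exact: measurableY.
- exact: measurable_cells.
- move=> x Yx; apply: contrapT => nJ.
  have fx : mp_fun (S n (s * t^-1)%g) x = x.
    apply: S_fix => i Di; apply/eqP/negPn/negP => ni; apply: nJ.
    by exists i => //; rewrite finset.in_set.
  by case: Yx => /= -[]; rewrite fx.
Qed.

(** The level [n1] depends on [A] only through the lower bound [al], so the sets may vary freely
    along the net. *)
Lemma lev_concentration (V : set (right_uniform Aut * right_uniform Aut)) (al e : R) :
  entourage V -> 0 < al -> 0 < e -> exists n1, forall n, (n1 <= n)%N ->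
  forall A : set Aut, (al%:E <= lev_haar n A)%E ->
    ((1 - e)%:E <= lev_haar n (entourage_nbhd V A))%E.
Proof.
move=> [W nW WV] al0 e0.
have [Es [dl [dl0 mEs EW]]] := weak_nbhs_set_nbhd nW.
(* The 36 hidden in [(dl / 6) ^+ 2] is the 9 of the concentration inequality times the 4 produced by
   [t] exceeding [dl / (2 * w n)]. *)
pose c := e * al * (dl / 6) ^+ 2.
have c0 : 0 < c by rewrite mulr_gt0 ?exprn_gt0 ?mulr_gt0// divr_gt0.
have [n1 n1P] := Nw_small c0; exists n1 => n /n1P Nw A.
have F0 := fact_gt0R n; rewrite !lev_haarE !lee_fin ler_pdivlMr// => alA.
pose A' : {set 'S_(N n)} := [set s | lev s \in A]%SET.
pose B' : {set 'S_(N n)} := [set s | lev s \notin entourage_nbhd V A]%SET.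
(* A distance less than [t] is at most [dl / (2 * w n)] and moves measure at most [dl / 2], which is
   strictly less than [dl]; on the other hand [t] itself exceeds [dl / (2 * w n)], as the bound on
   [B'] requires. *)
pose t := (Num.truncn (dl / (2 * w n))).+1.
have tlt : dl / (2 * w n) < t%:R by exact: truncnS_gt.
have w2 : 0 < 2 * w n by rewrite mulr_gt0.
have AB a b : a \in A' -> b \in B' -> (t <= ham a b)%N.
  rewrite !finset.in_set => /set_mem Aa /negP nb; rewrite ltnNge; apply/negP => hab.
  apply: nb; apply/mem_set; exists (lev a) => //; apply: WV => /=.
  apply: EW => E /mEs[mE _]; apply: lev_near1 => //.
  have : (ham b a)%:R <= dl / (2 * w n).
    rewrite ham_sym; apply: le_trans (_ : (Num.truncn (dl / (2 * w n)))%:R <= _).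
      by rewrite ler_nat.
    by rewrite truncn_le divr_ge0// ltW.
  rewrite ler_pdivlMr//; have := dl0; lra.
have hc : (#|A'|%:R * #|B'|%:R * t%:R ^+ 2 <= 9 * (N n)%:R * (N n)`!%:R ^+ 2 :> R).
  by rewrite -!natrX -!natrM ler_nat; exact: ham_concentration.
have cntB : (#|B'| + cnt n (entourage_nbhd V A) = (N n)`!)%N.
  rewrite -card_Sn -(cardsC B'); congr (_ + _)%N; apply: eq_card => s.
  by rewrite finset.in_setC !finset.in_set negbK.
have {}cntB : #|B'|%:R + (cnt n (entourage_nbhd V A))%:R = (N n)`!%:R :> R.
  by rewrite -natrD cntB.
rewrite ler_pdivlMr// mulrBl mul1r lerBlDr addrC -lerBlDr.
rewrite (_ : _ - _ = #|B'|%:R); last by rewrite -cntB addrK.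
have {}alA : al * (N n)`!%:R <= #|A'|%:R by exact: alA.
move: (#|A'|%:R : R) (#|B'|%:R : R) (ler0n R #|B'|) hc alA {cntB} Nw; rewrite /c.
move: (N n)`!%:R F0 => F F0; move: ((N n)%:R : R) => k a b b0 hc alA Nw.
have x0 : 0 < dl / (2 * w n) by rewrite divr_gt0.
have h1 : al * F * b * (dl / (2 * w n)) ^+ 2 <= 9 * k * F ^+ 2.
  apply: le_trans hc; apply: ler_pM.
  - by rewrite !mulr_ge0// ltW.
  - by rewrite exprn_ge0// ltW.
  - by rewrite ler_wpM2r.
  - by rewrite ler_sqr ?nnegrE ?(ltW x0)// ltW.
have h2 : al * b * dl ^+ 2 <= 36 * (k * w n ^+ 2) * F.
  rewrite -(ler_pM2r F0).
  have -> : al * b * dl ^+ 2 * F = al * F * b * (dl / (2 * w n)) ^+ 2 * (2 * w n) ^+ 2.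
    by field; rewrite gt_eqF.
  apply: le_trans (ler_wpM2r (sqr_ge0 _) h1) _.
  by rewrite le_eqVlt; apply/orP; left; apply/eqP; ring.
have h3 : al * b * dl ^+ 2 <= e * al * dl ^+ 2 * F.
  apply: (le_trans h2); rewrite ler_pM2r//.
  move: (ltW Nw); set q := k * _; rewrite exprMn => h.
  by lra.
have ad0 : 0 < al * dl ^+ 2 by rewrite mulr_gt0// exprn_gt0.
rewrite -(ler_pM2l ad0); move: h3; rewrite mulrAC.
by rewrite (_ : e * al * dl ^+ 2 * F = al * dl ^+ 2 * (e * F)) //; ring.
Qed.

Lemma levels_levy_group : levy_group R Aut.
Proof.
(* A subgroup may occur at several levels; [idx] selects one, and [lev_haar_eq] shows that the
   choice does not affect the measure. *)
pose idx (L : set Aut) : nat := xget 0%N [set n | K n = L].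
have idxP n : K (idx (K n)) = K n.
  by rewrite /idx; case: xgetP => [k _ //|/(_ n)[]].
exists (range K), (fun L => lev_haar (idx L)); split.
- by move=> _ [n _ <-]; split; [exact: K_subgroup|exact/finite_compact/K_finite].
- split; first by exists (K 0%N); exists 0%N.
  move=> _ _ [m _ <-] [n _ <-]; exists (K (maxn m n)); split; first by exists (maxn m n).
    exact/K_mono/leq_maxl.
  exact/K_mono/leq_maxr.
- exact: K_dense.
- by move=> _ [n _ <-]; rewrite -{1}(idxP n); exact: lev_haarP.
- move=> A V mA eV mVA.
  rewrite /liminf_along => /ereal_sup_gt[_ [T [L0 [n0 _ <-] L0T] <-] inf_gt0].
  have [al al0 alle] : exists2 al : R, 0 < al & forall L, T L ->
      (al%:E <= lev_haar (idx L) (A L))%E.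
    have hle L : T L -> (ereal_inf [set lev_haar (idx i) (A i) | i in T] <=
        lev_haar (idx L) (A L))%E.
      by move=> TL; apply: ereal_inf_lbound; exists L.
    move: inf_gt0 hle; case: (ereal_inf _) => [x| |]//.
      by rewrite lte_fin => x0 hle; exists x.
    by move=> _ hle; exists 1 => // L /hle; apply: le_trans; rewrite leey.
  have near_le (e : R) : 0 < e -> \forall L \near net_tails (range K)
      (fun L L' => L `<=` L'), ((1 - e)%:E <= lev_haar (idx L) (entourage_nbhd V (A L)))%E.
    move=> e0; have [n1 n1P] := lev_concentration eV al0 e0.
    exists (K (maxn n0 n1)); first by exists (maxn n0 n1).
    move=> _ [[n _ <-] KKn].
    have TKn : T (K n).
      apply: L0T; split; first by exists n.
      exact: subset_trans (K_mono (leq_maxl _ _)) KKn.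
    (* If [n] lies below [n1], then [K n] is squeezed between itself and [K (maxn n0 n1)], hence
       equals that later group, to which the estimate applies. *)
    have [k [n1k Kk]] : exists k, (n1 <= k)%N /\ K k = K n.
      have [n1n|nn1] := leqP n1 n; first by exists n.
      exists (maxn n0 n1); split; first exact: leq_maxr.
      by apply/seteqP; split=> //; apply: K_mono; rewrite leq_max (ltnW nn1) orbT.
    have haark B : lev_haar (idx (K n)) B = lev_haar k B.
      by apply: lev_haar_eq; rewrite idxP.
    by rewrite haark; apply: n1P => //; rewrite -haark; exact: alle.
  have FF : Filter (net_tails (range K) (fun L L' => L `<=` L')).
    apply: filter_from_filter; first by exists (K 0%N); exists 0%N.
    move=> _ _ [m _ <-] [n _ <-]; exists (K (maxn m n)); first by exists (maxn m n).
    move=> L [KL mnL]; split; split => //; apply: subset_trans mnL; apply: K_mono.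
      exact: leq_maxl.
    exact: leq_maxr.
  have le1 L : (lev_haar (idx L) (entourage_nbhd V (A L)) <= 1)%E.
    exact: probability_le1.
  have fin L : lev_haar (idx L) (entourage_nbhd V (A L)) \is a fin_num.
    exact: fin_num_measure.
  apply/fine_cvgP; split; first exact: nearW.
  apply/cvgrPdist_le => e e0; apply: filterS (near_le e e0) => L h2.
  pose z : \bar R := lev_haar (idx L) (entourage_nbhd V (A L)).
  have zfin : z \is a fin_num := fin L.
  have {h2}h2 : ((1 - e)%:E <= z)%E by [].
  have h1 : (z <= 1)%E := le1 L.
  change (`|1 - fine z| <= e); move: z zfin h1 h2 => [x| |]// _; rewrite !lee_fin/=.
  by move=> h1 h2; rewrite ger0_norm ?subr_ge0//; lra.
Qed.

End Levels.

(** * Interval exchanges *)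

Section IntervalExchange.
Variable R : realType.

Lemma lebesgue_measure_shift (t : R) (A : set R) : measurable A ->
  lebesgue_measure ((fun u => u + t) @^-1` A) = lebesgue_measure A.
Proof.
have mt : measurable_fun setT ((fun u => u + t) : measurableTypeR R -> measurableTypeR R).
  by apply: measurable_funD.
pose m : {measure set (measurableTypeR R) -> \bar R} :=
  measure_function_pushforward__canonical__measure_function_Measure lebesgue_measure mt.
move=> mA; apply/esym; apply: etrans (_ : m A = _); last by [].
apply: lebesgue_measure_unique mA => _ [[u v] _ <-].
apply/esym; apply: etrans (_ : lebesgue_measure (`]u - t, v - t]%classic : set R) = _).
  change (lebesgue_measure ((fun x : R => x + t) @^-1` `]u, v]%classic) =
    lebesgue_measure (`]u - t, v - t]%classic : set R)); congr (lebesgue_measure _).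
  by apply/seteqP; split=> x /=; rewrite !in_itv/= ltrBlDr lerBrDr.
by rewrite !lebesgue_measure_itv/= !lte_fin ltrD2r; case: ifP => // _; rewrite -!EFinB; congr EFin; ring.
Qed.

(** Extension by the identity to all integers, so that an exchange is defined on the whole line
    without a proof that the cell index is below [N]. *)
Definition ext N (s : 'S_N) (i : nat) : nat :=
  if insub i is Some j then s j : nat else i.

Lemma ext_ord N (s : 'S_N) (i : 'I_N) : ext s i = s i.
Proof. by rewrite /ext valK. Qed.

Lemma ext_out N (s : 'S_N) (i : nat) : (N <= i)%N -> ext s i = i.
Proof. by move=> Ni; rewrite /ext insubF// ltnNge Ni. Qed.

Lemma ext_lt N (s : 'S_N) (i : nat) : (ext s i < N)%N = (i < N)%N.
Proof.
have [iN|Ni] := ltnP i N; last by rewrite ext_out// ltnNge Ni.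
by rewrite (ext_ord s (Ordinal iN)) ltn_ord.
Qed.

Lemma ext1 N (i : nat) : ext (1%g : 'S_N) i = i.
Proof. by rewrite /ext; case: insubP => // j _ <-; rewrite perm1. Qed.

Lemma extM N (s t : 'S_N) (i : nat) : ext (s * t)%g i = ext t (ext s i).
Proof.
have [iN|Ni] := ltnP i N; last by rewrite !ext_out.
by rewrite -[i]/(Ordinal iN : nat) !ext_ord permM.
Qed.

Definition cell_idx (w u : R) : nat := Num.truncn (u / w).

Lemma cell_idxP (w u : R) (i : nat) : 0 < w -> 0 <= u ->
  (cell_idx w u = i) <-> i%:R * w <= u < (i%:R + 1) * w.
Proof.
move=> w0 u0; have uw : 0 <= u / w by rewrite divr_ge0// ltW.
split=> [<-|/andP[h1 h2]].
  by rewrite -ler_pdivlMr// -ltr_pdivrMr// natr1 truncn_itv.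
by apply: truncn_def; rewrite -natr1 ler_pdivlMr// ltr_pdivrMr// h1.
Qed.

Lemma cell_idx_div (w u : R) (q : nat) : 0 < w -> 0 <= u -> (0 < q)%N ->
  cell_idx (q%:R * w) u = (cell_idx w u %/ q)%N.
Proof.
move=> w0 u0 q0; have qw : 0 < q%:R * w by rewrite mulr_gt0// ltr0n.
apply/(cell_idxP _ qw u0).
have /(cell_idxP _ w0 u0)/andP[h1 h2] : cell_idx w u = cell_idx w u by [].
set i := cell_idx w u in h1 h2 *.
rewrite !mulrA; apply/andP; split.
  apply: le_trans h1; rewrite ler_pM2r// -natrM ler_nat; exact: leq_divM.
apply: lt_le_trans h2 _; rewrite ler_pM2r// !natr1 -natrM ler_nat.
exact: ltn_ceil.
Qed.

(** Negative points are set apart because truncation sends them to 0, which would place them in the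
    cell 0. *)
Definition xchg (w : R) N (s : 'S_N) (u : R) : R :=
  if 0 <= u then u + ((ext s (cell_idx w u))%:R - (cell_idx w u)%:R) * w else u.

Variable w : R.
Hypothesis w0 : 0 < w.

Lemma xchg_ge0 N (s : 'S_N) u : 0 <= u -> 0 <= xchg w s u.
Proof.
move=> u0; rewrite /xchg u0.
have /(cell_idxP _ w0 u0)/andP[h1 _] : cell_idx w u = cell_idx w u by [].
rewrite mulrBl addrCA addr_ge0 ?subr_ge0// mulr_ge0// ltW//.
Qed.

Lemma cell_idx_xchg N (s : 'S_N) u : 0 <= u ->
  cell_idx w (xchg w s u) = ext s (cell_idx w u).
Proof.
move=> u0; apply/(cell_idxP _ w0 (xchg_ge0 s u0)); rewrite /xchg u0.
have /(cell_idxP _ w0 u0) : cell_idx w u = cell_idx w u by [].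
by rewrite !mulrDl !mulNr mul1r => /andP[h1 h2]; apply/andP; split; lra.
Qed.

Lemma xchgM N (s t : 'S_N) u : xchg w (s * t)%g u = xchg w t (xchg w s u).
Proof.
have [u0|u0] := boolP (0 <= u); last by rewrite /xchg !(negbTE u0).
rewrite {2}/xchg xchg_ge0// cell_idx_xchg// /xchg u0 extM; ring.
Qed.

Lemma xchg_id N (s : 'S_N) u : ext s (cell_idx w u) = cell_idx w u -> xchg w s u = u.
Proof. by rewrite /xchg => ->; rewrite subrr mul0r addr0 if_same. Qed.

Lemma xchg1 N u : xchg w (1 : 'S_N)%g u = u.
Proof. by rewrite xchg_id// ext1. Qed.

Lemma measurable_cell_idx : measurable_fun setT (cell_idx w).
Proof.
by apply: (@measurableT_comp _ _ _ _ _ _ (@Num.truncn R));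
  [exact: measurable_truncn|exact: measurable_funM].
Qed.

Lemma measurable_xchg N (s : 'S_N) : measurable_fun setT (xchg w s).
Proof.
apply: measurable_fun_ifT => //.
  by apply: measurable_fun_ler.
apply: measurable_funD => //; apply: measurable_funM => //.
have mnat : measurable_fun setT (fun n : nat => n%:R : R) by [].
have mext : measurable_fun setT (ext s) by [].
apply: measurable_funB; first exact: (measurableT_comp mnat (measurableT_comp mext measurable_cell_idx)).
exact: (measurableT_comp mnat measurable_cell_idx).
Qed.

Definition half_line_cell (i : nat) : set R := [set u | 0 <= u /\ cell_idx w u = i].

Lemma half_line_cellE i : half_line_cell i = `[i%:R * w, (i%:R + 1) * w[%classic.
Proof.
apply/seteqP; split=> u /=; rewrite in_itv/=.
  by move=> [u0 /cell_idxP->].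
move=> h; have u0 : 0 <= u.
  by case/andP: h => h _; apply: le_trans h; rewrite mulr_ge0// ltW.
by split=> //; apply/cell_idxP.
Qed.

Lemma measurable_half_line_cell i : measurable (half_line_cell i).
Proof. by rewrite half_line_cellE; exact: measurable_itv. Qed.

Lemma lebesgue_half_line_cell i : lebesgue_measure (half_line_cell i) = w%:E.
Proof.
rewrite half_line_cellE lebesgue_measure_itv/= lte_fin ltr_pM2r// ltrDl ltr01.
by rewrite -EFinB; congr EFin; ring.
Qed.

(** On the cell [i] the exchange is a translation onto the cell [s i], and it fixes the rest of [J];
    the sum over cells is therefore reindexed by [s]. *)
Lemma lebesgue_xchg_preimage N (s : 'S_N) (J A : set R) :
  measurable J -> measurable A -> J `<=` [set u | 0 <= u] ->
  (forall i : 'I_N, half_line_cell i `<=` J) ->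
  lebesgue_measure (xchg w s @^-1` A `&` J) = lebesgue_measure (A `&` J).
Proof.
move=> mJ mA J0 cJ.
have split_cells B : measurable B -> lebesgue_measure (B `&` J) =
    (\sum_(i < N) lebesgue_measure (B `&` half_line_cell i) +
     lebesgue_measure (B `&` (J `\` [set u | (cell_idx w u < N)%N])))%E.
  move=> mB; rewrite -measure_bigsetU_ord//; last 2 first.
  - by move=> i; apply: measurableI => //; exact: measurable_half_line_cell.
  - move=> i j _ _ [u [[_ [_ /= ui]] [_ [_ uj]]]].
    by apply/val_inj; rewrite /= -ui -uj.
  have mN : measurable [set u | (cell_idx w u < N)%N].
    rewrite (_ : [set u | _] = cell_idx w @^-1` [set i | (i < N)%N])//.
    by rewrite -[X in measurable X]setTI; exact: measurable_cell_idx.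
  have mU : measurable (\big[setU/set0]_(i < N) (B `&` half_line_cell i)).
    apply: bigsetU_measurable => i _; apply: measurableI => //.
    exact: measurable_half_line_cell.
  rewrite -measureU//; last 2 first.
  - by apply: measurableI => //; exact: measurableD.
  - rewrite bigsetU_ordP; apply/seteqP; split=> // u [[i _ [_ [_ ui]]] [_ [_]]].
    by apply; rewrite /= ui.
  congr lebesgue_measure; rewrite bigsetU_ordP; apply/seteqP; split=> u.
    move=> [Bu Ju]; have [uN|uN] := ltnP (cell_idx w u) N.
      by left; exists (Ordinal uN) => //; split=> //; split=> //; exact: J0.
    by right; split=> //; split=> //=; rewrite ltnNge uN.
  by move=> [[i _ [Bu /cJ]]|[Bu []]].
have mxA : measurable (xchg w s @^-1` A).
  by rewrite -[X in measurable X]setTI; exact: measurable_xchg.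
rewrite !split_cells//; congr (_ + lebesgue_measure _)%E; last first.
  apply/seteqP; split=> u [/= Au [Ju /negP]]; rewrite -leqNgt => uN; split=> //=.
  - by move: Au; rewrite xchg_id// ext_out.
  - by split=> //; apply/negP; rewrite -leqNgt.
  - by rewrite xchg_id// ext_out.
  - by split=> //; apply/negP; rewrite -leqNgt.
rewrite [RHS](reindex_inj (@perm_inj _ s)); apply: eq_bigr => i _.
rewrite -[RHS](@lebesgue_measure_shift (((s i : nat)%:R - (i : nat)%:R) * w)); last first.
  by apply: measurableI => //; exact: measurable_half_line_cell.
congr lebesgue_measure; apply/seteqP; split=> u /=.
  move=> [Au [u0 ui]]; have := cell_idx_xchg s u0; have := xchg_ge0 s u0.
  by move: Au; rewrite /xchg u0 ui ext_ord => Au v0 vi; split.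
move=> [Au]; rewrite half_line_cellE/= in_itv/= => /andP[h1 h2].
have : half_line_cell i u.
  by rewrite half_line_cellE/= in_itv/=; apply/andP; split; move: h1 h2; rewrite !mulrDl mulNr mul1r; lra.
by move=> [u0 ui]; split; last split=> //; rewrite /xchg u0 ui ext_ord.
Qed.

End IntervalExchange.

(** * Transport of interval exchanges to the measure space *)

Section LevelConstruction.
Variables (R : realType) (d : measure_display) (X : measurableType d).
Variables (mu : {measure set X -> \bar R}) (a : X -> R) (b : R -> X) (e : X -> R).
Hypotheses (ma : measurable_fun setT a) (mb : measurable_fun setT b).
Hypotheses (me : measurable_fun setT e) (e_inj : injective e).
Hypothesis mu_a : forall A, measurable A ->
  mu (a @^-1` A) = lebesgue_measure (A `&` range_itv mu).
Hypothesis baK : {ae mu, forall x, b (a x) = x}.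
(* At level [n] the part [[0, c * L n[] of the model is cut into cells of width
   [c / 4 ^ n]; as [L n <= 2 ^ n], the product of the number of cells by the square
   of their width tends to 0. *)
Variables (c : R) (L : nat -> nat).
Hypothesis c_gt0 : 0 < c.
Hypothesis L_mono : {homo L : m n / (m <= n)%N}.
Hypothesis L_le : forall n, (L n <= 2 ^ n)%N.
Hypothesis range_itvE : forall u,
  range_itv mu u <-> 0 <= u /\ exists n, u < c * (L n)%:R.

Let J := range_itv mu.
Let mJ : measurable J. Proof. exact: measurable_range_itv. Qed.

Definition level_size (n : nat) : nat := (4 ^ n * L n)%N.
Definition level_width (n : nat) : R := c / 4 ^+ n.
Let N := level_size.
Let w := level_width.

Let w_gt0 n : 0 < w n.
Proof. by rewrite divr_gt0// exprn_gt0. Qed.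

Let Nw n : (N n)%:R * w n = c * (L n)%:R.
Proof.
rewrite /N /w /level_size /level_width natrM natrX.
have : 4 ^+ n != 0 :> R by rewrite expf_neq0.
by move: (4 ^+ n) => x x0; field.
Qed.

Let w_div m n : (m <= n)%N -> w m = (4 ^ (n - m))%:R * w n.
Proof.
move=> mn; rewrite /w /level_width -{2}(subnK mn) exprD natrX.
have : 4 ^+ (n - m) != 0 :> R by rewrite expf_neq0.
have : 4 ^+ m != 0 :> R by rewrite expf_neq0.
by move: (_ ^+ m) (_ ^+ (n - m)) => x y x0 y0; field; rewrite x0 y0.
Qed.

Let N_div m n i : (m <= n)%N -> (i %/ 4 ^ (n - m) < N m)%N -> (i < N n)%N.
Proof.
move=> mn; rewrite ltn_divLR ?expn_gt0// => /leq_trans; apply.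
rewrite /N /level_size mulnAC -expnD subnKC// leq_mul2l L_mono// orbT//.
Qed.

Let cell_idx_refine m n u : (m <= n)%N -> 0 <= u ->
  cell_idx (w m) u = (cell_idx (w n) u %/ 4 ^ (n - m))%N.
Proof. by move=> mn u0; rewrite (w_div mn) cell_idx_div// expn_gt0. Qed.

Let J_ge0 u : J u -> 0 <= u. Proof. by move=> /range_itvE[]. Qed.

Let cell_J n i : (i < N n)%N -> half_line_cell (w n) i `<=` J.
Proof.
move=> iN u [u0 ui]; apply/range_itvE; split=> //; exists n; rewrite -Nw.
have /(cell_idxP _ (w_gt0 n) u0)/andP[_ h] := ui.
by apply: lt_le_trans h _; rewrite ler_pM2r// natr1 ler_nat.
Qed.

Let mxchg n (s : 'S_(N n)) : measurable_fun setT (xchg (w n) s).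
Proof. exact: measurable_xchg. Qed.

Let xchg_J n (s : 'S_(N n)) u : J u -> J (xchg (w n) s u).
Proof.
move=> Ju; have u0 := J_ge0 Ju; have [uN|uN] := ltnP (cell_idx (w n) u) (N n).
  apply: (@cell_J n (ext s (cell_idx (w n) u))); first by rewrite ext_lt.
  by split; [exact: xchg_ge0|exact: cell_idx_xchg].
by rewrite xchg_id// ext_out.
Qed.

Let xchg_refine n (s : 'S_(N n)) : exists t : 'S_(N n.+1),
  xchg (w n.+1) t =1 xchg (w n) s.
Proof.
(* Each cell splits into four, which follow it in their order: the quotient by 4 is permuted and the
   remainder kept. Small cells beyond the old range stay fixed. *)
pose f (i : 'I_(N n.+1)) : nat := (4 * ext s (i %/ 4) + i %% 4)%N.
have fN i : (f i < N n.+1)%N.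
  have [h|h] := ltnP (i %/ 4) (N n).
    apply: (@N_div n n.+1) => //; rewrite subSnn expn1 /f mulnC divnMDl//.
    by rewrite (divn_small (ltn_pmod _ _))// addn0 ext_lt.
  by rewrite /f ext_out// mulnC -divn_eq ltn_ord.
pose g i := Ordinal (fN i).
have g_inj : injective g.
  move=> i j /(congr1 val)/=; rewrite /f => ij; apply/val_inj => /=.
  have mij : (i %% 4 = j %% 4)%N by lia.
  have : ext s (i %/ 4) = ext s (j %/ 4) by lia.
  move=> /(congr1 (ext s^-1%g)); rewrite -!extM mulgV !ext1 => dij.
  by rewrite (divn_eq i 4) (divn_eq j 4) dij mij.
exists (perm g_inj) => u; rewrite /xchg; case: ifPn => // u0.
have := @cell_idx_refine n n.+1 u (leqnSn n) u0; rewrite subSnn expn1.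
set i := cell_idx (w n.+1) u => ->; rewrite (w_div (leqnSn n)) subSnn expn1 mulrA.
congr (_ + _).
have -> : ext (perm g_inj) i = (4 * ext s (i %/ 4) + i %% 4)%N.
  have [iN|iN] := ltnP i (N n.+1).
    by rewrite -[i]/(Ordinal iN : nat) ext_ord permE.
  rewrite ext_out// ext_out; first by rewrite mulnC -divn_eq.
  by rewrite leqNgt; apply/negP => h; move: iN; rewrite leqNgt (@N_div n n.+1)// subSnn expn1.
rewrite [in (i%:R : R)](divn_eq i 4) !natrD !natrM /w /level_width; ring.
Qed.

Let xchg_lift m n (s : 'S_(N m)) : (m <= n)%N -> exists t : 'S_(N n),
  xchg (w n) t =1 xchg (w m) s.
Proof.
move=> /subnK <-; elim: (n - m)%N => [|k [t tE]]; first by exists s.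
have [t' t'E] := xchg_refine t; exists t' => u.
by rewrite -tE -t'E.
Qed.

Let lebesgue_xchg n (s : 'S_(N n)) A : measurable A ->
  lebesgue_measure (xchg (w n) s @^-1` A `&` J) = lebesgue_measure (A `&` J).
Proof.
move=> mA; apply: lebesgue_xchg_preimage => // i; exact: cell_J.
Qed.

Let bad : set R := [set v | a (b v) <> v].

Let measurable_good : measurable [set v | a (b v) = v].
Proof.
have mab : measurable_fun setT (fun v => a (b v) - v).
  by apply: measurable_funB => //; exact: (measurableT_comp ma mb).
rewrite (_ : [set _ | _] = (fun v => a (b v) - v) @^-1` [set 0]).
  by rewrite -[X in measurable X]setTI; exact: mab.
by apply/seteqP; split=> v /= => [->|/eqP]; rewrite ?subrr// subr_eq0 => /eqP.
Qed.

Let measurable_bad : measurable bad.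
Proof. by rewrite (_ : bad = ~` [set v | a (b v) = v])//; exact: measurableC. Qed.

Let mpre A : measurable A -> measurable (a @^-1` A).
Proof. by move=> mA; rewrite -[X in measurable X]setTI; exact: ma. Qed.

Let lebesgue_bad : lebesgue_measure (bad `&` J) = 0%E.
Proof.
rewrite -mu_a//; apply/negligibleP; first exact: mpre.
by apply: negligibleS baK => x /= h hx; apply: h; rewrite hx.
Qed.

(* The points all of whose images under the countably many interval exchanges are
   fixed by [a \o b]: conjugating by [a] and [b] is an action on [coreX]. *)
Definition core : set R := J `&`
  [set u | forall n (s : 'S_(N n)), a (b (xchg (w n) s u)) = xchg (w n) s u].

Let core_idx (k : nat) : set R :=
  if unpickle k is Some (existT n s) then xchg (w n) (s : 'S_(N n)) @^-1` bad else set0.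

Let measurable_core_idx k : measurable (core_idx k).
Proof.
rewrite /core_idx; case: unpickle => // -[n s].
by rewrite -[X in measurable X]setTI; exact: mxchg.
Qed.

Let coreE : core = J `\` \bigcup_k core_idx k.
Proof.
apply/seteqP; split=> u.
  move=> [Ju h]; split=> // -[k _]; rewrite /core_idx; case: unpickle => // -[n s] /=.
  by apply; exact: h.
move=> [Ju h]; split=> // n s; apply: contrapT => hn; apply: h.
have [k kq] : exists k, unpickle k = Some (existT (fun n => 'S_(N n)) n s).
  by exists (pickle (existT (fun n => 'S_(N n)) n s)); exact: pickleK.
by exists k => //; rewrite /core_idx kq.
Qed.

Let measurable_core : measurable core.
Proof. by rewrite coreE; apply: measurableD => //; exact: bigcup_measurable. Qed.

Let core_xchg n (s : 'S_(N n)) u : core u -> core (xchg (w n) s u).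
Proof.
move=> [Ju h]; split; first exact: xchg_J.
(* Lifted to a common level, the two exchanges compose to a single exchange of that level, for which
   the condition defining [core] is known. *)
move=> m t; have [s' s'E] := xchg_lift s (leq_maxl n m).
have [t' t'E] := xchg_lift t (leq_maxr n m).
by rewrite -s'E -t'E -xchgM//; exact: h.
Qed.

Definition coreX : set X := [set x | b (a x) = x] `&` a @^-1` core.

Let measurable_coreX : measurable coreX.
Proof.
apply: measurableI; last exact: mpre.
(* The equation [b (a x) = x] in [X] is tested through the injective real function [e], which makes
   its solution set measurable. *)
have mab : measurable_fun setT (fun x => e (b (a x)) - e x).
  by apply: measurable_funB => //; exact: (measurableT_comp me (measurableT_comp mb ma)).
rewrite (_ : [set _ | _] = (fun x => e (b (a x)) - e x) @^-1` [set 0]).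
  by rewrite -[X in measurable X]setTI; exact: mab.
apply/seteqP; split=> v /= => [->|/eqP]; rewrite ?subrr// subr_eq0 => /eqP.
exact: e_inj.
Qed.

Let coreX_ae : {ae mu, forall x, coreX x}.
Proof.
have : mu.-negligible (a @^-1` (~` core)).
  apply/negligibleP; first by apply: mpre; exact: measurableC.
  apply: etrans (mu_a (measurableC measurable_core)) _.
  have mIJ k : measurable (core_idx k `&` J).
    exact: (measurableI _ _ (measurable_core_idx k) mJ).
  have -> : ~` core `&` J = \bigcup_k (core_idx k `&` J).
    rewrite coreE; apply/seteqP; split=> u.
      move=> [nc Ju]; have [k _ ck] : (\bigcup_k core_idx k) u.
        by apply: contrapT => h; apply: nc; split.
      by exists k.
    by move=> [k _ [ck Ju]]; split=> // -[_]; apply; exists k.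
  apply/negligibleP; last first.
    apply: negligible_bigcup => k; apply/negligibleP; first exact: mIJ.
    rewrite /core_idx; case: unpickle => [[n s]|]; last by rewrite set0I measure0.
    exact: etrans (lebesgue_xchg s measurable_bad) lebesgue_bad.
  by apply: bigcup_measurable => k _; exact: mIJ.
by apply: filterS2 baK => x h1 h2; split.
Qed.

(** The identity off [coreX] keeps the map a bijection of the whole of [X], and the group law holds
    at every point. *)
Let swap n (s : 'S_(N n)) (x : X) : X :=
  if x \in coreX then b (xchg (w n) s (a x)) else x.

Let swap_core n (s : 'S_(N n)) x : coreX x ->
  [/\ coreX (swap s x), swap s x = b (xchg (w n) s (a x)) &
      a (swap s x) = xchg (w n) s (a x)].
Proof.
move=> xX; have [bax ax] := xX; have swE : swap s x = b (xchg (w n) s (a x)).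
  by rewrite /swap mem_set.
have aE : a (swap s x) = xchg (w n) s (a x) by rewrite swE; have [_] := ax; apply.
by split=> //; split; rewrite /= aE//; exact: core_xchg.
Qed.

Let swap_out n (s : 'S_(N n)) x : ~ coreX x -> swap s x = x.
Proof. by move=> nx; rewrite /swap memNset. Qed.

Let swapM n (s t : 'S_(N n)) x : swap (s * t)%g x = swap t (swap s x).
Proof.
have [xX|nx] := pselect (coreX x); last by rewrite !swap_out.
have [_ -> _] := swap_core (s * t)%g xX; have [sX _ sE] := swap_core s xX.
by have [_ -> _] := swap_core t sX; rewrite sE xchgM.
Qed.

Let swap1 n x : swap (1%g : 'S_(N n)) x = x.
Proof.
have [xX|nx] := pselect (coreX x); last by rewrite swap_out.
by have [_ -> _] := swap_core (1%g : 'S_(N n)) xX; rewrite xchg1//; case: xX.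
Qed.

Let swapK n (s : 'S_(N n)) : cancel (swap s) (swap s^-1%g).
Proof. by move=> x; rewrite -swapM mulgV swap1. Qed.

Let swapVK n (s : 'S_(N n)) : cancel (swap s^-1%g) (swap s).
Proof. by move=> x; rewrite -swapM mulVg swap1. Qed.

Let measurable_swap n (s : 'S_(N n)) : measurable_fun setT (swap s).
Proof.
apply: measurable_fun_ifT.
- apply: (measurable_fun_bool true); rewrite setTI (_ : _ @^-1` _ = coreX)//.
  by apply/seteqP; split=> x /=; [exact: set_mem|exact: mem_set].
- exact: (measurableT_comp mb (measurableT_comp (mxchg s) ma)).
- exact: measurable_id.
Qed.

Let mu_core A B : measurable A -> measurable B ->
  (forall x, coreX x -> A x <-> B x) -> mu A = mu B.
Proof. by move=> mA mB AB; apply: ae_eq_measure => //; apply: filterS coreX_ae. Qed.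

Let swap_preserving n (s : 'S_(N n)) A : measurable A -> mu (swap s @^-1` A) = mu A.
Proof.
move=> mA; have mbA : measurable (b @^-1` A).
  by rewrite -[X in measurable X]setTI; exact: mb.
have mxbA : measurable (xchg (w n) s @^-1` (b @^-1` A)).
  by rewrite -[X in measurable X]setTI; exact: mxchg.
transitivity (mu (a @^-1` (xchg (w n) s @^-1` (b @^-1` A)))).
  apply: mu_core; [|exact: mpre|].
    by rewrite -[X in measurable X]setTI; exact: measurable_swap.
  by move=> x xX; have [_ swE _] := swap_core s xX; rewrite /= swE.
rewrite mu_a// lebesgue_xchg// -mu_a//.
by apply: mu_core => //; [exact: mpre|move=> x [/= ->]].
Qed.

Let level_transf n (s : 'S_(N n)) : mp_transf mu :=
  @MPTransf _ _ _ mu (swap s) (swap s^-1%g) (swapK s) (swapVK s)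
    (measurable_swap s) (measurable_swap s^-1%g) (@swap_preserving n s).

(** Restriction to [coreX] makes [swap] carry cells onto cells exactly; it costs only a null set. *)
Let level_cell n (i : 'I_(N n)) : set X := coreX `&` [set x | cell_idx (w n) (a x) = i].

Let coreX_ge0 x : coreX x -> 0 <= a x.
Proof. by move=> [_ [/J_ge0]]. Qed.

Let mcell n i : measurable [set x | cell_idx (w n) (a x) = i].
Proof.
rewrite (_ : [set _ | _] = a @^-1` (cell_idx (w n) @^-1` [set i]))//; apply: mpre.
by rewrite -[X in measurable X]setTI; exact: measurable_cell_idx.
Qed.

Let measurable_level_cell n i : measurable (@level_cell n i).
Proof. exact: measurableI. Qed.

Let mu_level_cell n i : mu (@level_cell n i) = (w n)%:E.
Proof.
rewrite -(lebesgue_half_line_cell (w_gt0 n) i) -[in RHS](setIidl (cell_J (ltn_ord i))).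
have mh : measurable (half_line_cell (w n) i) by exact: measurable_half_line_cell.
rewrite -mu_a//; apply: mu_core => //; first exact: mpre.
move=> x xX; split=> [[_ xi]|[_ xi]]; first by split=> //; exact: coreX_ge0.
by split.
Qed.

Let level_cell_S n (s : 'S_(N n)) i x : level_cell i x ->
  level_cell (s i) (mp_fun (level_transf s) x).
Proof.
move=> [xX xi]; have [sX _ sE] := swap_core s xX; split=> //=.
by rewrite sE cell_idx_xchg ?coreX_ge0// xi ext_ord.
Qed.

Let level_fix n (s : 'S_(N n)) x : (forall i, level_cell i x -> s i = i) ->
  mp_fun (level_transf s) x = x.
Proof.
move=> h /=; have [xX|nx] := pselect (coreX x); last exact: swap_out.
have [_ -> _] := swap_core s xX; rewrite xchg_id; first by case: xX.
have [iN|iN] := ltnP (cell_idx (w n) (a x)) (N n); last exact: ext_out.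
by rewrite -[cell_idx _ _]/(Ordinal iN : nat) ext_ord h.
Qed.

Let level_cell_refine m n i : (m <= n)%N -> exists B : {set 'I_(N n)},
  @level_cell m i = [set x | exists2 j, j \in B & level_cell j x].
Proof.
move=> mn; exists [set j : 'I_(N n) | (j %/ 4 ^ (n - m))%N == i]%SET.
apply/seteqP; split=> x.
  move=> [xX xi]; have := cell_idx_refine mn (coreX_ge0 xX); rewrite xi => iE.
  have jN : (cell_idx (w n) (a x) < N n)%N by apply: (N_div mn); rewrite -iE.
  by exists (Ordinal jN); rewrite ?finset.in_set//= -iE.
move=> [j]; rewrite finset.in_set => /eqP ji [xX xj]; split=> //=.
by rewrite (cell_idx_refine mn (coreX_ge0 xX)) xj.
Qed.

Let w_small r : 0 < r -> exists n0, forall n, (n0 <= n)%N -> w n < r.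
Proof.
move=> r0; exists (Num.truncn (c / r)).+1 => n hn.
rewrite /w /level_width ltr_pdivrMr ?exprn_gt0// mulrC -ltr_pdivrMr//.
apply: lt_le_trans (truncnS_gt _) _; rewrite -natrX ler_nat.
by apply: leq_trans hn _; apply/ltnW/ltn_expl.
Qed.

Let level_approx E (eps : R) : measurable E -> (mu E < +oo)%E -> 0 < eps ->
  exists n0, forall n, (n0 <= n)%N -> exists B : {set 'I_(N n)},
    (mu (E `+` [set x | exists2 j, j \in B & level_cell j x]) < eps%:E)%E.
Proof.
move=> mE Efin eps0; have eps2 : 0 < eps / 2 by rewrite divr_gt0.
have mbE : measurable (b @^-1` E).
  by rewrite -[X in measurable X]setTI; exact: mb.
pose B0 := b @^-1` E `&` J.
have mB0 : measurable B0 by exact: measurableI.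
have B0fin : (lebesgue_measure B0 < +oo)%E.
  rewrite /B0 -mu_a// (@mu_core _ E)//; first exact: mpre.
  by move=> x [/= ->].
(* Outer regularity reduces [E] to an open set [U] of the model. The cells contained in [U] increase
   with the level and exhaust it, so half of [eps] pays for [U] and half for the cells still
   missing. *)
have [U [oU B0U Usmall]] := lebesgue_regularity_outer mB0 B0fin eps2.
have mU : measurable U by exact: open_measurable.
pose W := coreX `&` a @^-1` U.
have mW : measurable W by apply: measurableI => //; exact: mpre.
pose V n : set X := [set x | exists2 j : 'I_(N n),
  j \in [set j : 'I_(N n) | `[< half_line_cell (w n) j `<=` U >]]%SET & level_cell j x].
have mV n : measurable (V n).
  rewrite /V -(bigsetU_ordP (mem [set j : 'I_(N n) | `[< half_line_cell (w n) j `<=` U >]]%SET)).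
  by apply: bigsetU_measurable.
have VP n x : V n x <-> [/\ coreX x, (cell_idx (w n) (a x) < N n)%N &
    half_line_cell (w n) (cell_idx (w n) (a x)) `<=` U].
  split.
    by move=> [j]; rewrite finset.in_set => /asboolP jU [xX ->].
  move=> [xX jN jU]; exists (Ordinal jN); first by rewrite finset.in_set; exact/asboolP.
  by split.
have VW n : V n `<=` W.
  move=> x /VP[xX jN jU]; split=> //; apply: jU; split=> //; exact: coreX_ge0.
have V_mono m n : (m <= n)%N -> V m `<=` V n.
  move=> mn x /VP[xX jN jU]; have x0 := coreX_ge0 xX.
  apply/VP; split=> //; first by apply: (N_div mn); rewrite -cell_idx_refine.
  move=> u [u0 uj]; apply: jU; split=> //.
  by rewrite !(cell_idx_refine mn)// uj.
have V_cover x : W x -> exists n, V n x.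
  move=> [xX Ux]; have x0 := coreX_ge0 xX.
  have [_ [/range_itvE[_ [n1 n1P]] _]] := xX.
  have : nbhs (a x) U by exact: open_nbhs_nbhs.
  move=> /nbhs_ballP[r /= r0 rU]; have [n2 n2P] := w_small r0.
  pose n := maxn n1 n2; exists n; apply/VP.
  have /(cell_idxP _ (w_gt0 n) x0)/andP[h1 h2] : cell_idx (w n) (a x) = cell_idx (w n) (a x) by [].
  split=> //.
    rewrite -(ltr_nat R) -(ltr_pM2r (w_gt0 n)) Nw; apply: le_lt_trans h1 _.
    apply: lt_le_trans n1P _; rewrite ler_pM2l// ler_nat; exact/L_mono/leq_maxl.
  move=> u [u0 /(cell_idxP _ (w_gt0 n) u0)/andP[h3 h4]]; apply: rU.
  rewrite /ball /= ltr_norml; have := n2P n (leq_maxr _ _).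
  by move: h2 h4; rewrite !mulrDl mul1r => ? ? ?; apply/andP; split; lra.
have Wfin : (mu W < +oo)%E.
  apply: (@le_lt_trans _ _ (mu (a @^-1` U))).
    by apply: le_measure; rewrite ?inE//; [exact: mpre|move=> x []].
  rewrite mu_a//; apply: (@le_lt_trans _ _ (lebesgue_measure ((U `\` B0) `|` B0))).
    apply: le_measure; rewrite ?inE.
    - exact: measurableI.
    - by apply: measurableU => //; exact: measurableD.
    - by move=> u [Uu _]; have [?|?] := pselect (B0 u); [right|left].
  have UB0 := @measureU2 _ _ _ lebesgue_measure _ _ (measurableD mU mB0) mB0.
  apply: le_lt_trans UB0 _.
  by apply: lte_add_pinfty => //; apply: lt_trans Usmall _; rewrite ltry.
have WV0 : mu (W `\` V n) @[n --> \oo] --> mu (\bigcap_n (W `\` V n)).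
  apply: nonincreasing_cvg_mu.
  - by apply: le_lt_trans Wfin; apply: le_measure; rewrite ?inE;
      [exact: measurableD|exact: mW|by move=> x []].
  - by move=> n; exact: measurableD.
  - by apply: bigcap_measurableType => n _; exact: measurableD.
  - by move=> m n mn; apply/subsetPset => x [Wx nV]; split=> // /(V_mono _ _ mn).
have capE : \bigcap_n (W `\` V n) = set0.
  apply/seteqP; split=> // x h; have [Wx _] := h 0%N I.
  by have [n Vn] := V_cover x Wx; have [_] := h n I.
move: WV0; rewrite capE measure0 => WV0.
have : \forall n \near \oo, (mu (W `\` V n) < (eps / 2)%:E)%E.
  by apply: (WV0 [set y | (y < (eps / 2)%:E)%E]); apply: open_ereal_lt'; rewrite lte_fin.
move=> [n0 _ n0P]; exists n0 => n n0n.
exists [set j : 'I_(N n) | `[< half_line_cell (w n) j `<=` U >]]%SET; rewrite -/(V n).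
have mUB : measurable (a @^-1` (U `\` B0)) by apply: mpre; exact: measurableD.
have mWV : measurable (W `\` V n) by exact: measurableD.
have mEV : measurable (E `+` V n) by exact: measurableY.
pose Z := a @^-1` (U `\` B0) `|` (W `\` V n).
have mZ : measurable Z by exact: measurableU.
have -> : mu (E `+` V n) = mu ((E `+` V n) `&` coreX).
  by apply: mu_core => //; [exact: measurableI|move=> x xX; split=> [?|[]]].
apply: (@le_lt_trans _ _ (mu Z)).
  apply: le_measure; rewrite ?inE//; first exact: measurableI.
  move=> x [Yx xX]; have [bax ax] := xX; have Jx : J (a x) by case: ax.
  case: Yx => [[Ex nV]|[Vx nE]].
    by right; split=> //; split=> //; apply: B0U; split=> //=; rewrite bax.
  left; split; first by have [] := VW _ _ Vx.
  by move=> [/= Eb _]; apply: nE; rewrite -bax.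
apply: le_lt_trans (measureU2 _ mUB mWV) _; rewrite [eps]splitr EFinD.
apply: lteD; last exact: n0P.
apply: le_lt_trans Usmall; rewrite [leLHS]mu_a; last exact: measurableD.
apply: le_measure; rewrite ?inE; last by move=> u [].
- by apply: measurableI => //; exact: measurableD.
- exact: measurableD.
Qed.

Let level_transfM n (s t : 'S_(N n)) x :
  mp_fun (level_transf (s * t)%g) x = mp_fun (level_transf t) (mp_fun (level_transf s) x).
Proof. exact: swapM. Qed.

Let level_transf_refine n (s : 'S_(N n)) : exists t : 'S_(N n.+1),
  mp_fun (level_transf t) =1 mp_fun (level_transf s).
Proof.
have [t tE] := xchg_refine s; exists t => x /=.
have [xX|nx] := pselect (coreX x); last by rewrite !swap_out.
by have [_ -> _] := swap_core t xX; have [_ -> _] := swap_core s xX; rewrite tE.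
Qed.

Let Nw_small r : 0 < r -> exists n0, forall n, (n0 <= n)%N -> (N n)%:R * w n ^+ 2 < r.
Proof.
move=> r0; exists (Num.truncn (c ^+ 2 / r)).+1 => n hn.
rewrite expr2 mulrA Nw /w /level_width.
(* The product is [c ^ 2 * L n / 4 ^ n], and [L n] absorbs at most one of the two factors
   [2 ^ n]. *)
apply: (@le_lt_trans _ _ (c ^+ 2 / 2 ^+ n)).
  rewrite (_ : (4 : R) = 2 * 2); last by ring.
  rewrite exprMn.
  have x0 : 0 < 2 ^+ n :> R by rewrite exprn_gt0.
  have := L_le n; rewrite -(ler_nat R) natrX; move: (2 ^+ n) x0 => x x0 Lx.
  rewrite (_ : _ * _ = c ^+ 2 / x * ((L n)%:R / x)); last by field; rewrite gt_eqF.
  rewrite ger_pMr ?divr_gt0 ?exprn_gt0//.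
  by rewrite ler_pdivrMr// mul1r.
rewrite ltr_pdivrMr ?exprn_gt0// mulrC -ltr_pdivrMr//.
apply: lt_le_trans (truncnS_gt _) _; rewrite -natrX ler_nat.
by apply: leq_trans hn _; apply/ltnW/ltn_expl.
Qed.

Lemma lebesgue_levy_group (p : R) (p1 : (1 <= p%:E)%E) :
  accessible_space (weak_aut mu p1) -> levy_group R (weak_aut mu p1).
Proof.
apply: (@levels_levy_group _ _ _ _ N w level_cell level_transf) => //.
by move=> n i j x [_ xi] [_ xj]; apply/val_inj; rewrite /= -xi -xj.
Qed.

End LevelConstruction.

Theorem theorem4p2 (R : realType) (d : measure_display) (X : measurableType d)
    (mu : {measure set X -> \bar R}) (p : R) (p1 : (1 <= p%:E)%E)
    (X_standard : standard_borel R X)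
    (mu_non_atomic : non_atomic mu)
    (mu_finite_or_sigma_finite : fin_num_fun mu \/ sigma_finite [set: X] mu) :
  levy_group R (weak_aut mu p1) /\ extremely_amenable (weak_aut mu p1).
Proof.
suff levy : levy_group R (weak_aut mu p1).
  by split=> //; exact: levy_extremely_amenable levy.
have mu_sf : sigma_finite [set: X] mu.
  by case: mu_finite_or_sigma_finite => // /fin_num_fun_sigma_finite; apply; rewrite measure0.
have [a [b [e [ma mb [me e_inj] mu_a baK]]]] :=
  lebesgue_model X_standard mu_non_atomic mu_sf.
have acc : accessible_space (weak_aut mu p1) by exact: weak_aut_accessible me e_inj mu_sf.
suff [c [L [c0 L_mono L_le LE]]] : exists (c : R) (L : nat -> nat),
    [/\ 0 < c, {homo L : m n / (m <= n)%N}, forall n, (L n <= 2 ^ n)%N &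
        forall u, range_itv mu u <-> 0 <= u /\ exists n, u < c * (L n)%:R].
  exact: (lebesgue_levy_group ma mb me e_inj mu_a baK c0 L_mono L_le LE acc).
have [M [M0 ME]] : exists M, (0 <= M)%E /\
    forall u, range_itv mu u = (0 <= u /\ (u%:E < M)%E).
  by exists (mu setT); split=> //; exact: measure_ge0.
(* Zero mass: no cells at any level. Finite mass [r]: one interval of length [r], only the mesh
   varies. Infinite mass: the level [n] covers [[0, n[]. *)
case: M M0 ME => [r| |]//.
- rewrite lee_fin le_eqVlt => /orP[/eqP<-|r0] ME.
    exists 1, (fun=> 0%N); split=> // u; rewrite ME mulr0 lte_fin.
    by split=> [[u0 u1]|[u0 [_ u1]]]; split=> //; exists 0%N.
  exists r, (fun=> 1%N); split=> // [n|u]; first by rewrite expn_gt0.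
  rewrite ME mulr1 lte_fin.
  by split=> [[u0 ur]|[u0 [_ ur]]]; split=> //; exists 0%N.
- move=> _ ME; exists 1, id; split=> // [n|u]; first exact/ltnW/ltn_expl.
  rewrite ME; split=> -[u0 _]; split=> //; last exact: ltry.
  by exists (Num.truncn u).+1; rewrite mul1r truncnS_gt.
Qed.
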